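(* Let $\Lambda$ be a row finite rank-$r$ graph with finite set of objects and no sources, satisfying the Kumjian–Pask aperiodicity condition. Let $X=\Lambda^\infty$ be its infinite path space with shifts $T^p$, let $O_\Lambda$ be its higher rank graph $C^*$-algebra with canonical shift maps $\Phi^p$, and let $\mathcal{C}\cong C(X)$ be the canonical commutative subalgebra of $O_\Lambda$. Let $\widetilde f\in\mathcal{C}$ be self-adjoint, corresponding to the real-valued function $f\in C(X)$. Then for every $p\in\mathbb{Z}_+^r$ $$P_{\Phi^p}(\widetilde f)=P_{\mathrm{top}}(f,T^p),$$ where the left side is the noncommutative (Neshveyev–Størmer) pressure of $\widetilde f$ with respect to $\Phi^p$ and the right side is the classical topological pressure.
   Context: Orders on $\mathbb{Z}_+^r$ ($\mathbb{Z}_+=\{0,1,2,\ldots\}$) are coordinatewise. Rank-$r$ graphs. A rank-$r$ graph $\Lambda$ is a small category with set of objects $\Lambda^0$ (identified with the morphisms of shape $0$), with origin and terminal maps $o,t:\Lambda\to\Lambda^0$ on morphisms (''words''), the product $uv$ being defined when $t(u)=o(v)$ (with $o(uv)=o(u)$, $t(uv)=t(v)$), together with a shape functor $\sigma$ from $\Lambda$ to the one-object category with morphisms $\mathbb{Z}_+^r$ (so $\sigma(uv)=\sigma(u)+\sigma(v)$), satisfying the factorisation property: every $w$ with $\sigma(w)=m+n$ is a unique product $w=uv$ with $\sigma(u)=m$, $\sigma(v)=n$, $t(u)=o(v)$. Put $\Lambda_m=\{w\in\Lambda:\sigma(w)=m\}$ and $\Lambda_m(\lambda)=\{w\in\Lambda_m:o(w)=\lambda\}$.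 $\Lambda$ is row finite if all $\Lambda_m(\lambda)$ are finite and has no sources if all $\Lambda_m(\lambda)$ are nonempty. Path space and shifts. $\Lambda^\infty$ is the set of families $x=(x_{(m,n)})_{m\le n}$ ($m,n\in\mathbb{Z}_+^r$) with $x_{(m,n)}\in\Lambda_{n-m}$ and $x_{(m,n)}=x_{(m,k)}x_{(k,n)}$ for all $m\le k\le n$; $o(x)=o(x_{(0,n)})$. It is a compact metrizable space in the topology generated by the cylinder sets $Z_u=\{x: x_{(0,\sigma(u))}=u\}$, $u\in\Lambda$. For $p\in\mathbb{Z}_+^r$, the continuous shift $T^p:\Lambda^\infty\to\Lambda^\infty$ is $T^p(x)_{(m,n)}=x_{(m+p,n+p)}$. Aperiodicity condition: for every $a\in\Lambda^0$ there is $x\in\Lambda^\infty$ with $o(x)=a$ such that for no $n\in\mathbb{Z}_+^r$ does $y=T^nx$ have a nonzero period, where $q\in\mathbb{Z}^r$ is a period of $y$ if $y_{(m+q,k+q)}=y_{(m,k)}$ for all $m\le k$ in $\mathbb{Z}_+^r$ with $m+q\ge0$. The algebra. $O_\Lambda$ is the universal $C^*$-algebra generated by operators $s_u$, $u\in\Lambda$, such that: (1) $\{s_a: a\in\Lambda^0\}$ are pairwise orthogonal projections; (2) $s_{uv}=s_us_v$ if $t(u)=o(v)$; (3) $s_u^*s_u=s_{t(u)}$; (4) $s_a=\sum_{\sigma(u)=n,\,o(u)=a}s_us_u^*$ for all $a\in\Lambda^0$, $n\in\mathbb{Z}_+^r$. Under the assumptions made it is unital and nuclear. For $p\in\mathbb{Z}_+^r$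 the canonical shift map is the unital completely positive (ucp) map $\Phi^p(Y)=\sum_{w\in\Lambda_p}s_wYs_w^*$. $\mathcal{C}$ is the commutative $C^*$-algebra generated by $\{s_ws_w^*:w\in\Lambda\}$; it is $*$-isomorphic to $C(X)$ via $s_us_u^*\mapsto\chi_{Z_u}$, and $\widetilde f\in\mathcal{C}$ denotes the element corresponding to $f\in C(X)$. Noncommutative pressure. Let $A$ be a nuclear unital $C^*$-algebra, $a=a^*\in A$, $\theta:A\to A$ ucp. For $\Omega\subset A$ finite and $n\in\mathbb{N}$ put $\Omega^{(n)}=\bigcup_{j=0}^n\theta^j(\Omega)$, $a^{(n)}=\sum_{j=0}^n\theta^j(a)$. $CPA(A,\Omega,\varepsilon)$ is the set of triples $(\phi,\psi,C)$ with $C$ a finite-dimensional $C^*$-algebra and $\phi:C\to A$, $\psi:A\to C$ ucp with $\|\phi\circ\psi(b)-b\|<\varepsilon$ for all $b\in\Omega$. With $\mathrm{Tr}$ the trace on $C$ that is $1$ on every minimal projection, put $Z_{\theta,n}(a,\Omega,\varepsilon)=\inf\{\mathrm{Tr}\,e^{\psi(a^{(n)})}:(\phi,\psi,C)\in CPA(A,\Omega^{(n)},\varepsilon)\}$, $P_\theta(a,\Omega,\varepsilon)=\limsup_{n\to\infty}\frac1n\log Z_{\theta,n}(a,\Omega,\varepsilon)$ and $P_\theta(a)=\sup_{\varepsilon>0,\,\Omega}P_\theta(a,\Omega,\varepsilon)$, with $\Omega$ ranging over finite subsets of $A$. $P_{\mathrm{top}}(f,T)$ is the usual topological pressure of a continuous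 function $f$ for a continuous self-map $T$ of a compact metric space (as in Walters' book). *)

(* Defs.v *)
From HB Require Import structures.
From mathcomp Require Import all_boot all_order all_algebra.
From mathcomp Require Import complex.
From mathcomp Require Import all_classical all_reals all_analysis.

Set Implicit Arguments.
Unset Strict Implicit.
Unset Printing Implicit Defensive.

Import Order.TTheory GRing.Theory Num.Theory.
Import numFieldNormedType.Exports.

Local Open Scope classical_set_scope.
Local Open Scope ring_scope.
Local Open Scope complex_scope.

(** * Rank-r graphs *)

(* Z_+^r; the additive structure is the pointwise one of finite functions. *)
Notation deg r := {ffun 'I_r -> nat}.

(* Boolean, so that proofs of [le_deg m n] are unique. *)
Definition le_deg (r : nat) (m n : deg r) : bool := [forall i, (m i <= n i)%N].

Lemma le_deg_refl (r : nat) (m : deg r) : le_deg m m.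
Proof. exact/forallP. Qed.

Lemma le0_deg (r : nat) (m : deg r) : le_deg 0 m.
Proof. by apply/forallP => i; rewrite ffunE. Qed.

Lemma le_degD (r : nat) (m n p : deg r) :
  le_deg m n -> le_deg (m + p) (n + p).
Proof.
by move=> /forallP mn; apply/forallP => i; rewrite !ffunE leq_add2r.
Qed.

(* Objects are identified with the words of shape 0 (their identities), so
   origin and terminus are themselves words.  The value [kmul u v] is
   unconstrained unless [trm u = org v]. *)
Record kGraph (r : nat) := KGraph {
  word :> choiceType;
  kshape : word -> deg r;
  org : word -> word;
  trm : word -> word;
  kmul : word -> word -> word;
  shape_org : forall w, kshape (org w) = 0;
  shape_trm : forall w, kshape (trm w) = 0;
  org_id : forall a, kshape a = 0 -> org a = a;
  trm_id : forall a, kshape a = 0 -> trm a = a;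
  org_mul : forall u v, trm u = org v -> org (kmul u v) = org u;
  trm_mul : forall u v, trm u = org v -> trm (kmul u v) = trm v;
  kmul1l : forall w, kmul (org w) w = w;
  kmul1r : forall w, kmul w (trm w) = w;
  kmulA : forall u v w, trm u = org v -> trm v = org w ->
    kmul u (kmul v w) = kmul (kmul u v) w;
  shape_mul : forall u v, trm u = org v ->
    kshape (kmul u v) = kshape u + kshape v;
  factorisation : forall (w : word) (m n : deg r), kshape w = m + n ->
    exists! uv : word * word,
      [/\ kshape uv.1 = m, kshape uv.2 = n, trm uv.1 = org uv.2
        & w = kmul uv.1 uv.2]
}.

Section Graphs.
Variables (r : nat) (L : kGraph r).

Definition words_of (m : deg r) : set L := [set w | kshape w = m].

Definition objects : set L := words_of 0.

Definition words_from (m : deg r) (a : L) : set L :=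
  [set w | kshape w = m /\ org w = a].

Definition row_finite : Prop :=
  forall (m : deg r) (a : L), objects a -> finite_set (words_from m a).

Definition no_sources : Prop :=
  forall (m : deg r) (a : L), objects a -> words_from m a !=set0.

(* The condition [shape x_(m,n) = n - m] is written without subtraction. *)
Record infpath := Path {
  seg : forall m n : deg r, le_deg m n -> L;
  seg_shape : forall m n (mn : le_deg m n), m + kshape (seg mn) = n;
  seg_mul : forall m k n (mk : le_deg m k) (kn : le_deg k n)
      (mn : le_deg m n),
    trm (seg mk) = org (seg kn) /\ seg mn = kmul (seg mk) (seg kn)
}.

Definition origin (x : infpath) : L := org (seg x (le_deg_refl 0)).

Definition cylinder (u : L) : set infpath :=
  [set x | seg x (le0_deg (kshape u)) = u].

Lemma path_shift_shape (p : deg r) (x : infpath) (m n : deg r)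
    (mn : le_deg m n) :
  m + kshape (seg x (le_degD p mn)) = n.
Proof.
have /ffunP e := seg_shape x (le_degD p mn).
by apply/ffunP => i; have := e i; rewrite !ffunE addrAC; exact: addIn.
Qed.

Definition path_shift (p : deg r) (x : infpath) : infpath :=
  @Path (fun m n mn => seg x (le_degD p mn))
    (@path_shift_shape p x)
    (fun m k n mk kn mn =>
       seg_mul x (le_degD p mk) (le_degD p kn) (le_degD p mn)).

Definition period (y : infpath) (q : {ffun 'I_r -> int}) : Prop :=
  forall (m k m' k' : deg r) (mk : le_deg m k) (mk' : le_deg m' k'),
    (forall i, (m' i)%:Z = (m i)%:Z + q i) ->
    (forall i, (k' i)%:Z = (k i)%:Z + q i) ->
    seg y mk' = seg y mk.

Definition aperiodic : Prop :=
  forall a : L, objects a -> exists x : infpath,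
    origin x = a /\
    forall (n : deg r) (q : {ffun 'I_r -> int}),
      q != 0 -> ~ period (path_shift n x) q.

HB.instance Definition _ := gen_eqMixin infpath.
HB.instance Definition _ := gen_choiceMixin infpath.
HB.instance Definition _ :=
  isSubBaseTopological.Build infpath (range cylinder) id.

End Graphs.
Arguments words_of {r} L m _.
Arguments objects {r} L _.

(** * C*-algebras *)

(* Unital C*-algebras over C = R[i]: a Banach space with a product, a unit (the
   zero algebra is allowed) and an involution.  The norm has values in the
   nonnegative reals of R[i]. *)
Record cStarAlgType (R : realType) := CStarAlg {
  cs_space : completeNormedModType R[i];
  cs_one : cs_space;
  cs_mul : cs_space -> cs_space -> cs_space;
  cs_star : cs_space -> cs_space;
  cs_mulA : associative cs_mul;
  cs_mul1l : left_id cs_one cs_mul;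
  cs_mul1r : right_id cs_one cs_mul;
  cs_mulDl : left_distributive cs_mul +%R;
  cs_mulDr : right_distributive cs_mul +%R;
  cs_scale_mull : forall (z : R[i]) a b, z *: cs_mul a b = cs_mul (z *: a) b;
  cs_scale_mulr : forall (z : R[i]) a b, z *: cs_mul a b = cs_mul a (z *: b);
  cs_star_star : involutive cs_star;
  cs_star_add : {morph cs_star : a b / a + b};
  cs_star_scale : forall (z : R[i]) a, cs_star (z *: a) = z^* *: cs_star a;
  cs_star_mul : forall a b, cs_star (cs_mul a b) = cs_mul (cs_star b) (cs_star a);
  cs_norm_mul : forall a b, `|cs_mul a b| <= `|a| * `|b|;
  cs_norm_star_mul : forall a, `|cs_mul (cs_star a) a| = `|a| ^+ 2
}.

(* MathComp has no structure joining rings and normed modules below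
   [numDomainType]; both are declared on this carrier. *)
Definition cs_carrier (R : realType) (A : cStarAlgType R) : Type := cs_space A.
Coercion cs_carrier : cStarAlgType >-> Sortclass.

HB.instance Definition _ (R : realType) (A : cStarAlgType R) :=
  CompleteNormedModule.copy (cs_carrier A) (cs_space A).
HB.instance Definition _ (R : realType) (A : cStarAlgType R) :=
  GRing.Zmodule_isPzRing.Build (cs_carrier A) (@cs_mulA R A)
    (@cs_mul1l R A) (@cs_mul1r R A) (@cs_mulDl R A) (@cs_mulDr R A).

Definition star (R : realType) (A : cStarAlgType R) (a : A) : A :=
  @cs_star R A a.
Arguments star {R A} a.

Section CStar.
Variables (R : realType).
Implicit Types A B C : cStarAlgType R.

(* Norm-closed *-subalgebras, not required to contain the unit. *)
Definition cstar_subalgebra A (S : set A) : Prop :=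
  closed S /\ S 0 /\
  (forall (z : R[i]) (a b : A), S a -> S b -> S (z *: a + b)) /\
  (forall a b : A, S a -> S b -> S (a * b)) /\
  (forall a : A, S a -> S (star a)).

Definition cstar_gen A (G : set A) : set A := smallest (@cstar_subalgebra A) G.

Definition star_hom A B (pi : A -> B) : Prop :=
  [/\ linear pi, forall a b, pi (a * b) = pi a * pi b
    & forall a, pi (star a) = star (pi a)].

Definition is_projection A (e : A) : Prop := star e = e /\ e * e = e.

Definition minimal_projection A (e : A) : Prop :=
  [/\ is_projection e, e != 0
    & forall q : A, is_projection q -> e * q = q -> q = 0 \/ q = e].

Definition finite_dimensional A : Prop :=
  exists b : seq A, forall a : A, exists c : 'I_(size b) -> R[i],
    a = \sum_(i < size b) c i *: b`_i.

(* The trace of a finite-dimensional C*-algebra with value 1 on every minimal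
   projection; these properties determine it. *)
Definition canonical_trace C (tr : {scalar C}) : Prop :=
  (forall a b : C, tr (a * b) = tr (b * a)) /\
  (forall e : C, minimal_projection e -> tr e = 1).

Definition cstar_exp A (a : A) : A :=
  lim (series (fun k => (k`!%:R : R[i])^-1 *: a ^+ k) @ \oo).

(* Positivity in the C*-algebra M_n(A): elements of the form y^* y. *)
Definition mx_positive A (n : nat) (x : 'M[A]_n) : Prop :=
  exists y : 'M[A]_n, x = (map_mx star y)^T *m y.

Definition completely_positive A B (phi : A -> B) : Prop :=
  forall (n : nat) (x : 'M[A]_n), mx_positive x -> mx_positive (map_mx phi x).

Definition ucp A B (phi : A -> B) : Prop :=
  [/\ linear phi, phi 1 = 1 & completely_positive phi].

(** * Noncommutative pressure *)

Definition CPA A (Omega : set A) (eps : R) C (phi : C -> A) (psi : A -> C)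
    : Prop :=
  [/\ finite_dimensional C, ucp phi, ucp psi
    & forall b, Omega b -> `|phi (psi b) - b| < eps%:C].

Section Pressure.
Variables (A : cStarAlgType R) (theta : A -> A).

Definition orbit_set (Omega : set A) (n : nat) : set A :=
  \bigcup_(j in [set j | (j <= n)%N]) (iter j theta @` Omega).

Definition orbit_sum (a : A) (n : nat) : A :=
  \sum_(j < n.+1) iter j theta a.

(* [psi (orbit_sum a n)] is self-adjoint when [a] is, and then the trace of
   its exponential is real. *)
Definition ncZ (a : A) (Omega : set A) (eps : R) (n : nat) : \bar R :=
  ereal_inf [set z | exists (C : cStarAlgType R) (phi : C -> A)
    (psi : A -> C) (tr : {scalar C}),
    [/\ CPA (orbit_set Omega n) eps phi psi, canonical_trace tr
      & z = (complex.Re (tr (cstar_exp (psi (orbit_sum a n)))))%:E]].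

Definition ncP (a : A) (Omega : set A) (eps : R) : \bar R :=
  limn_esup (fun n => ((n%:R^-1)%:E * lne (ncZ a Omega eps n))%E).

Definition nc_pressure (a : A) : \bar R :=
  ereal_sup [set z | exists (eps : R) (Omega : set A),
    [/\ 0 < eps, finite_set Omega & z = ncP a Omega eps]].

End Pressure.
End CStar.

(** * Topological pressure (Walters, via spanning sets) *)

Section TopologicalPressure.
Variables (R : realType) (X : choiceType) (d : X -> X -> R).
Variables (f : X -> R) (T : X -> X).

Definition spanning (n : nat) (eps : R) (F : set X) : Prop :=
  forall x, exists2 y, F y &
    forall i, (i < n)%N -> d (iter i T x) (iter i T y) <= eps.

Definition birkhoff_sum (n : nat) (x : X) : R := \sum_(i < n) f (iter i T x).

Definition topQ (n : nat) (eps : R) : \bar R :=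
  ereal_inf [set (\sum_(x \in F) expR (birkhoff_sum n x))%:E |
    F in [set F | finite_set F /\ spanning n eps F]].

Definition top_pressure : \bar R :=
  lim ((fun eps : R =>
    limn_esup (fun n => ((n%:R^-1)%:E * lne (topQ n eps))%E)) @ 0^'+).

End TopologicalPressure.

Definition compatible_metric (R : realType) (X : topologicalType)
    (d : X -> X -> R) : Prop :=
  [/\ forall x y, d x y = 0 <-> x = y,
      forall x y, d x y = d y x,
      forall x y z, d x z <= d x y + d y z
    & forall (x : X) (U : set X), nbhs x U <->
        exists2 eps : R, 0 < eps & [set y | d x y < eps] `<=` U].

(** * The C*-algebra of a rank-r graph *)

Section GraphAlgebra.
Variables (R : realType) (r : nat) (L : kGraph r).

Definition graph_family (B : cStarAlgType R) (s : L -> B) : Prop :=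
  (forall a, objects L a -> is_projection (s a)) /\
  (forall a b, objects L a -> objects L b -> a <> b -> s a * s b = 0) /\
  (forall u v, trm u = org v -> s (kmul u v) = s u * s v) /\
  (forall u, star (s u) * s u = s (trm u)) /\
  (forall (a : L) (n : deg r), objects L a ->
    s a = \sum_(u \in words_from n a) s u * star (s u)).

(* [O] is generated by [s] and universal.  Testing universality on unital [B],
   with *-homomorphisms that need not preserve the units, loses nothing: any
   C*-algebra embeds in its unitization. *)
Definition graph_algebra (O : cStarAlgType R) (s : L -> O) : Prop :=
  [/\ graph_family s,
      cstar_gen (range s) = setT
    & forall (B : cStarAlgType R) (t : L -> B), graph_family t ->
        exists2 pi : O -> B, star_hom pi & forall u, pi (s u) = t u].

Variables (O : cStarAlgType R) (s : L -> O).

Definition canonical_shift (p : deg r) (Y : O) : O :=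
  \sum_(w \in words_of L p) s w * Y * star (s w).

Definition diag_alg : set O := cstar_gen (range (fun w => s w * star (s w))).

(* [kappa], restricted to [diag_alg], is the *-isomorphism onto C(X) that maps
   s_u s_u^* to the indicator function of the cylinder Z_u. *)
Definition diagonal_iso (kappa : O -> infpath L -> R[i]^o) : Prop :=
  set_bij diag_alg [set g | continuous g] kappa /\
  (forall (z : R[i]) (a b : O) x, diag_alg a -> diag_alg b ->
    kappa (z *: a + b) x = z * kappa a x + kappa b x) /\
  (forall (a b : O) x, diag_alg a -> diag_alg b ->
    kappa (a * b) x = kappa a x * kappa b x) /\
  (forall (a : O) x, diag_alg a -> kappa (star a) x = (kappa a x)^*) /\
  (forall u x, kappa (s u * star (s u)) x = \1_(cylinder u) x).

End GraphAlgebra.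

(* Main.v *)
Require Import Defs.
From HB Require Import structures.
From mathcomp Require Import all_boot all_order all_algebra.
From mathcomp Require Import complex finmap.
From mathcomp Require Import all_classical all_reals all_analysis.
From mathcomp Require Import ring lra zify.

(* Approximate f by a function c of the first N coordinates of a path, and let
   Z(n) be the sum, over the words w of shape np + N, of the exponential of the
   sum of c along w.  Since cylinders and small balls are comparable, the
   topological pressure is the exponential growth rate of Z(n), up to the error
   of the approximation.  The noncommutative pressure has the same growth rate.

   States.  Along an aperiodic path starting at a, the compressions
   s_v^* b s_v by the initial words v tend to multiples of s_t(v); the factor is
   a state tau_a that vanishes on s_u s_v^* when the shapes of u and v differ.

   Upper bound.  Index matrices by the words u whose shape lies in a large box
   translated by np + N, and put psi(a)_uv = tau_t(u)(s_u^* a s_v) if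
   t(u) = t(v), and 0 otherwise; phi(x) is the average of the x_uv s_u s_v^*.
   Then phi psi multiplies Phi^j(s_u s_v^* ) by the proportion of the box that
   survives a shift by the difference of the shapes, which is close to 1, and psi
   maps the orbit sum of f to a diagonal matrix whose exponential has trace at
   most a constant times Z(n).

   Lower bound.  Given unital completely positive maps psi : O -> C and
   phi : C -> O with phi psi close to the identity on the orbit, every word w
   gives a functional tau_t(w)(s_w^* phi(.) s_w) on C, which we weigh by its term
   in Z(n).  The elements psi(Phi^kl(s_v s_v^* )), v of shape lp + N, form a
   measurement that recovers the k-th block of w with small error.  Comparing
   errors of quantum and classical discrimination (Nussbaum and Szkola), each
   such measurement costs a bounded amount of entropy, so the mixture of these
   functionals has almost the entropy of the weights; Gibbs' variational principle
   then bounds Tr e^psi(.) from below by Z(n), up to a factor of small growth. *)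

Set Implicit Arguments.
Unset Strict Implicit.
Unset Printing Implicit Defensive.

Import Order.TTheory GRing.Theory Num.Theory.
Import numFieldNormedType.Exports.

Local Open Scope classical_set_scope.
Local Open Scope ring_scope.
Local Open Scope complex_scope.

(** * Positive elements of C*-algebras *)

(** The maps [phi] and [psi] of the lower bound are arbitrary, so the elements that measure
    different times need not commute, and no single measurement reads a whole word. They are used
    one after another, and each use may lose entropy. Letter by letter this would cost a fixed
    amount per unit of time, hence blocks of length l: a loss is
    [- ln eps + 6 * eps * ln (2 * K) + 1], where the number K of possible blocks is at most
    exponential in l, so per unit of time it is about 6 eps times the growth rate of words, plus a
    term of order 1/l. Therefore eps is fixed before l.

    In the upper bound s_u^* s_v need not vanish when the shapes of u and v differ. The states tau_a
    repair this: they make psi unital, and for the image of s_u s_v^* under Phi^j they let only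
    those pairs of shapes contribute that differ as the shapes of u and v do. That difference does
    not depend on j, so a box of one fixed side serves all times; only its position moves with n,
    and the additional words multiply Z(n) by a constant. *)

Section ComplexNorm.
Variable R : realType.
Implicit Types z w : R[i].

(** Norms take values in [R[i]]. Their real parts, [nc] here and [nrm] for algebras, are real
    numbers, on which [lra], suprema and square roots work. *)
Definition nc z : R := complex.Re `|z|.

Lemma ncE z : `|z| = (nc z)%:C.
Proof. by rewrite /nc normc_def. Qed.

Lemma nc_ge0 z : 0 <= nc z.
Proof. by rewrite -ler0c -ncE. Qed.

Lemma ncM z w : nc (z * w) = nc z * nc w.
Proof. by apply: complexI; rewrite -ncE normrM !ncE -rmorphM. Qed.

Lemma nc_real (t : R) : nc t%:C = `|t|.
Proof. by rewrite /nc normc_def /= expr0n addr0 sqrtr_sqr. Qed.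

Lemma nc_i : nc 'i = 1.
Proof. by rewrite /nc normc_def /= expr0n add0r expr1n sqrtr1. Qed.

Lemma ler_Re_nc z : `|complex.Re z| <= nc z.
Proof. by rewrite -lecR -ncE normc_ge_Re. Qed.

Lemma ler_Im_nc z : `|complex.Im z| <= nc z.
Proof.
by have := ler_Re_nc (z * 'i); rewrite ncM nc_i mulr1 ReiNIm normrN.
Qed.

Lemma nc_le z : nc z <= `|complex.Re z| + `|complex.Im z|.
Proof.
rewrite -lecR -ncE {1}(complexE z) (le_trans (ler_normD _ _))// normrM.
by rewrite !ncE !nc_real nc_i mul1r -rmorphD lexx.
Qed.

Lemma ncN z : nc (- z) = nc z. Proof. by rewrite /nc normrN. Qed.

Lemma ncD z w : nc (z + w) <= nc z + nc w.
Proof. by rewrite -lecR rmorphD/= -!ncE ler_normD. Qed.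

Lemma nc_eq0 z : (nc z == 0) = (z == 0).
Proof. by rewrite -(normr_eq0 z) ncE -(inj_eq (@complexI R)). Qed.

Lemma nc_sqr z : conjc z * z = (nc z ^+ 2)%:C.
Proof. by rewrite mulrC -sqr_normc ncE rmorphXn. Qed.

End ComplexNorm.

Section Norm.
Variables (R : realType) (A : cStarAlgType R).
Implicit Types a b c : A.

Definition nrm a : R := complex.Re `|a|.

Lemma nrmE a : `|a| = (nrm a)%:C.
Proof.
rewrite /nrm; have := normr_ge0 a; rewrite lecE => /andP[/eqP h _].
by case: `|a| h => x y /= ->.
Qed.

Lemma nrm_ge0 a : 0 <= nrm a.
Proof. by rewrite -ler0c -nrmE. Qed.

Lemma nrm0 : nrm 0 = 0.
Proof. by rewrite /nrm normr0. Qed.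

Lemma nrm_eq0 a : (nrm a == 0) = (a == 0).
Proof. by rewrite -(normr_eq0 a) nrmE -(inj_eq (@complexI R)). Qed.

Lemma nrm0_eq0 a : nrm a = 0 -> a = 0.
Proof. by move=> /eqP; rewrite nrm_eq0 => /eqP. Qed.

Lemma nrmN a : nrm (- a) = nrm a. Proof. by rewrite /nrm normrN. Qed.

Lemma nrmD a b : nrm (a + b) <= nrm a + nrm b.
Proof. by rewrite -lecR rmorphD/= -!nrmE ler_normD. Qed.

Lemma nrmB a b : nrm (a - b) <= nrm a + nrm b.
Proof. by rewrite (le_trans (nrmD _ _))// nrmN. Qed.

Lemma nrm_distC a b : nrm (a - b) = nrm (b - a).
Proof. by rewrite -nrmN opprB. Qed.

Lemma nrm_dist_add c a b : nrm (a - b) <= nrm (a - c) + nrm (c - b).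
Proof. by rewrite (le_trans _ (nrmD _ _))// addrA subrK. Qed.

Lemma nrmZ (z : R[i]) a : nrm (z *: a) = nc z * nrm a.
Proof. by apply: complexI; rewrite -nrmE normrZ ncE nrmE -rmorphM. Qed.

Lemma nrmZr (t : R) a : nrm (t%:C *: a) = `|t| * nrm a.
Proof. by rewrite nrmZ nc_real. Qed.

Lemma nrmM a b : nrm (a * b) <= nrm a * nrm b.
Proof.
rewrite -lecR rmorphM/= -!nrmE.
exact: (@cs_norm_mul R A a b).
Qed.

Lemma nrm_sum (I : Type) (r : seq I) (P : pred I) (F : I -> A) :
  nrm (\sum_(i <- r | P i) F i) <= \sum_(i <- r | P i) nrm (F i).
Proof.
elim/big_rec2: _ => [|i y x _ h]; first by rewrite nrm0.
by rewrite (le_trans (nrmD _ _))// lerD2l.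
Qed.

Lemma starK a : star (star a) = a.
Proof. exact: (@cs_star_star R A a). Qed.

Lemma starD a b : star (a + b) = star a + star b.
Proof. exact: (@cs_star_add R A a b). Qed.

Lemma starZ z a : star (z *: a) = conjc z *: star a.
Proof. exact: (@cs_star_scale R A z a). Qed.

Lemma starM a b : star (a * b) = star b * star a.
Proof. exact: (@cs_star_mul R A a b). Qed.

Lemma star0 : star (0 : A) = 0.
Proof. by apply: (@addrI _ (star 0)); rewrite -starD !addr0. Qed.

Lemma starN a : star (- a) = - star a.
Proof. by apply/eqP; rewrite -addr_eq0 -starD addNr star0. Qed.

Lemma starB a b : star (a - b) = star a - star b.
Proof. by rewrite starD starN. Qed.

Lemma starZr (t : R) a : star (t%:C *: a) = t%:C *: star a.
Proof. by rewrite starZ conjc_real. Qed.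

Lemma star_sum (I : Type) (r : seq I) (P : pred I) (F : I -> A) :
  star (\sum_(i <- r | P i) F i) = \sum_(i <- r | P i) star (F i).
Proof. by elim/big_rec2: _ => [|i y x _ <-]; rewrite ?star0 ?starD. Qed.

Lemma star1 : star (1 : A) = 1.
Proof. by rewrite -[LHS]mulr1 -{2}(starK 1) -starM mulr1 starK. Qed.

Lemma nrm_starM a : nrm (star a * a) = nrm a ^+ 2.
Proof.
apply: complexI; rewrite -nrmE rmorphXn/= -nrmE.
exact: (@cs_norm_star_mul R A a).
Qed.

Lemma nrm_sa a : star a = a -> nrm (a * a) = nrm a ^+ 2.
Proof. by move=> h; rewrite -nrm_starM h. Qed.

(** |b|^2 = |b^* b| <= |b^*| |b|; dividing by |b| and exchanging b with b^* gives both
    inequalities. *)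
Lemma nrm_star a : nrm (star a) = nrm a.
Proof.
have H b : nrm b <= nrm (star b).
  have [->|b0] := eqVneq (nrm b) 0; first exact: nrm_ge0.
  have b1 : 0 < nrm b by rewrite lt_neqAle eq_sym b0 nrm_ge0.
  by rewrite -(ler_pM2r b1) -expr2 -nrm_starM nrmM.
by apply/eqP; rewrite eq_le H -{2}(starK a) H.
Qed.

(** Only an inequality, since the zero algebra is allowed; otherwise |1| is a nonzero solution of t
    = t^2. *)
Lemma nrm1_le : nrm 1 <= 1.
Proof.
have := nrm_starM 1; rewrite star1 mulr1 => h.
have [->//|n0] := eqVneq (nrm 1) 0.
by suff -> : nrm 1 = 1 by []; apply: (mulfI n0); rewrite mulr1 -expr2 -h.
Qed.

Lemma scalerAle (z : R[i]) a b : z *: (a * b) = (z *: a) * b.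
Proof. exact: (@cs_scale_mull R A z a b). Qed.

Lemma scalerAre (z : R[i]) a b : z *: (a * b) = a * (z *: b).
Proof. exact: (@cs_scale_mulr R A z a b). Qed.

Lemma nrm_rs_le (t : R) : 0 <= t -> nrm (t%:C *: (1 : A)) <= t.
Proof.
by move=> t0; rewrite nrmZr ger0_norm// -[leRHS]mulr1 ler_wpM2l// nrm1_le.
Qed.

Definition cvgs (u : nat -> A) (l : A) : Prop :=
  forall e : R, 0 < e -> exists N, forall n, (N <= n)%N -> nrm (u n - l) < e.

Lemma cvgs_cvg (u : nat -> A) l : cvgs u l <-> u n @[n --> \oo] --> l.
Proof.
split=> [h|/cvgrPdist_lt h].
  apply/cvgrPdist_lt => e e0.
  have := e0; rewrite ltcE /= => /andP[/eqP e1 e2].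
  have [N hN] := h _ e2; exists N => // n /= Nn.
  rewrite distrC nrmE ltcE /= -e1 eqxx /=.
  exact: hN.
move=> e e0.
have ec : 0 < e%:C by rewrite ltcR.
have [N _ hN] := h _ ec; exists N => n Nn.
have := hN n Nn.
by rewrite /= distrC nrmE ltcR.
Qed.

Lemma cauchys_cvgs (u : nat -> A) :
  (forall e : R, 0 < e -> exists N, forall n m, (N <= n)%N -> (N <= m)%N ->
     nrm (u n - u m) < e) -> exists l, cvgs u l.
Proof.
move=> h.
have /cvg_ex[l hl] : cvg (u n @[n --> \oo]).
  apply: (@cauchy_cvg (cs_space A)); apply: cauchy_exP => e e0.
  have := e0; rewrite ltcE /= => /andP[/eqP e1 e2].
  have [N hN] := h _ e2.
  exists (u N), N => // n /= Nn.
  rewrite -ball_normE /=.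
  have := hN N n (leqnn _) Nn; rewrite -ltcR -nrmE => hh.
  apply: (lt_le_trans hh).
  by rewrite lecE /= -e1 eqxx lexx.
by exists l; apply/cvgs_cvg.
Qed.

Lemma closed_cvgs (S : set A) (u : nat -> A) l :
  closed S -> (forall n, S (u n)) -> cvgs u l -> S l.
Proof.
move=> cS uS /cvgs_cvg h.
apply: (@closed_cvg _ _ \oo _ u S) h => //.
by exists 0%N.
Qed.

Lemma cvgs_uniq (u : nat -> A) l l' : cvgs u l -> cvgs u l' -> l = l'.
Proof.
move=> h h'; apply/eqP; rewrite -subr_eq0 -nrm_eq0 eq_le nrm_ge0 andbT.
apply/ler_addgt0Pr => e e0.
have e2 : 0 < e / 2 by rewrite divr_gt0.
have [N hN] := h _ e2; have [M hM] := h' _ e2.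
rewrite add0r (splitr e) (le_trans (nrm_dist_add (u (N + M)%N) _ _))//.
by rewrite nrm_distC lerD// ltW// ?hN ?hM ?leq_addr ?leq_addl.
Qed.

Lemma closed_nrmP (S : set A) :
  (forall a, (forall e : R, 0 < e -> exists2 b, S b & nrm (a - b) < e) -> S a) ->
  closed S.
Proof.
move=> h a aS; apply: h => e e0.
have ec : 0 < e%:C by rewrite ltcR.
have [b [Sb ab]] := aS _ (nbhsx_ballx a e%:C ec).
exists b => //; have := ab.
by rewrite -ball_normE /= nrmE ltcR.
Qed.

End Norm.

(** * Square roots by successive approximation *)

Section Sqrt.
Variables (R : realType) (A : cStarAlgType R).
Implicit Types a b c x y : A.

Definition rs (t : R) : A := t%:C *: (1 : A).

Lemma rs_mull (t : R) a : rs t * a = t%:C *: a.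
Proof. by rewrite -scalerAle mul1r. Qed.

Lemma rs_mulr (t : R) a : a * rs t = t%:C *: a.
Proof. by rewrite -scalerAre mulr1. Qed.

Lemma rsD s t : rs (s + t) = rs s + rs t.
Proof. by rewrite /rs rmorphD scalerDl. Qed.

Lemma rs1 : rs 1 = 1. Proof. by rewrite /rs scale1r. Qed.

Lemma rs0 : rs 0 = 0. Proof. by rewrite /rs scale0r. Qed.

Lemma star_rs t : star (rs t) = rs t.
Proof. by rewrite starZr star1. Qed.

Lemma scale_rs (s t : R) : s%:C *: rs t = rs (s * t).
Proof. by rewrite scalerA -rmorphM. Qed.

Lemma nrm_rs t : 0 <= t -> nrm (rs t) <= t.
Proof. exact: nrm_rs_le. Qed.

(** Square roots are produced together with their membership in every such set that contains the
    given element. For a commutant this says that the root commutes with whatever the element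
    commutes with; for [diag_alg], that it stays diagonal. *)
Definition unital_closed_subalg (S : set A) : Prop :=
  [/\ closed S, S 1, forall (z : R[i]) a b, S a -> S b -> S (z *: a + b)
    & forall a b, S a -> S b -> S (a * b)].

Lemma closed_commutant c : closed [set a : A | c * a = a * c].
Proof.
apply: closed_nrmP => a h /=; apply/eqP; rewrite -subr_eq0 -nrm_eq0.
rewrite eq_le nrm_ge0 andbT; apply/ler_addgt0Pr => e e0.
have c0 : 0 < 2 * nrm c + 1 by rewrite ltr_wpDl// mulr_ge0// nrm_ge0.
have [b /= cb ab] := h _ (divr_gt0 e0 c0).
have -> : c * a - a * c = c * (a - b) - (a - b) * c.
  by rewrite mulrBr mulrBl cb opprB addrA subrK.
rewrite add0r (le_trans (nrmB _ _))//.
rewrite (le_trans (lerD (nrmM _ _) (nrmM _ _)))//.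
rewrite [X in _ + X]mulrC -mulr2n -mulr_natl mulrA.
apply: (@le_trans _ _ (2 * nrm c * (e / (2 * nrm c + 1)))).
  by rewrite ler_wpM2l ?mulr_ge0 ?nrm_ge0// ltW.
rewrite mulrCA ler_piMr// ?(ltW e0)// ler_pdivrMr// mul1r lerDl.
exact: ler01.
Qed.

Lemma commutant_subalg c : unital_closed_subalg [set a : A | c * a = a * c].
Proof.
split; first exact: closed_commutant.
- by rewrite /= mulr1 mul1r.
- move=> z a b /= ca cb.
  by rewrite mulrDr mulrDl -scalerAle -scalerAre ca cb.
- by move=> a b /= ca cb; rewrite mulrA ca -mulrA cb mulrA.
Qed.

Lemma closed_sa : closed [set a : A | star a = a].
Proof.
apply: closed_nrmP => a h /=; apply/eqP; rewrite -subr_eq0 -nrm_eq0.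
rewrite eq_le nrm_ge0 andbT; apply/ler_addgt0Pr => e e0.
have e2 : 0 < e / 2 by rewrite divr_gt0.
have [b /= sb ab] := h _ e2.
rewrite add0r (splitr e) (le_trans (nrm_dist_add b _ _))// lerD//; last first.
  by rewrite nrm_distC ltW.
by rewrite -{1}sb -starB nrm_star ltW.
Qed.

Section Iteration.
Variable x : A.
Hypothesis x1 : nrm x <= 1.

Let hf : R := 2^-1.

(** A fixed point w of y -> (x + y^2) / 2 satisfies (1 - w)^2 = 1 - x. [rsqrt_iter] is the same
    iteration at the number 1 and majorizes both the norms of the iterates and their increments. *)
Fixpoint sqrt_iter n : A :=
  if n is m.+1 then hf%:C *: (x + sqrt_iter m * sqrt_iter m) else 0.

Fixpoint rsqrt_iter n : R :=
  if n is m.+1 then hf * (1 + rsqrt_iter m ^+ 2) else 0.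

Let hf0 : 0 <= hf. Proof. by rewrite invr_ge0. Qed.

Lemma rsqrt_iter_bound n : 0 <= rsqrt_iter n <= 1.
Proof.
elim: n => [|n /andP[h0 h1]] /=; first by rewrite lexx ler01.
by rewrite /hf; apply/andP; split; nra.
Qed.

Lemma sqrt_iter_bound n : nrm (sqrt_iter n) <= rsqrt_iter n.
Proof.
elim: n => [|n ih] /=; first by rewrite nrm0.
rewrite nrmZr ger0_norm// ler_wpM2l// (le_trans (nrmD _ _))// lerD//.
by rewrite (le_trans (nrmM _ _))// expr2 ler_pM// nrm_ge0.
Qed.

Lemma sqrt_iter_step n :
  nrm (sqrt_iter n.+1 - sqrt_iter n) <= rsqrt_iter n.+1 - rsqrt_iter n.
Proof.
elim: n => [|n ih].
  rewrite /= !subr0 expr0n addr0 mul0r addr0 mulr1 nrmZr ger0_norm//.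
  by rewrite ler_piMr.
rewrite [sqrt_iter n.+2]/= [X in _ - X]/= -scalerBr opprD addrACA subrr add0r.
rewrite nrmZr ger0_norm// [rsqrt_iter n.+2]/= [X in _ <= _ - X]/=.
rewrite -mulrBr ler_wpM2l// -/(sqrt_iter n.+1) -/(rsqrt_iter n.+1).
set v := sqrt_iter n.+1 in ih *; set w := sqrt_iter n in ih *.
have -> : v * v - w * w = v * (v - w) + (v - w) * w.
  by rewrite mulrBr mulrBl addrA subrK.
rewrite (le_trans (nrmD _ _))// (le_trans (lerD (nrmM _ _) (nrmM _ _)))//.
have hv := sqrt_iter_bound n.+1; have hw := sqrt_iter_bound n.
rewrite -/v -/w in hv hw.
have := nrm_ge0 v; have := nrm_ge0 w; have := nrm_ge0 (v - w).
set p := nrm (v - w) in ih *; set q := nrm v in hv *; set u := nrm w in hw *.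
move=> p0 u0 q0.
have -> : 1 + rsqrt_iter n.+1 ^+ 2 - (1 + rsqrt_iter n ^+ 2) =
  rsqrt_iter n.+1 * (rsqrt_iter n.+1 - rsqrt_iter n) +
  (rsqrt_iter n.+1 - rsqrt_iter n) * rsqrt_iter n by ring.
by apply: lerD; apply: ler_pM.
Qed.

Lemma sqrt_iter_dist n k :
  nrm (sqrt_iter (n + k) - sqrt_iter n) <= rsqrt_iter (n + k) - rsqrt_iter n.
Proof.
elim: k => [|k ih]; first by rewrite addn0 !subrr nrm0.
rewrite addnS (le_trans (nrm_dist_add (sqrt_iter (n + k)) _ _))//.
rewrite (le_trans (lerD (sqrt_iter_step _) ih))//.
by rewrite addrA subrK.
Qed.

Lemma rsqrt_iter_nd : {homo rsqrt_iter : n m / (n <= m)%N >-> n <= m}.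
Proof.
apply: homo_leq => [//|? ? ?|n]; first exact: le_trans.
by rewrite -subr_ge0 (le_trans _ (sqrt_iter_step n))// nrm_ge0.
Qed.

(** The majorant increases and is bounded by 1, so it is Cauchy, and the iterates are Cauchy with
    it. *)
Lemma sqrt_iter_cvg : exists w, cvgs sqrt_iter w.
Proof.
apply: cauchys_cvgs => e e0.
have : cvgn rsqrt_iter.
  apply: nondecreasing_is_cvgn; first exact: rsqrt_iter_nd.
  by exists 1 => _ [n _ <-]; case/andP: (rsqrt_iter_bound n).
move=> /cvg_ex[l] /cvgrPdist_lt hl.
have e4 : 0 < e / 4 by rewrite divr_gt0.
have [N _ hN] := hl _ e4.
have H n : (N <= n)%N -> nrm (sqrt_iter n - sqrt_iter N) < e / 2.
  move=> Nn; have := sqrt_iter_dist N (n - N); rewrite subnKC// => h.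
  apply: (le_lt_trans h).
  have := hN n Nn; have := hN N (leqnn N) => /=.
  rewrite !ltr_distl => /andP[? ?] /andP[? ?]; lra.
exists N => n m Nn Nm.
rewrite (le_lt_trans (nrm_dist_add (sqrt_iter N) _ _))// (splitr e).
by rewrite ltrD ?H// nrm_distC H.
Qed.

Lemma sqrt_iter_mem S n :
  unital_closed_subalg S -> S x -> S (sqrt_iter n).
Proof.
move=> [_ S1 Sl Sm] Sx.
have S0 : S 0 by have := Sl (-1) 1 1 S1 S1; rewrite scaleN1r addNr.
elim: n => [//|n ih] /=.
have := Sl hf%:C (x + sqrt_iter n * sqrt_iter n) 0; rewrite addr0; apply => //.
by have := Sl 1 x (sqrt_iter n * sqrt_iter n); rewrite scale1r; apply => //; exact: Sm.
Qed.

Lemma sqrt_iter_sa n : star x = x -> star (sqrt_iter n) = sqrt_iter n.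
Proof.
by move=> xs; elim: n => [|n ih] /=; rewrite ?star0// starZr starD xs starM ih.
Qed.

End Iteration.

(** The root is 1 - w for the limit w of the iteration. The bound |w| <= 1 is kept in the form |1 -
    y| <= 1 because this is what makes y positive. *)
Lemma sqrt1m x : star x = x -> nrm x <= 1 ->
  exists y, [/\ star y = y, y * y = 1 - x, nrm (1 - y) <= 1
    & forall S, unital_closed_subalg S -> S x -> S y].
Proof.
move=> xs x1.
have [w hw] := sqrt_iter_cvg x1.
have ws : star w = w.
  exact: (closed_cvgs closed_sa (fun n => sqrt_iter_sa n xs) hw).
have wb n : nrm (sqrt_iter x n) <= 1.
  rewrite (le_trans (sqrt_iter_bound x1 n))//.
  by case/andP: (rsqrt_iter_bound n).
have w1 : nrm w <= 1.
  apply/ler_addgt0Pr => e e0; have [N hN] := hw _ e0.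
  have := hN N (leqnn N); rewrite nrm_distC => /ltW h.
  rewrite -[w](subrK (sqrt_iter x N)) (le_trans (nrmD _ _))// addrC lerD//.
have wE : w = (2^-1)%:C *: (x + w * w).
  apply: (cvgs_uniq (u := fun n => sqrt_iter x n.+1)).
    move=> e e0; have [N hN] := hw _ e0; exists N => n Nn.
    by apply: hN; rewrite (leq_trans Nn).
  move=> e e0; have [N hN] := hw _ e0; exists N => n Nn.
  rewrite /= -scalerBr opprD addrACA subrr add0r nrmZr ger0_norm ?invr_ge0//.
  set v := sqrt_iter x n.
  have -> : v * v - w * w = v * (v - w) + (v - w) * w.
    by rewrite mulrBr mulrBl addrA subrK.
  apply: (@le_lt_trans _ _ (nrm (v - w))); last exact: hN.
  rewrite ler_pdivrMl// (le_trans (nrmD _ _))// mulr_natl mulr2n.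
  apply: lerD; rewrite (le_trans (nrmM _ _))//.
    by rewrite ler_piMl ?nrm_ge0// wb.
  by rewrite ler_piMr ?nrm_ge0.
exists (1 - w); split.
- by rewrite starB star1 ws.
- have w2 : w + w = x + w * w.
    rewrite {1 2}wE -scalerDl -rmorphD.
    by rewrite (_ : 2^-1 + 2^-1 = 1 :> R) ?scale1r//; field.
  have -> : (1 - w) * (1 - w) = 1 - w - (w - w * w).
    by rewrite mulrBl mul1r mulrBr mulr1.
  have -> : w * w = w + w - x by rewrite w2 addrC addKr.
  by rewrite opprB [w + w - x - w]addrAC addrK addrA subrK.
- by rewrite opprB addrC subrK.
- move=> S hS Sx.
  case: (hS) => Sc S1 Sl Sm.
  have Sw : S w by exact: (closed_cvgs Sc (fun n => sqrt_iter_mem n hS Sx) hw).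
  by have := Sl (-1) w 1 Sw S1; rewrite scaleN1r addrC.
Qed.

End Sqrt.

(** * The order on self-adjoint elements *)

Section Psd.
Variables (R : realType) (A : cStarAlgType R).
Implicit Types (a b c x y : A) (s t : R).
Local Notation rs := (@rs R A).

(* Equivalent to a self-adjoint spectrum in [0, +oo[; in this form sums of
   positive elements are visibly positive. *)
Definition psd a : Prop := star a = a /\ exists t, nrm (rs t - a) <= t.

Lemma scale_half a : (2^-1)%:C *: (a + a) = a.
Proof.
rewrite scalerDr -scalerDl -rmorphD (_ : 2^-1 + 2^-1 = 1 :> R) ?scale1r//.
by field.
Qed.

Lemma psd_sa a : psd a -> star a = a. Proof. by case. Qed.

Lemma psdD a b : psd a -> psd b -> psd (a + b).
Proof.
move=> [sa [s hs]] [sb [t ht]]; split; first by rewrite starD sa sb.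
by exists (s + t); rewrite rsD opprD addrACA (le_trans (nrmD _ _))// lerD.
Qed.

Lemma psd0 : psd (0 : A).
Proof. by split; [rewrite star0|exists 0; rewrite rs0 subrr nrm0]. Qed.

Lemma psdZ t a : 0 <= t -> psd a -> psd (t%:C *: a).
Proof.
move=> t0 [sa [s hs]]; split; first by rewrite starZr sa.
exists (t * s); rewrite -scale_rs -scalerBr nrmZr ger0_norm//.
exact: ler_wpM2l.
Qed.

Lemma psd_rs t : 0 <= t -> psd (rs t).
Proof. by move=> t0; split; [rewrite star_rs|exists t; rewrite subrr nrm0]. Qed.

Lemma psd1 : psd 1.
Proof. by rewrite -rs1; apply: psd_rs. Qed.

Lemma psd_sum (I : eqType) (r : seq I) (P : pred I) (F : I -> A) :
  (forall i, i \in r -> P i -> psd (F i)) -> psd (\sum_(i <- r | P i) F i).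
Proof.
move=> h; rewrite big_seq_cond; apply: big_ind => [||i /andP[]].
- exact: psd0.
- exact: psdD.
- exact: h.
Qed.

(** If |t - a| <= t with t > 0, then a = t (1 - x) with |x| <= 1, and [sqrt1m] applies; t = 0 forces
    a = 0. *)
Lemma psd_sqrt a : psd a ->
  exists b, [/\ star b = b, b * b = a, psd b
    & forall S, unital_closed_subalg S -> S a -> S b].
Proof.
move=> [sa [t ht]].
have t0 : 0 <= t by rewrite (le_trans _ ht)// nrm_ge0.
have [te|tn] := eqVneq t 0.
  have a0 : a = 0.
    apply: nrm0_eq0; apply/eqP; rewrite eq_le nrm_ge0 andbT.
    by move: ht; rewrite te rs0 sub0r nrmN.
  by exists 0; rewrite star0 mul0r a0; split => //; exact: psd0.
have tp : 0 < t by rewrite lt_neqAle eq_sym tn.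
pose x := (t^-1)%:C *: (rs t - a).
have xE : x = 1 - (t^-1)%:C *: a by rewrite /x scalerBr scale_rs mulVf// rs1.
have xs : star x = x by rewrite starZr starB star_rs sa.
have x1 : nrm x <= 1.
  by rewrite nrmZr ger0_norm ?invr_ge0// ler_pdivrMl// mulr1.
have [y [ys yy y1 yS]] := sqrt1m xs x1.
exists ((Num.sqrt t)%:C *: y); split.
- by rewrite starZr ys.
- rewrite -scalerAle -scalerAre scalerA -rmorphM -expr2 sqr_sqrtr// yy xE.
  by rewrite opprB addrC subrK scalerA -rmorphM mulfV// scale1r.
- apply: psdZ; first exact: sqrtr_ge0.
  by split=> //; exists 1; rewrite rs1.
- move=> S hS Sa; case: (hS) => Sc S1 Sl Sm.
  have S0 : S 0 by have := Sl (-1) 1 1 S1 S1; rewrite scaleN1r addNr.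
  have := Sl (Num.sqrt t)%:C y 0; rewrite addr0; apply => //.
  apply: yS => //.
  by rewrite xE addrC -scalerN -scaleN1r scalerA; apply: Sl.
Qed.

Lemma cartesian_sq b c : star b = b -> star c = c ->
  star (b + 'i *: c) * (b + 'i *: c) =
    b * b + c * c + 'i *: (b * c - c * b).
Proof.
move=> bs cs; rewrite starD starZ bs cs mulrDl !mulrDr -!scalerAle -!scalerAre.
rewrite !scalerA.
have -> : conjc 'i = - 'i :> R[i] by apply/eqP; rewrite eq_complex /= oppr0 !eqxx.
have -> : - 'i * 'i = 1 :> R[i] by rewrite mulNr -expr2 sqr_i opprK.
rewrite scale1r scaleNr scalerBr -!addrA; congr (_ + _).
by rewrite addrA addrC.
Qed.

(** For u = b + i c the commutator disappears, u^* u = b^2 + c^2, so |u|^2 <= t; and b is the real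
    part of u. *)
Lemma commuting_sq_le b c t : star b = b -> star c = c -> b * c = c * b ->
  0 <= t -> b * b + c * c = rs t -> nrm (b * b) <= t.
Proof.
move=> bs cs bc t0 h; pose u := b + 'i *: c.
have uu : nrm u ^+ 2 <= t.
  by rewrite -nrm_starM cartesian_sq// bc subrr scaler0 addr0 h nrm_rs.
have bE : b = (2^-1)%:C *: (u + star u).
  rewrite /u starD starZ bs cs.
  have -> : conjc 'i = - 'i :> R[i] by apply/eqP; rewrite eq_complex /= oppr0 !eqxx.
  by rewrite scaleNr addrACA subrr addr0 scale_half.
have bu : nrm b <= nrm u.
  rewrite bE nrmZr ger0_norm ?invr_ge0// ler_pdivrMl// mulr_natl mulr2n.
  by rewrite (le_trans (nrmD _ _))// nrm_star.
by rewrite nrm_sa// (le_trans _ uu)// lerXn2r ?nnegrE ?nrm_ge0.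
Qed.

(** Scale b to d with |d^2| <= 1 and let c be the root of 1 - d^2. It commutes with d, so
    [commuting_sq_le] gives |1 - d^2| = |c^2| <= 1, which is positivity of d^2. *)
Lemma psd_sq b : star b = b -> psd (b * b).
Proof.
move=> bs; pose M := nrm b + 1.
have M0 : 0 < M by rewrite ltr_wpDl ?nrm_ge0.
pose d := (M^-1)%:C *: b.
have ds : star d = d by rewrite starZr bs.
have d1 : nrm (d * d) <= 1.
  rewrite nrm_sa// expr_le1 ?nrm_ge0// nrmZr ger0_norm ?invr_ge0 ?(ltW M0)//.
  by rewrite ler_pdivrMl// mulr1 lerDl.
have dds : star (d * d) = d * d by rewrite starM ds.
have [c [cs cc _ cS]] := sqrt1m dds d1.
have dc : d * c = c * d.
  by apply: (cS _ (commutant_subalg d)); rewrite /= mulrA.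
have h : psd (d * d).
  split=> //; exists 1; rewrite rs1 -cc.
  by apply: (commuting_sq_le (c := d)); rewrite // ?dc// cc subrK rs1.
have -> : b * b = (M ^+ 2)%:C *: (d * d).
  rewrite -scalerAle -scalerAre !scalerA -!rmorphM.
  rewrite (_ : M ^+ 2 * _ * _ = 1) ?scale1r//.
  by field; rewrite gt_eqF.
by apply: psdZ => //; rewrite exprn_ge0// ltW.
Qed.

(** Two uses of the commutant: b commutes with z because x does, then c commutes with b because z
    does. *)
Lemma psd_sqrt_commuting x z : psd x -> psd z -> x * z = z * x ->
  exists b c, [/\ star b = b, star c = c, b * b = x, c * c = z & b * c = c * b].
Proof.
move=> px pz xz.
have [b [bs bb _ bS]] := psd_sqrt px; have [c [cs cc _ cS]] := psd_sqrt pz.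
exists b, c; split=> //.
have /= zb := bS _ (commutant_subalg z) (esym xz).
exact: (cS _ (commutant_subalg b) (esym zb)).
Qed.

Lemma psdM x z : psd x -> psd z -> x * z = z * x -> psd (x * z).
Proof.
move=> px pz xz; have [b [c [bs cs bb cc bc]]] := psd_sqrt_commuting px pz xz.
have -> : x * z = (b * c) * (b * c).
  by rewrite -bb -cc mulrA -(mulrA b b c) [in LHS]bc !mulrA.
by apply: psd_sq; rewrite starM bs cs.
Qed.

Lemma psd_nrm_le x t : 0 <= t -> psd x -> psd (rs t - x) -> nrm x <= t.
Proof.
move=> t0 px pt.
have [|b [c [bs cs bb cc bc]]] := psd_sqrt_commuting px pt.
  by rewrite mulrBr mulrBl rs_mull rs_mulr.
by rewrite -bb; apply: (commuting_sq_le bs cs bc t0); rewrite bb cc addrC subrK.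
Qed.

Lemma psd_rsB a t : star a = a -> nrm a <= t -> psd (rs t - a).
Proof.
move=> sa ht; split; first by rewrite starB star_rs sa.
by exists t; rewrite opprB addrC subrK.
Qed.

Lemma psd_rsD a t : star a = a -> nrm a <= t -> psd (rs t + a).
Proof.
by move=> sa ht; rewrite -[a]opprK; apply: psd_rsB; rewrite ?starN ?sa ?nrmN.
Qed.

Lemma psd_nrm_rsB a t : psd a -> nrm a <= t -> nrm (rs t - a) <= t.
Proof.
move=> pa ht; apply: psd_nrm_le; first by rewrite (le_trans _ ht)// nrm_ge0.
  by apply: psd_rsB => //; exact: psd_sa.
by rewrite opprB addrC subrK.
Qed.

Lemma psd_anti a : psd a -> psd (- a) -> a = 0.
Proof.
move=> pa pn; apply: nrm0_eq0; apply/eqP; rewrite eq_le nrm_ge0 andbT.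
by apply: psd_nrm_le => //; rewrite rs0 sub0r.
Qed.

Lemma psd_mono x z : psd x -> psd (z - x) -> nrm x <= nrm z.
Proof.
move=> px pzx; have pz : psd z by rewrite -(subrK x z); exact: psdD.
apply: psd_nrm_le; rewrite ?nrm_ge0//.
have -> : rs (nrm z) - x = (rs (nrm z) - z) + (z - x) by rewrite addrA subrK.
by apply: psdD => //; apply: psd_rsB => //; exact: psd_sa.
Qed.

(** t^2 - x^2 = (t + x) (t - x) is a product of commuting positive elements. *)
Lemma sa_nrm_le x t : 0 <= t -> star x = x -> psd (rs t + x) ->
  psd (rs t - x) -> nrm x <= t.
Proof.
move=> t0 xs p m.
rewrite -(@ler_pXn2r _ 2%N)// ?nnegrE ?nrm_ge0// -nrm_sa//.
apply: psd_nrm_le; rewrite ?exprn_ge0//; first exact: psd_sq.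
have -> : rs (t ^+ 2) - x * x = (rs t + x) * (rs t - x).
  by rewrite mulrDl !mulrBr rs_mull rs_mulr rs_mull scale_rs -expr2 addrA subrK.
apply: psdM => //.
rewrite mulrDl !mulrBr mulrBl !mulrDr !rs_mulr !rs_mull.
by rewrite addrA subrK opprD addrA addrK.
Qed.

(** A Bernoulli inequality in the order of the algebra. The bound P n >= g carries the induction:
    each step adds al g P n, which is at least al g^2. It supplies the growth in [star_mul_npsd]. *)
Lemma psd_ind_pow (al : R) g n : 0 <= al -> psd g ->
  let P n := (1 + al%:C *: g) ^+ n * g in
  [/\ GRing.comm g (P n), psd (P n - g) &
      psd (P n - (n%:R * al)%:C *: (g * g))].
Proof.
move=> al0 pg P.
have c1 : GRing.comm g (1 + al%:C *: g).
  by apply: commrD; [exact: commr1|rewrite /GRing.comm -scalerAle -scalerAre].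
have cP k : GRing.comm g (P k) by apply: commrM => //; exact: commrX.
have PS k : P k.+1 = P k + al%:C *: (g * P k).
  by rewrite /P exprS -mulrA mulrDl mul1r -scalerAle.
split=> //.
- elim: n => [|n ih]; first by rewrite /P expr0 mul1r subrr; exact: psd0.
  rewrite PS addrAC; apply: psdD => //; apply: psdZ => //.
  by apply: psdM; [|rewrite -(subrK g (P n)); exact: psdD|exact: cP].
- suff : psd (P n - g) /\ psd (P n - (n%:R * al)%:C *: (g * g)) by case.
  elim: n => [|n [ih1 ih2]].
    by rewrite mul0r scale0r subr0 /P expr0 mul1r subrr; split=> //; exact: psd0.
  split.
    rewrite PS addrAC; apply: psdD => //; apply: psdZ => //.
    by apply: psdM; [|rewrite -(subrK g (P n)); exact: psdD|exact: cP].
  have -> : P n.+1 - (n.+1%:R * al)%:C *: (g * g) =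
      (P n - (n%:R * al)%:C *: (g * g)) + al%:C *: (g * (P n - g)).
    rewrite PS -natr1 mulrDl mul1r rmorphD scalerDl mulrBr scalerBr.
    by rewrite opprD addrACA.
  apply: psdD => //; apply: psdZ => //; apply: psdM => //.
  by rewrite mulrBr mulrBl (cP n).
Qed.

(* Iterating [c c^* c = - c g] gives
   [(1 - al c c^* )^n c = c (1 + al g)^n]; the left side stays bounded while
   the norm of the right side grows like [sqrt n] unless [g = 0]. *)
Lemma star_mul_npsd c g : psd g -> star c * c = - g -> c = 0.
Proof.
move=> pg cg.
have [rc [ic [rs_ is_ cE]]] : exists a b, [/\ star a = a, star b = b & c = a + 'i *: b].
  exists ((2^-1)%:C *: (c + star c)), ((2^-1)%:C *: ('i *: (star c - c))).
  have ji : conjc 'i = - 'i :> R[i] by apply/eqP; rewrite eq_complex /= oppr0 !eqxx.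
  split; first by rewrite starZr starD starK addrC.
    by rewrite starZr starZ starB starK ji scaleNr -scalerN opprB.
  rewrite scalerA [_ * _%:C]mulrC -scalerA -scalerDr scalerA -expr2 sqr_i scaleN1r opprB.
  by rewrite addrA addrAC addrK scale_half.
(* With c = a + i b this sum is 2 (a^2 + b^2); adding g leaves c c^*, which is therefore
   positive. *)
have psum : psd (star c * c + c * star c).
  rewrite {1 2}cE cartesian_sq//.
  have -> : c * star c = rc * rc + ic * ic - 'i *: (rc * ic - ic * rc).
    have -> : c = star (rc + 'i *: - ic).
      rewrite cE starD starZ starN rs_ is_ scalerN -scaleNr; congr (_ + _ *: _).
      by apply/eqP; rewrite eq_complex /= oppr0 opprK !eqxx.
    rewrite starK cartesian_sq ?starN ?is_// mulrNN mulrN mulNr opprK.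
    by rewrite -scalerN opprB [- _ + _]addrC.
  rewrite addrACA subrr addr0.
  by do 3? [apply: psdD]; apply: psd_sq.
have pe : psd (c * star c).
  have -> : c * star c = (star c * c + c * star c) + g.
    by rewrite cg addrAC addNr add0r.
  exact: psdD.
pose e := c * star c; pose M := nrm e + 1.
have M0 : 0 < M by rewrite ltr_wpDl ?nrm_ge0.
pose al := M^-1; have al0 : 0 < al by rewrite invr_gt0.
have eM : nrm e <= M by rewrite lerDl.
have e1 : nrm (1 - al%:C *: e) <= 1.
  have -> : 1 - al%:C *: e = al%:C *: (rs M - e).
    by rewrite scalerBr scale_rs mulVf ?gt_eqF// rs1.
  by rewrite nrmZr ger0_norm ?(ltW al0)// ler_pdivrMl// mulr1 psd_nrm_rsB.
have shift n : (1 - al%:C *: e) ^+ n * c = c * (1 + al%:C *: g) ^+ n.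
  elim: n => [|n ih]; first by rewrite !expr0 mul1r mulr1.
  rewrite exprSr -mulrA mulrBl mul1r -scalerAle /e -mulrA cg mulrN scalerN opprK.
  have -> : c + al%:C *: (c * g) = c * (1 + al%:C *: g).
    by rewrite mulrDr mulr1 -scalerAre.
  by rewrite mulrA ih -mulrA exprSr.
have bound n : nrm (c * (1 + al%:C *: g) ^+ n) <= nrm c.
  rewrite -shift; elim: n => [|n ih]; first by rewrite expr0 mul1r.
  rewrite exprS -mulrA (le_trans (nrmM _ _))// (le_trans _ ih)//.
  by rewrite ler_piMl ?nrm_ge0.
have g2 : nrm (g * g) = 0.
  apply/eqP; rewrite eq_le nrm_ge0 andbT leNgt; apply/negP => gp.
  (* For n >= K the lower bound 2 n al |g^2| exceeds |c|^2. The exponent is doubled so that the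
     power splits, up to sign, as y^* y with y = c (1 + al g)^n. *)
  pose K := nrm c ^+ 2 / (al * nrm (g * g)) + 1.
  have [n Kn] : exists n, K <= n%:R.
    exists (Num.bound `|K|); apply/ltW.
    by apply: (le_lt_trans (ler_norm _)); rewrite archi_boundP.
  have [_ _ pn] := @psd_ind_pow al g (n + n) (ltW al0) pg.
  have := psd_mono _ pn.
  have -> : (1 + al%:C *: g) ^+ (n + n) * g =
      - (star (c * (1 + al%:C *: g) ^+ n) * (c * (1 + al%:C *: g) ^+ n)).
    rewrite starM -mulrA [star c * _]mulrA cg mulNr mulrN opprK.
    have -> : star ((1 + al%:C *: g) ^+ n) = (1 + al%:C *: g) ^+ n.
      elim: n {Kn pn} => [|n ih]; first by rewrite expr0 star1.
      by rewrite exprSr starM ih starD star1 starZr (psd_sa pg) -exprS exprSr.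
    have cg1 : GRing.comm g ((1 + al%:C *: g) ^+ n).
      apply: commrX; apply: commrD; first exact: commr1.
      by rewrite /GRing.comm -scalerAle -scalerAre.
    by rewrite exprD -mulrA cg1.
  rewrite nrmN nrm_starM nrmZr.
  have pgg : psd (g * g) by apply: psd_sq; exact: psd_sa.
  have nal : 0 <= (n + n)%:R * al by rewrite mulr_ge0// ltW.
  move=> /(_ (psdZ nal pgg)).
  rewrite ger0_norm// => h.
  have h2 : nrm (c * (1 + al%:C *: g) ^+ n) ^+ 2 <= nrm c ^+ 2.
    by rewrite lerXn2r ?nnegrE ?nrm_ge0.
  have := le_trans h h2; apply/negP; rewrite -ltNge natrD.
  have ag : 0 < al * nrm (g * g) by rewrite mulr_gt0.
  rewrite -mulrA -ltr_pdivrMr//.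
  have n0 : 0 <= n%:R :> R by [].
  by move: Kn; rewrite /K; lra.
have g0 : g = 0.
  have := nrm_sa (psd_sa pg); rewrite g2 => /esym/eqP.
  by rewrite expf_eq0 /= => /eqP/nrm0_eq0.
apply: nrm0_eq0; apply/eqP; have := nrm_starM c.
by rewrite cg g0 oppr0 nrm0 => /esym/eqP; rewrite expf_eq0.
Qed.

(* [g] is the negative part of [h]. *)
Lemma neg_part h : star h = h -> exists g,
  [/\ star g = g, psd (g * g * g), h * g = - (g * g) & g * g * g = 0 -> psd h].
Proof.
move=> hs.
have [k [ks kk pk kS]] := psd_sqrt (psd_sq hs).
have hk : h * k = k * h.
  by apply: (kS _ (commutant_subalg h)); rewrite /= mulrA.
pose hm := (2^-1)%:C *: (k - h); pose hp := (2^-1)%:C *: (k + h).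
have hpm : hp - hm = h.
  by rewrite -scalerBr opprB addrC addrA subrK scale_half.
have hphm : hp + hm = k.
  by rewrite -scalerDr addrACA addrC [h - h]subrr add0r scale_half.
have hms : star hm = hm by rewrite starZr starB ks hs.
have hpm0 : hp * hm = 0.
  rewrite -scalerAle -scalerAre mulrDl !mulrBr kk hk addrA subrK subrr.
  by rewrite !scaler0.
have [l [ls ll pl lS]] := psd_sqrt pk.
have khm : k * hm = hm * k.
  by rewrite /hm -scalerAle -scalerAre mulrBr mulrBl hk.
have lhm : hm * l = l * hm by exact: (lS _ (commutant_subalg hm) (esym khm)).
exists hm; split=> //.
- have -> : hm * hm * hm = (l * hm) * (l * hm).
    have -> : (l * hm) * (l * hm) = hm * (k * hm).
      by rewrite -{1}lhm -mulrA (mulrA l l) ll.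
    by rewrite -hphm mulrDl hpm0 add0r mulrA.
  by apply: psd_sq; rewrite starM ls hms lhm.
- by rewrite -hpm mulrBl hpm0 sub0r.
- move=> h3.
  have hm0 : hm = 0.
    have : nrm ((hm * hm) * (hm * hm)) = 0 by rewrite mulrA h3 mul0r nrm0.
    rewrite nrm_sa ?starM ?hms// nrm_sa// -exprM => /eqP.
    by rewrite expf_eq0 /= => /eqP/nrm0_eq0.
  by rewrite -hpm hm0 subr0 -(addr0 hp) -hm0 hphm.
Qed.

(** Kaplansky's argument: if g is the negative part of y^* y, then (y g)^* (y g) = - g^3, so y g = 0
    by [star_mul_npsd]; hence g^3 = 0 and the negative part is gone. *)
Theorem psd_starM y : psd (star y * y).
Proof.
have hs : star (star y * y) = star y * y by rewrite starM starK.
have [g [gs p3 hg]] := neg_part hs; apply.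
have E : star (y * g) * (y * g) = - (g * g * g).
  by rewrite starM gs -mulrA [star y * _]mulrA hg mulrN mulrA.
have := E; rewrite (star_mul_npsd p3 E) mulr0 => /esym/eqP.
by rewrite oppr_eq0 => /eqP.
Qed.

Lemma psd_sum_eq0 (I : finType) (F : I -> A) :
  (forall i, psd (F i)) -> \sum_i F i = 0 -> forall i, F i = 0.
Proof.
move=> pF s0 i; apply: nrm0_eq0; apply/eqP; rewrite eq_le nrm_ge0 andbT.
have := psd_mono (pF i) (z := \sum_i F i); rewrite s0 nrm0; apply.
rewrite -s0 (bigD1 i)//= addrAC subrr add0r.
by apply: psd_sum => j _ _.
Qed.

End Psd.

(** * Linear maps and positive unital maps *)

Section LinearFacts.
Variables (K : pzRingType) (U V : lmodType K) (f : U -> V).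
Hypothesis fl : linear f.

Lemma linf_D u v : f (u + v) = f u + f v.
Proof. by have := fl 1 u v; rewrite !scale1r. Qed.

Lemma linf_0 : f 0 = 0.
Proof. by apply: (@addrI _ (f 0)); rewrite -linf_D !addr0. Qed.

Lemma linf_Z z u : f (z *: u) = z *: f u.
Proof. by have := fl z u 0; rewrite linf_0 !addr0. Qed.

Lemma linf_N u : f (- u) = - f u.
Proof. by rewrite -scaleN1r linf_Z scaleN1r. Qed.

Lemma linf_B u v : f (u - v) = f u - f v.
Proof. by rewrite linf_D linf_N. Qed.

Lemma linf_sum (I : Type) (r : seq I) (P : pred I) (F : I -> U) :
  f (\sum_(i <- r | P i) F i) = \sum_(i <- r | P i) f (F i).
Proof. exact: (big_morph f linf_D linf_0). Qed.

End LinearFacts.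

Section PositiveMaps.
Variables (R : realType) (A B : cStarAlgType R) (th : A -> B).

Definition pos_unital : Prop :=
  [/\ linear th, th 1 = 1 & forall y, psd (th (star y * y))].

Hypothesis thP : pos_unital.

Let thl : linear th. Proof. by case: thP. Qed.

Lemma pos_unital_rs t : th (rs A t) = rs B t.
Proof. by rewrite /rs (linf_Z thl); case: thP => _ ->. Qed.

Lemma pos_unital_psd a : psd a -> psd (th a).
Proof.
move=> /psd_sqrt[b [bs <- _ _]]; rewrite -{1}bs; by case: thP.
Qed.

Lemma pos_unital_sa a : star a = a -> star (th a) = th a.
Proof.
move=> sa; have := psd_sa (pos_unital_psd (psd_rsB sa (lexx (nrm a)))).
by rewrite (linf_B thl) pos_unital_rs starB star_rs => /addrI/oppr_inj.
Qed.

Lemma pos_unital_nrm_sa a : star a = a -> nrm (th a) <= nrm a.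
Proof.
move=> sa; apply: sa_nrm_le; rewrite ?nrm_ge0 ?pos_unital_sa// -pos_unital_rs.
  by rewrite -(linf_D thl); apply: pos_unital_psd; exact: psd_rsD.
by rewrite -(linf_B thl); apply: pos_unital_psd; exact: psd_rsB.
Qed.

End PositiveMaps.

Section RealImag.
Variables (R : realType) (A : cStarAlgType R).

Lemma conjc_i : conjc 'i = - 'i :> R[i].
Proof. by apply/eqP; rewrite eq_complex /= oppr0 !eqxx. Qed.

Lemma cartesian (c : A) : exists a b : A,
  [/\ star a = a, star b = b, c = a + 'i *: b, nrm a <= nrm c & nrm b <= nrm c].
Proof.
exists ((2^-1)%:C *: (c + star c)), ((2^-1)%:C *: ('i *: (star c - c))).
have half2 x y : nrm x <= nrm c -> nrm y <= nrm c ->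
    nrm ((2^-1)%:C *: (x + y)) <= nrm c.
  move=> hx hy; rewrite nrmZr ger0_norm ?invr_ge0// ler_pdivrMl//.
  by rewrite mulr_natl mulr2n (le_trans (nrmD _ _))// lerD.
split.
- by rewrite starZr starD starK addrC.
- by rewrite starZr starZ starB starK conjc_i scaleNr -scalerN opprB.
- rewrite scalerA [_ * _%:C]mulrC -scalerA -scalerDr scalerA -expr2 sqr_i scaleN1r opprB.
  by rewrite addrA addrAC addrK scale_half.
- by apply: half2; rewrite ?nrm_star.
- by rewrite scalerBr; apply: half2; rewrite ?nrmN nrmZ nc_i mul1r ?nrm_star.
Qed.

End RealImag.

Section PositiveMaps2.
Variables (R : realType) (A B : cStarAlgType R) (th : A -> B).
Hypothesis thP : pos_unital th.
Let thl : linear th. Proof. by case: thP. Qed.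

(** The map is contractive on self-adjoint elements; the factor 2 comes from the real and imaginary
    parts. *)
Lemma pos_unital_nrm a : nrm (th a) <= 2 * nrm a.
Proof.
have [b [c [bs cs aE bn cn]]] := cartesian a.
rewrite {1}aE (linf_D thl) (linf_Z thl) (le_trans (nrmD _ _))// nrmZ nc_i mul1r.
rewrite mulr_natl mulr2n lerD// (le_trans (pos_unital_nrm_sa thP _))//.
Qed.

End PositiveMaps2.

(** * Completeness by sequences, and the complex numbers as an algebra *)

Section Complete.
Variables (R : realType) (V : normedModType R[i]).

(** A Cauchy filter contains a ball of radius 1 / (n + 1) for every n; the centres form a Cauchy
    sequence, whose limit is that of the filter. *)
Lemma complete_of_seq :
  (forall u : nat -> V, (forall e : R, 0 < e -> exists N, forall n m,
      (N <= n)%N -> (N <= m)%N -> `|u n - u m| < e%:C) ->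
    exists l, forall e : R, 0 < e -> exists N, forall n, (N <= n)%N ->
      `|u n - l| < e%:C) ->
  forall F : set_system V, ProperFilter F -> cauchy F -> cvg F.
Proof.
move=> h F FF /cauchyP Fc.
have n1 n : 0 < (n.+1%:R : R)^-1 by rewrite invr_gt0.
have H n : exists x : V, F (ball x (n.+1%:R^-1 : R)%:C).
  have [|x hx] := Fc (n.+1%:R^-1 : R)%:C; first by rewrite ltcR.
  by exists x.
have [u hu] := choice H.
have small (e : R) : 0 < e -> exists N, forall n, (N <= n)%N -> n.+1%:R^-1 < e.
  move=> e0; exists (Num.bound e^-1) => n Nn.
  rewrite invf_plt ?posrE//.
  have ei : 0 <= e^-1 by rewrite invr_ge0 ltW.
  have := archi_boundP ei.
  move=> /lt_le_trans; apply; rewrite ler_nat.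
  exact: leq_trans Nn _.
have [e e0|l hl] := h u.
  have [N hN] := small (e / 2) (divr_gt0 e0 (ltr0Sn _ _)).
  exists N => n m Nn Nm.
  have [x []] := filter_ex (filterI (hu n) (hu m)).
  rewrite -!ball_normE /= => hn hm.
  have -> : u n - u m = (u n - x) - (u m - x) by rewrite opprB addrA subrK.
  rewrite (le_lt_trans (ler_normB _ _))// (splitr e) rmorphD /=.
  apply: ltrD; [apply: lt_trans hn _|apply: lt_trans hm _]; rewrite ltcR hN//.
apply/cvg_ex; exists l; apply/cvgrPdist_lt => e e0.
have := e0; rewrite ltcE /= => /andP[/eqP e1 e2].
have eE : e = (complex.Re e)%:C by move: e1; case: (e) => ? ? /= ->.
have e4 : 0 < complex.Re e / 2 by rewrite divr_gt0.
have [N hN] := small _ e4; have [M hM] := hl _ e4.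
apply: filterS (hu (N + M)%N) => x; rewrite -ball_normE /= => hx.
have -> : l - x = (u (N + M)%N - x) - (u (N + M)%N - l).
  by rewrite opprB [RHS]addrC addrA subrK.
rewrite (le_lt_trans (ler_normB _ _))// eE (splitr (complex.Re e)) rmorphD /=.
apply: ltrD; last by apply: hM; rewrite leq_addl.
by apply: (lt_trans hx); rewrite ltcR hN// leq_addr.
Qed.

End Complete.

Lemma real_cauchy_cvg (R : realType) (u : nat -> R) :
  (forall e : R, 0 < e -> exists N, forall n m,
      (N <= n)%N -> (N <= m)%N -> `|u n - u m| < e) ->
  exists l, forall e : R, 0 < e -> exists N, forall n, (N <= n)%N ->
      `|u n - l| < e.
Proof.
move=> h.
have /cvg_ex[l /cvgrPdist_lt hl] : cvg (u n @[n --> \oo]).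
  apply: cauchy_cvg; apply: cauchy_exP => e e0.
  have [N hN] := h _ e0; exists (u N), N => // n /= Nn.
  by rewrite -ball_normE /=; apply: hN => //; exact: leqnn.
exists l => e e0; have [N _ hN] := hl _ e0; exists N => n Nn.
by rewrite distrC; exact: hN.
Qed.

Section ComplexAlg.
Variable R : realType.

Lemma complex_seq_complete (u : nat -> R[i]) :
  (forall e : R, 0 < e -> exists N, forall n m,
      (N <= n)%N -> (N <= m)%N -> `|u n - u m| < e%:C) ->
    exists l, forall e : R, 0 < e -> exists N, forall n, (N <= n)%N ->
      `|u n - l| < e%:C.
Proof.
move=> h.
have [e e0|a ha] := @real_cauchy_cvg R (fun n => complex.Re (u n)).
  have [N hN] := h _ e0; exists N => n m Nn Nm; rewrite -raddfB.
  apply: le_lt_trans (ler_Re_nc _) _.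
  by rewrite -ltcR -ncE; exact: hN.
have [e e0|b hb] := @real_cauchy_cvg R (fun n => complex.Im (u n)).
  have [N hN] := h _ e0; exists N => n m Nn Nm; rewrite -raddfB.
  apply: le_lt_trans (ler_Im_nc _) _.
  by rewrite -ltcR -ncE; exact: hN.
exists (a +i* b) => e e0; have e2 : 0 < e / 2 by rewrite divr_gt0.
have [N hN] := ha _ e2; have [M hM] := hb _ e2.
exists (N + M)%N => n Nn; rewrite ncE ltcR (le_lt_trans (nc_le _))// (splitr e).
rewrite !raddfB /=; apply: ltrD.
  by apply: hN; rewrite (leq_trans _ Nn)// leq_addr.
by apply: hM; rewrite (leq_trans _ Nn)// leq_addl.
Qed.

(* An alias, because [_^o] already carries the completeness of real types. *)
Definition cplx_space : Type := R[i]^o.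
HB.instance Definition _ := NormedModule.copy cplx_space (R[i]^o).
HB.instance Definition _ := Uniform_isComplete.Build cplx_space
  (@complete_of_seq R cplx_space complex_seq_complete).

Lemma cplx_norm_mul (a b : R[i]) : `|a * b| <= `|a| * `|b|.
Proof. by rewrite normrM. Qed.

Lemma cplx_norm_star_mul (a : R[i]) : `|conjc a * a| = `|a| ^+ 2.
Proof. by rewrite normrM normcJ expr2. Qed.

Lemma cplx_scale_mulr (z a b : R[i]) : z * (a * b) = a * (z * b).
Proof. by rewrite mulrCA. Qed.

Definition cplx : cStarAlgType R := @CStarAlg R cplx_space 1 *%R (@conjc R)
  (@mulrA R[i]) (@mul1r R[i]) (@mulr1 R[i]) (@mulrDl R[i]) (@mulrDr R[i])
  (@mulrA R[i]) cplx_scale_mulr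
  (@conjcK R) (@rmorphD _ _ (@conjc R)) (@rmorphM _ _ (@conjc R))
  (fun a b => etrans (rmorphM (@conjc R) a b) (mulrC _ _))
  cplx_norm_mul cplx_norm_star_mul.

End ComplexAlg.

(** * Matrix algebras and complete positivity *)

Section HilbertModule.
Variables (R : realType) (A : cStarAlgType R) (n : nat).
Implicit Types (xi eta : 'I_n -> A) (x y : 'M[A]_n).

Lemma psd_conj (x c : A) : psd x -> psd (star c * x * c).
Proof.
move=> /psd_sqrt[b [bs <- _ _]].
by rewrite mulrA -mulrA -{1}bs -starM; exact: psd_starM.
Qed.

(** A^n as a Hilbert module over A. Matrices act on it, and their operator norm is the C*-norm of
    M_n(A). *)
Definition inner xi eta : A := \sum_i star (xi i) * eta i.

Definition hnrm xi : R := Num.sqrt (nrm (inner xi xi)).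

Definition mxact x xi : 'I_n -> A := fun i => \sum_j x i j * xi j.

Definition mxstar x : 'M[A]_n := (map_mx star x)^T.

Lemma innerDr xi eta zeta :
  inner xi (fun i => eta i + zeta i) = inner xi eta + inner xi zeta.
Proof.
by rewrite /inner -big_split; apply: eq_bigr => i _; rewrite mulrDr.
Qed.

Lemma inner_star xi eta : star (inner xi eta) = inner eta xi.
Proof. by rewrite star_sum; apply: eq_bigr => i _; rewrite starM starK. Qed.

Lemma innerDl xi eta zeta :
  inner (fun i => eta i + zeta i) xi = inner eta xi + inner zeta xi.
Proof. by rewrite -inner_star innerDr starD !inner_star. Qed.

Lemma inner_mulr xi eta c : inner xi (fun i => eta i * c) = inner xi eta * c.
Proof. by rewrite /inner mulr_suml; apply: eq_bigr => i _; rewrite mulrA. Qed.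

Lemma inner_mull xi eta c : inner (fun i => eta i * c) xi = star c * inner eta xi.
Proof. by rewrite -inner_star inner_mulr starM inner_star. Qed.

Lemma psd_inner xi : psd (inner xi xi).
Proof. by apply: psd_sum => i _ _; exact: psd_starM. Qed.

Lemma hnrm_ge0 xi : 0 <= hnrm xi. Proof. exact: sqrtr_ge0. Qed.

Lemma hnrm_sqr xi : hnrm xi ^+ 2 = nrm (inner xi xi).
Proof. by rewrite sqr_sqrtr// nrm_ge0. Qed.

(** With c = <xi, eta>, t > |<xi, xi>| and b = - c / t, positivity of <eta + xi b, eta + xi b>
    yields <eta, eta> >= c^* c / t. Then t tends to |<xi, xi>|; the strict inequality keeps t
    positive. *)
Lemma inner_cauchy_schwarz xi eta : nrm (inner xi eta) <= hnrm xi * hnrm eta.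
Proof.
rewrite -(@ler_pXn2r _ 2%N)// ?nnegrE ?nrm_ge0 ?mulr_ge0 ?hnrm_ge0//.
rewrite exprMn !hnrm_sqr; set c := inner xi eta.
set X := nrm (inner xi xi); set Y := nrm (inner eta eta).
have H t : X < t -> nrm c ^+ 2 <= t * Y.
  move=> Xt; have t0 : 0 < t by rewrite (le_lt_trans _ Xt)// nrm_ge0.
  pose b : A := (- t^-1)%:C *: c.
  have E : inner (fun i => eta i + xi i * b) (fun i => eta i + xi i * b) =
      inner eta eta - (t^-1 + t^-1)%:C *: (star c * c) +
      (t^-1 * t^-1)%:C *: (star c * inner xi xi * c).
    rewrite innerDr !innerDl !inner_mulr !inner_mull -/c addrA.
    have -> : inner eta xi = star c by rewrite inner_star.
    rewrite /b starZr -!scalerAle -!scalerAre scalerA !rmorphN mulrNN !scaleNr.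
    rewrite -[_ - _ - _]addrA -opprD -scalerDl.
    by congr (_ - _ *: _ + _ *: _); rewrite -?rmorphD -?rmorphM.
  have pE := psd_inner (fun i => eta i + xi i * b); rewrite E in pE.
  have pc : psd (star c * (rs A t - inner xi xi) * c).
    by apply/psd_conj/psd_rsB; [exact: psd_sa (psd_inner _)|exact: ltW].
  have pt : psd (inner eta eta - (t^-1)%:C *: (star c * c)).
    have -> : inner eta eta - (t^-1)%:C *: (star c * c) =
      inner eta eta - (t^-1 + t^-1)%:C *: (star c * c) +
      (t^-1 * t^-1)%:C *: (star c * inner xi xi * c) +
      (t^-1 * t^-1)%:C *: (star c * (rs A t - inner xi xi) * c).
      rewrite -[RHS]addrA -scalerDr -mulrDl -mulrDr [_ + (_ - _)]addrC subrK.
      rewrite rs_mulr -scalerAle scalerA -rmorphM -mulrA mulVf ?gt_eqF// mulr1.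
      by rewrite rmorphD scalerDl opprD addrA subrK.
    apply: psdD => //; apply: psdZ => //.
    by rewrite mulr_ge0// invr_ge0 ltW.
  have := psd_mono _ pt; rewrite nrmZr nrm_starM.
  rewrite ger0_norm ?invr_ge0 ?(ltW t0)// ler_pdivrMl//.
  by apply; apply: psdZ; [rewrite invr_ge0 ltW|exact: psd_starM].
have Y0 : 0 <= Y by exact: nrm_ge0.
apply/ler_addgt0Pr => e e0.
have e1 : 0 < e / (Y + 1) by rewrite divr_gt0// ltr_wpDl.
apply: (le_trans (H (X + e / (Y + 1)) _)); first by rewrite ltrDl.
rewrite mulrDl lerD2l -mulrA ler_piMr// ?(ltW e0)// mulrC.
by rewrite ler_pdivrMr ?ltr_wpDl// mul1r lerDl.
Qed.

Lemma hnrmD xi eta : hnrm (fun i => xi i + eta i) <= hnrm xi + hnrm eta.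
Proof.
rewrite -(@ler_pXn2r _ 2%N)// ?nnegrE ?addr_ge0 ?hnrm_ge0//.
rewrite hnrm_sqr innerDr !innerDl sqrrD !hnrm_sqr.
rewrite (le_trans (nrmD _ _))// -!addrA.
rewrite (le_trans (lerD (nrmD _ _) (nrmD _ _)))//.
have h1 := inner_cauchy_schwarz xi eta; have h2 := inner_cauchy_schwarz eta xi.
by lra.
Qed.

Lemma hnrmZ (z : R[i]) xi : hnrm (fun i => z *: xi i) = nc z * hnrm xi.
Proof.
rewrite /hnrm.
have -> : inner (fun i => z *: xi i) (fun i => z *: xi i) =
    (nc z ^+ 2)%:C *: inner xi xi.
  rewrite /inner scaler_sumr; apply: eq_bigr => i _.
  by rewrite starZ -scalerAle -scalerAre scalerA nc_sqr.
rewrite nrmZr ger0_norm ?exprn_ge0 ?nc_ge0// sqrtrM ?exprn_ge0 ?nc_ge0//.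
by rewrite sqrtr_sqr ger0_norm ?nc_ge0.
Qed.

Lemma nrm_coord xi i : nrm (xi i) <= hnrm xi.
Proof.
rewrite -(@ler_pXn2r _ 2%N)// ?nnegrE ?nrm_ge0 ?hnrm_ge0// hnrm_sqr -nrm_starM.
apply: psd_mono; first exact: psd_starM.
rewrite /inner (bigD1 i)//= addrAC subrr add0r.
by apply: psd_sum => j _ _; exact: psd_starM.
Qed.

Lemma hnrm_le xi : hnrm xi <= \sum_i nrm (xi i).
Proof.
have s0 : 0 <= \sum_i nrm (xi i) by apply: sumr_ge0 => i _; exact: nrm_ge0.
rewrite -(@ler_pXn2r _ 2%N)// ?nnegrE ?hnrm_ge0// hnrm_sqr.
rewrite (le_trans (nrm_sum _ _ _))// expr2 mulr_suml ler_sum// => i _.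
rewrite nrm_starM expr2 ler_wpM2l ?nrm_ge0// (bigD1 i)//= lerDl.
by apply: sumr_ge0 => j _; exact: nrm_ge0.
Qed.

(** A crude bound by entries. It makes the supremum in [opnrm] finite and turns entrywise
    convergence into convergence in norm. *)
Definition mxbound x : R := \sum_i \sum_j nrm (x i j).

Lemma mxbound_ge0 x : 0 <= mxbound x.
Proof. by do 2 (apply: sumr_ge0 => ? _); exact: nrm_ge0. Qed.

Lemma mxact_bound x xi : hnrm (mxact x xi) <= mxbound x * hnrm xi.
Proof.
rewrite (le_trans (hnrm_le _))// /mxbound mulr_suml ler_sum// => i _.
rewrite (le_trans (nrm_sum _ _ _))// mulr_suml ler_sum// => j _.
by rewrite (le_trans (nrmM _ _))// ler_wpM2l ?nrm_ge0// nrm_coord.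
Qed.

Definition opnrm x : R := sup [set hnrm (mxact x xi) | xi in [set xi | hnrm xi <= 1]].

Let opset x := [set hnrm (mxact x xi) | xi in [set xi | hnrm xi <= 1]].

Lemma hnrm0 : hnrm (fun=> 0) = 0.
Proof. by rewrite /hnrm /inner big1 ?nrm0 ?sqrtr0// => i _; rewrite mulr0. Qed.

Let opset_ub x : ubound (opset x) (mxbound x).
Proof.
move=> _ [xi /= h <-]; rewrite (le_trans (mxact_bound _ _))//.
by rewrite ler_piMr ?mxbound_ge0.
Qed.

Let opset_sup x : has_sup (opset x).
Proof.
split; last by exists (mxbound x); exact: opset_ub.
by exists (hnrm (mxact x (fun=> 0))), (fun=> 0) => //=; rewrite hnrm0.
Qed.

Lemma opnrm_le_bound x : opnrm x <= mxbound x.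
Proof. by apply: ge_sup; [case: (opset_sup x)|exact: opset_ub]. Qed.

Lemma opnrm_ge0 x : 0 <= opnrm x.
Proof.
apply: le_trans (sup_upper_bound (opset_sup x) _); first exact: (hnrm_ge0 (mxact x (fun=> 0))).
by exists (fun=> 0) => //=; rewrite hnrm0.
Qed.

Lemma mxactZ x (z : R[i]) xi : mxact x (fun i => z *: xi i) = fun i => z *: mxact x xi i.
Proof.
apply/funext => i; rewrite /mxact scaler_sumr; apply: eq_bigr => j _.
by rewrite -scalerAre.
Qed.

Lemma opnrmP x xi : hnrm (mxact x xi) <= opnrm x * hnrm xi.
Proof.
have [h0|h0] := eqVneq (hnrm xi) 0.
  have -> : xi = fun=> 0.
    apply/funext => i; apply: nrm0_eq0; apply/eqP; rewrite eq_le nrm_ge0 andbT.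
    by rewrite -h0 nrm_coord.
  rewrite hnrm0 mulr0 (_ : mxact x _ = fun=> 0) ?hnrm0//.
  by apply/funext => i; rewrite /mxact big1// => j _; rewrite mulr0.
have hp : 0 < hnrm xi by rewrite lt_neqAle eq_sym h0 hnrm_ge0.
rewrite -ler_pdivrMr// mulrC.
pose eta i := ((hnrm xi)^-1)%:C *: xi i.
have etaE : hnrm eta = 1.
  by rewrite hnrmZ nc_real ger0_norm ?invr_ge0 ?hnrm_ge0// mulVf.
have : opset x (hnrm (mxact x eta)) by exists eta => //=; rewrite etaE.
move=> /(sup_upper_bound (opset_sup x)).
by rewrite mxactZ hnrmZ nc_real ger0_norm ?invr_ge0 ?hnrm_ge0.
Qed.

Lemma opnrm_le x t : 0 <= t ->
  (forall xi, hnrm (mxact x xi) <= t * hnrm xi) -> opnrm x <= t.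
Proof.
move=> t0 h; apply: ge_sup; first by case: (opset_sup x).
by move=> _ [xi /= hx <-]; rewrite (le_trans (h _))// ler_piMr.
Qed.

Lemma mxactD x y xi : mxact (x + y) xi = fun i => mxact x xi i + mxact y xi i.
Proof.
apply/funext => i; rewrite /mxact -big_split; apply: eq_bigr => j _ /=.
by rewrite mxE mulrDl.
Qed.

Lemma mxactM x y xi : mxact (x *m y) xi = mxact x (mxact y xi).
Proof.
apply/funext => i; rewrite /mxact.
under eq_bigr => j _ do rewrite mxE mulr_suml.
rewrite exchange_big /=; apply: eq_bigr => k _.
by rewrite mulr_sumr; apply: eq_bigr => j _; rewrite mulrA.
Qed.

Lemma inner_mxact x xi eta : inner (mxact x xi) eta = inner xi (mxact (mxstar x) eta).
Proof.
rewrite /inner /mxact; under eq_bigr => i _ do rewrite star_sum mulr_suml.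
rewrite exchange_big /=; apply: eq_bigr => j _.
rewrite mulr_sumr; apply: eq_bigr => i _.
by rewrite starM !mxE mulrA.
Qed.

Lemma nrm_entry x i j : nrm (x i j) <= opnrm x.
Proof.
pose e := fun k : 'I_n => if k == j then (1 : A) else 0.
have he : hnrm e <= 1.
  rewrite (le_trans (hnrm_le _))// (bigD1 j)//= big1 ?addr0 /e ?eqxx ?nrm1_le//.
  by move=> k /negPf ->; rewrite nrm0.
have -> : x i j = mxact x e i.
  rewrite /mxact (bigD1 j)//= big1 ?addr0 /e ?eqxx ?mulr1//.
  by move=> k /negPf ->; rewrite mulr0.
rewrite (le_trans (nrm_coord _ _))// (le_trans (opnrmP _ _))//.
by rewrite ler_piMr// opnrm_ge0.
Qed.

Lemma opnrmD x y : opnrm (x + y) <= opnrm x + opnrm y.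
Proof.
apply: opnrm_le => [|xi]; first by rewrite addr_ge0 ?opnrm_ge0.
by rewrite mxactD (le_trans (hnrmD _ _))// mulrDl lerD// opnrmP.
Qed.

Lemma opnrmM x y : opnrm (x *m y) <= opnrm x * opnrm y.
Proof.
apply: opnrm_le => [|xi]; first by rewrite mulr_ge0 ?opnrm_ge0.
rewrite mxactM (le_trans (opnrmP _ _))// -mulrA ler_wpM2l ?opnrm_ge0//.
exact: opnrmP.
Qed.

(** By Cauchy-Schwarz |y xi|^2 = |<xi, y^* y xi>| <= |y^* y| |xi|^2, hence |y|^2 <= |y^* y| and |y|
    <= |y^*|. The last bound, for x^* in place of y, gives the converse inequality. *)
Lemma opnrm_star_mul x : opnrm (mxstar x *m x) = opnrm x ^+ 2.
Proof.
have H y : opnrm y ^+ 2 <= opnrm (mxstar y *m y).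
  rewrite -[leRHS]sqr_sqrtr ?opnrm_ge0// lerXn2r ?nnegrE ?sqrtr_ge0 ?opnrm_ge0//.
  apply: opnrm_le => [|xi]; first exact: sqrtr_ge0.
  rewrite -(@ler_pXn2r _ 2%N)// ?nnegrE ?mulr_ge0 ?sqrtr_ge0 ?hnrm_ge0//.
  rewrite exprMn (sqr_sqrtr (opnrm_ge0 _)) hnrm_sqr inner_mxact -mxactM.
  rewrite (le_trans (inner_cauchy_schwarz _ _))// expr2 mulrCA.
  by rewrite ler_wpM2l ?hnrm_ge0// opnrmP.
have K y : opnrm y <= opnrm (mxstar y).
  have [->|y0] := eqVneq (opnrm y) 0; first exact: opnrm_ge0.
  have y1 : 0 < opnrm y by rewrite lt_neqAle eq_sym y0 opnrm_ge0.
  by rewrite -(ler_pM2r y1) -expr2 (le_trans (H _))// opnrmM.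
have xK : mxstar (mxstar x) = x by apply/matrixP => i j; rewrite !mxE starK.
apply/eqP; rewrite eq_le H andbT (le_trans (opnrmM _ _))// expr2.
by rewrite ler_wpM2r ?opnrm_ge0// -{2}xK K.
Qed.

End HilbertModule.

Section MatrixAlgebra.
Variables (R : realType) (A : cStarAlgType R) (n : nat).

(** A separate name for the type, to carry the operator norm. *)
Definition mxa : Type := 'M[A]_n.
HB.instance Definition _ := GRing.Zmodule.copy mxa 'M[A]_n.

Definition mxa_scale (z : R[i]) (x : mxa) : mxa := map_mx (fun a => z *: a) x.

Lemma mxa_scaleA a b v : mxa_scale a (mxa_scale b v) = mxa_scale (a * b) v.
Proof. by apply/matrixP => i j; rewrite !mxE scalerA. Qed.
Lemma mxa_scale1 : left_id 1 mxa_scale.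
Proof. by move=> v; apply/matrixP => i j; rewrite !mxE scale1r. Qed.
Lemma mxa_scaleDr : right_distributive mxa_scale +%R.
Proof. by move=> z u v; apply/matrixP => i j; rewrite !mxE scalerDr. Qed.
Lemma mxa_scaleDl v : {morph mxa_scale^~ v : a b / a + b}.
Proof. by move=> a b; apply/matrixP => i j; rewrite !mxE scalerDl. Qed.

HB.instance Definition _ := GRing.Zmodule_isLmodule.Build R[i] mxa
  mxa_scaleA mxa_scale1 mxa_scaleDr mxa_scaleDl.

Definition mxa_norm (x : mxa) : R[i] := (opnrm x)%:C.

Lemma mxa_normD x y : mxa_norm (x + y) <= mxa_norm x + mxa_norm y.
Proof. by rewrite -rmorphD lecR; exact: opnrmD. Qed.

Lemma mxa_normZ (z : R[i]) x : mxa_norm (z *: x) = `|z| * mxa_norm x.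
Proof.
rewrite ncE -rmorphM; congr (_%:C).
have E (w : R[i]) (y : mxa) xi : mxact (w *: y : mxa) xi = fun i => w *: mxact y xi i.
  apply/funext => i; rewrite /mxact scaler_sumr; apply: eq_bigr => j _.
  by rewrite mxE scalerAle.
have H (w : R[i]) (y : mxa) : opnrm (w *: y : mxa) <= nc w * opnrm y.
  apply: opnrm_le => [|xi]; first by rewrite mulr_ge0 ?nc_ge0 ?opnrm_ge0.
  by rewrite E hnrmZ -mulrA ler_wpM2l ?nc_ge0// opnrmP.
apply/eqP; rewrite eq_le H /=.
have [->|z0] := eqVneq z 0.
  have /eqP -> : nc (0 : R[i]) == 0 by rewrite nc_eq0.
  by rewrite mul0r opnrm_ge0.
have ncz : 0 < nc z by rewrite lt_neqAle eq_sym nc_eq0 z0 nc_ge0.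
rewrite -ler_pdivlMl//.
have := H z^-1 (z *: x); rewrite scalerA mulVf// scale1r.
suff -> : nc z^-1 = (nc z)^-1 by [].
apply: (mulfI (lt0r_neq0 ncz)); rewrite -ncM !mulfV ?(lt0r_neq0 ncz)//.
by rewrite -[1]/(1%:C) nc_real normr1.
Qed.

Lemma mxa_norm0_eq0 x : mxa_norm x = 0 -> x = 0.
Proof.
move=> /complexI h; apply/matrixP => i j; rewrite [RHS]mxE.
apply: (@nrm0_eq0 R A); apply/eqP.
by rewrite eq_le nrm_ge0 andbT -h nrm_entry.
Qed.

HB.instance Definition _ := Lmodule_isNormed.Build R[i] mxa
  mxa_normD mxa_normZ mxa_norm0_eq0.

Lemma mxa_complete (u : nat -> mxa) :
  (forall e : R, 0 < e -> exists N, forall n m,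
      (N <= n)%N -> (N <= m)%N -> `|u n - u m| < e%:C) ->
    exists l, forall e : R, 0 < e -> exists N, forall n, (N <= n)%N ->
      `|u n - l| < e%:C.
Proof.
move=> h.
have hE (x : mxa) e : (`|x| < e%:C) = (opnrm x < e) by rewrite -ltcR.
have H ij : exists l, cvgs (fun k => u k ij.1 ij.2) l.
  apply: cauchys_cvgs => e e0; have [N hN] := h _ e0.
  exists N => k m Nk Nm; apply: le_lt_trans (_ : opnrm (u k - u m) < e).
    by have := nrm_entry (u k - u m) ij.1 ij.2; rewrite !mxE.
  by rewrite -hE; exact: hN.
have [l hl] := choice H.
exists (\matrix_(i, j) l (i, j)) => e e0.
pose K : R := (#|{: 'I_n * 'I_n}|)%:R + 1.
have K0 : 0 < K by rewrite ltr_wpDl.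
have eK : 0 < e / K by rewrite divr_gt0.
have H2 ij : exists N, forall k, (N <= k)%N -> nrm (u k ij.1 ij.2 - l ij) < e / K.
  exact: hl.
have [N hN] := choice H2.
exists (\sum_ij N ij)%N => k Nk; rewrite hE.
apply: le_lt_trans (opnrm_le_bound _) _.
rewrite /mxbound pair_big /=.
apply: (@le_lt_trans _ _ (\sum_(ij : 'I_n * 'I_n) e / K)).
  apply: ler_sum => ij _; rewrite !mxE -surjective_pairing ltW// hN//.
  by rewrite (leq_trans _ Nk)// (bigD1 ij)//= leq_addr.
rewrite sumr_const -mulr_natl mulrCA gtr_pMr// ltr_pdivrMr// mul1r ltrDl.
exact: ltr01.
Qed.

HB.instance Definition _ := Uniform_isComplete.Build mxa
  (@complete_of_seq R mxa mxa_complete).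

Lemma mxa_scale_mull (z : R[i]) (a b : mxa) :
  z *: (a *m b : mxa) = ((z *: a : mxa) *m b).
Proof.
apply/matrixP => i j; rewrite !mxE scaler_sumr; apply: eq_bigr => k _.
by rewrite mxE scalerAle.
Qed.

Lemma mxa_scale_mulr (z : R[i]) (a b : mxa) :
  z *: (a *m b : mxa) = (a *m (z *: b : mxa)).
Proof.
apply/matrixP => i j; rewrite !mxE scaler_sumr; apply: eq_bigr => k _.
by rewrite mxE scalerAre.
Qed.

Lemma mxa_star_star : involutive (@mxstar R A n).
Proof. by move=> x; apply/matrixP => i j; rewrite !mxE starK. Qed.

Lemma mxa_star_add (a b : mxa) : mxstar (a + b) = mxstar a + mxstar b.
Proof. by apply/matrixP => i j; rewrite !mxE starD. Qed.

Lemma mxa_star_scale (z : R[i]) (a : mxa) :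
  mxstar (z *: a : mxa) = (conjc z *: (mxstar a : mxa) : mxa).
Proof. by apply/matrixP => i j; rewrite !mxE starZ. Qed.

Lemma mxa_star_mul (a b : mxa) : mxstar (a *m b) = mxstar b *m mxstar a.
Proof.
apply/matrixP => i j; rewrite !mxE star_sum; apply: eq_bigr => k _.
by rewrite starM !mxE.
Qed.

Lemma mxa_norm_mul (a b : mxa) : `|a *m b : mxa| <= `|a| * `|b|.
Proof. by rewrite -rmorphM lecR; exact: opnrmM. Qed.

Lemma mxa_norm_star_mul (a : mxa) : `|mxstar a *m a : mxa| = `|a| ^+ 2.
Proof.
by rewrite [LHS](_ : _ = (opnrm (mxstar a *m a))%:C)// opnrm_star_mul rmorphXn.
Qed.

Definition mxC : cStarAlgType R := @CStarAlg R mxa (1%:M : 'M[A]_n)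
  (@mulmx A n n n) (@mxstar R A n) (@mulmxA A n n n n) (@mul1mx A n n)
  (@mulmx1 A n n) (fun a b c => mulmxDl a b c) (fun a b c => mulmxDr a b c)
  mxa_scale_mull mxa_scale_mulr mxa_star_star mxa_star_add mxa_star_scale
  mxa_star_mul mxa_norm_mul mxa_norm_star_mul.

End MatrixAlgebra.

(** * Positive matrices and completely positive maps *)

Section MatrixPositivity.
Variables (R : realType) (A : cStarAlgType R) (n : nat).

Lemma mx_positiveP (x : 'M[A]_n) : mx_positive x <-> psd (x : mxC A n).
Proof.
split=> [[y ->]|/psd_sqrt[b [bs <- _ _]]].
  exact: (@psd_starM R (mxC A n) y).
by exists b; rewrite -{1}bs.
Qed.

Lemma mxC_mulE (x y : mxC A n) i j : (x * y) i j = \sum_k x i k * y k j.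
Proof. by rewrite [LHS]mxE. Qed.

Lemma mxC_starE (x : mxC A n) i j : (star x) i j = star (x j i).
Proof. by rewrite [LHS]mxE mxE. Qed.

Lemma mxC_psd_diag (x : mxC A n) i : psd x -> psd (x i i).
Proof.
move=> /psd_sqrt[b [bs <- _ _]]; rewrite -{1}bs mxC_mulE.
by apply: psd_sum => k _ _; rewrite mxC_starE; exact: psd_starM.
Qed.

(** If g is the negative part of x, testing with column j of g gives - (g^3)_jj >= 0. So the
    positive matrix g^3 has zero diagonal, and a positive matrix with zero diagonal is zero. *)
Lemma mxC_psd_inner (x : mxC A n) : star x = x ->
  (forall xi : 'I_n -> A, psd (inner xi (mxact x xi))) -> psd x.
Proof.
move=> xs h; have [g [gs p3 xg]] := neg_part xs; apply.
have [y [ys yy _ _]] := psd_sqrt p3.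
have d0 j : (g * g * g) j j = 0.
  apply: psd_anti; first exact: mxC_psd_diag.
  have := h (fun i => g i j).
  have -> : inner (fun i => g i j) (mxact x (fun i => g i j)) =
      (star g * (x * g)) j j.
    rewrite mxC_mulE; apply: eq_bigr => i _; rewrite mxC_starE; congr (_ * _).
    by rewrite mxC_mulE.
  by rewrite gs xg mulrN mulrA mxE.
have y0 k j : y k j = 0.
  have s0 : \sum_k star (y k j) * y k j = 0.
    have <- : (g * g * g) j j = \sum_k star (y k j) * y k j.
      by rewrite -yy -{1}ys mxC_mulE; apply: eq_bigr => i _; rewrite mxC_starE.
    exact: d0.
  have := psd_sum_eq0 (fun k => psd_starM (y k j)) s0 k.
  move=> /(congr1 (@nrm R A)); rewrite nrm_starM nrm0 => /eqP.
  by rewrite expf_eq0 /= => /eqP/nrm0_eq0.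
rewrite -yy (_ : y = 0) ?mul0r//.
by apply/matrixP => i j; rewrite y0 mxE.
Qed.

End MatrixPositivity.

Section CompletePositivity.
Variables (R : realType) (A B : cStarAlgType R) (phi : A -> B).

Lemma cp_of_forms : (forall a, phi (star a) = star (phi a)) ->
  (forall n (y : 'M[A]_n) (xi : 'I_n -> B),
    psd (\sum_i \sum_j star (xi i) * phi ((mxstar y *m y) i j) * xi j)) ->
  completely_positive phi.
Proof.
move=> phis h n _ [y ->].
apply/mx_positiveP; apply: mxC_psd_inner => [|xi].
  apply/matrixP => i j; rewrite mxC_starE !mxE -phis; congr (phi _).
  by rewrite star_sum; apply: eq_bigr => k _; rewrite !mxE starM starK.
rewrite /inner; have := h n y xi.
rewrite (_ : \sum_i _ = \sum_i (star (xi i) * mxact (map_mx phi (mxstar y *m y)) xi i))//.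
apply: eq_bigr => i _; rewrite mulr_sumr; apply: eq_bigr => j _.
by rewrite [map_mx _ _ _ _]mxE mulrA.
Qed.

Lemma ucp_pos_unital : ucp phi -> pos_unital phi.
Proof.
move=> [pl p1 pc]; split=> // y.
have /mx_positiveP/(mxC_psd_diag ord0) : mx_positive (map_mx phi ((star y * y)%:M : 'M[A]_1)).
  by apply: pc; exists (y%:M : 'M[A]_1); apply/matrixP => i j; rewrite !mxE big_ord1 !mxE !ord1.
by rewrite !mxE.
Qed.

End CompletePositivity.

Section ComplexPositivity.
Variable R : realType.

Lemma cplx_psdP (z : cplx R) : psd z <-> 0 <= (z : R[i]).
Proof.
split=> [/psd_sqrt[b [bs <- _ _]]|z0].
  by rewrite -{1}bs; have := mulcJ_ge0 (b : R[i]); rewrite mulrC.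
split; first by move: z0; rewrite lecE => /andP[/eqP]; case: z => a b /= -> _; rewrite /star /= oppr0.
exists (nc z).
suff -> : rs (cplx R) (nc z) = z by rewrite subrr nrm0 nc_ge0.
by rewrite /rs /GRing.scale /= mulr1 -ncE ger0_norm.
Qed.

End ComplexPositivity.

Lemma ge0_ReE (R : realType) (z : R[i]) : 0 <= z -> z = (complex.Re z)%:C.
Proof. by case: z => a b; rewrite lecE /= => /andP[/eqP-> _]. Qed.

(** * Traces on finite-dimensional C*-algebras *)

Section PositiveFunctionals.
Variables (R : realType) (A : cStarAlgType R).

Definition pos_functional (om : A -> R[i]) : Prop :=
  linear (om : A -> R[i]^o) /\ forall y, 0 <= om (star y * y).

Variable om : A -> R[i].
Hypothesis omP : pos_functional om.

Lemma pos_functional_lin : linear (om : A -> R[i]^o).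
Proof. by case: omP. Qed.

Lemma pos_functional_psd a : psd a -> 0 <= om a.
Proof. by move=> /psd_sqrt[b [bs <- _ _]]; rewrite -{1}bs; case: omP. Qed.

Lemma pos_functional_sa a : star a = a -> om a = (complex.Re (om a))%:C.
Proof.
move=> sa.
have p1 := pos_functional_psd (psd_rsB sa (lexx _)).
have p2 := pos_functional_psd (psd_rs A (nrm_ge0 a)).
have aE : om a = om (rs A (nrm a)) - om (rs A (nrm a) - a).
  by rewrite (linf_B pos_functional_lin) opprB addrC subrK.
by rewrite aE (ge0_ReE p1) (ge0_ReE p2) -rmorphB.
Qed.

Lemma pos_functional_star a : om (star a) = conjc (om a).
Proof.
have [b [c [bs cs -> _ _]]] := cartesian a.
rewrite starD starZ bs cs conjc_i !(linf_D pos_functional_lin) !(linf_Z pos_functional_lin).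
have := pos_functional_sa bs; have := pos_functional_sa cs.
case: (om b) (om c) => [? ?] [? ?] /= [->] [->].
apply/eqP; rewrite eq_complex /GRing.scale /=.
by rewrite !(mul0r, mulr0, mul1r, addr0, oppr0, subr0, add0r, mulN1r) !eqxx.
Qed.

End PositiveFunctionals.

(** * Eigenprojections in finite-dimensional algebras *)

Section FiniteDimensional.
Variables (R : realType) (C : cStarAlgType R).
Hypothesis Cfd : finite_dimensional C.
Implicit Types (h e q u : C).

Lemma fd_dependent : exists N, forall v : 'I_N.+1 -> C,
  exists2 c : 'I_N.+1 -> R[i], (exists i, c i != 0) & \sum_i c i *: v i = 0.
Proof.
have [b hb] := Cfd; exists (size b) => v.
have [c hc] := choice hb.
pose M : 'M[R[i]]_((size b).+1, size b) := \matrix_(i, j) c (v i) j.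
have : kermx M != 0.
  rewrite kermx_eq0 /row_free neq_ltn.
  by rewrite (leq_ltn_trans (rank_leq_col M)).
move=> /rowV0Pn[w /sub_kermxP wM w0].
exists (fun i => w 0 i).
  apply: contrapT => h; move/eqP: w0; apply.
  apply/rowP => i; rewrite [RHS]mxE; apply/eqP/negPn/negP => wi.
  by apply: h; exists i.
under eq_bigr => i _ do rewrite (hc (v i)) scaler_sumr.
rewrite exchange_big /= big1// => j _.
under eq_bigr => i _ do rewrite scalerA.
rewrite -scaler_suml.
have /rowP/(_ j) := wM; rewrite !mxE => wj.
suff -> : \sum_i w 0 i * c (v i) j = 0 by rewrite scale0r.
by rewrite -[RHS]wj; apply: eq_bigr => i _; rewrite mxE.
Qed.

Definition ev h (p : {poly R[i]}) : C := \sum_(i < size p) p`_i *: h ^+ i.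

Lemma evE h (p : {poly R[i]}) n : (size p <= n)%N ->
  ev h p = \sum_(i < n) p`_i *: h ^+ i.
Proof.
move=> pn; rewrite /ev (big_ord_widen n (fun i => p`_i *: h ^+ i))//.
rewrite big_mkcond; apply: eq_bigr => i _; case: ifP => // /negbT.
by rewrite -leqNgt => pi; rewrite nth_default// scale0r.
Qed.

Lemma ev_factor h (q : {poly R[i]}) z :
  ev h (q * ('X - z%:P)) = h * ev h q - z *: ev h q.
Proof.
have s1 : (size (q * ('X - z%:P))%R <= (size q).+1)%N.
  by rewrite (leq_trans (size_polyMleq _ _))// size_XsubC addn2.
rewrite (evE h s1).
have -> : \sum_(i < (size q).+1) (q * ('X - z%:P))`_i *: h ^+ i =
    \sum_(i < (size q).+1) (q * 'X)`_i *: h ^+ i -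
    z *: \sum_(i < (size q).+1) q`_i *: h ^+ i.
  rewrite scaler_sumr -sumrB; apply: eq_bigr => i _.
  by rewrite mulrBr coefB coefMC scalerBl scalerA [z * _]mulrC.
rewrite -(evE h (leqnSn _)); congr (_ - _).
rewrite big_ord_recl coefMX eqxx scale0r add0r /ev mulr_sumr.
by apply: eq_bigr => i _; rewrite coefMX /= -scalerAre -exprS.
Qed.

Lemma ev_eigen h p u z : h * u = z *: u -> ev h p * u = p.[z] *: u.
Proof.
move=> hu; rewrite /ev horner_coef mulr_suml scaler_suml.
apply: eq_bigr => i _; rewrite -scalerAle -scalerA; congr (_ *: _).
elim: (i : nat) => [|n ih]; first by rewrite !expr0 mul1r scale1r.
by rewrite exprSr -mulrA hu -scalerAre ih scalerA -exprS.
Qed.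

Lemma star_ev_eigen h p u (z : R) : star h = h -> h * u = z%:C *: u ->
  star (ev h p) * u = conjc p.[z%:C] *: u.
Proof.
move=> hs hu; rewrite /ev horner_coef star_sum rmorph_sum mulr_suml scaler_suml.
apply: eq_bigr => i _; rewrite starZ -scalerAle rmorphM -scalerA; congr (_ *: _).
rewrite -[X in X *: _]/(conjc (z%:C ^+ i)) -rmorphXn conjc_real; elim: (i : nat) => [|n ih].
  by rewrite !expr0 star1 mul1r scale1r.
by rewrite exprS starM hs -mulrA hu -scalerAre ih scalerA -rmorphM -exprS.
Qed.

Lemma ev_comm h p e : h * e = e * h -> ev h p * e = e * ev h p.
Proof.
move=> he; rewrite /ev mulr_suml mulr_sumr; apply: eq_bigr => i _.
rewrite -scalerAle -scalerAre; congr (_ *: _).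
by apply/esym/commrX.
Qed.

Lemma ev_annihilator h e : exists2 p : {poly R[i]}, p != 0 & ev h p * e = 0.
Proof.
have [N hN] := fd_dependent.
have [c [i ci] c0] := hN (fun i => h ^+ i * e).
exists (\poly_(i < N.+1) c (inord i)).
  apply/eqP => /polyP/(_ i); rewrite coef_poly ltn_ord inord_val coef0.
  by apply/eqP.
rewrite (evE _ (size_poly _ _)) mulr_suml -[RHS]c0; apply: eq_bigr => k _.
by rewrite coef_poly ltn_ord inord_val scalerAle.
Qed.

(* The projection onto an eigenspace: [p = q ('X - z)] annihilates [h] with
   minimal degree, and [q h] is proportional to a self-adjoint idempotent. *)
Lemma eigen_projection h e : star h = h -> is_projection e -> e != 0 ->
  h * e = e * h -> exists (q : C) (z : R),
  [/\ is_projection q, q != 0, e * q = q, h * q = q * h & h * q = z%:C *: q].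
Proof.
move=> hs [es ee] e0 he.
(* Annihilation is asked only after multiplication by e, so that the projection is found below e. *)
pose P n := `[< exists p : {poly R[i]}, [/\ p != 0, size p = n & ev h p * e = 0] >].
have exP : exists n, P n.
  have [p p0 pe] := ev_annihilator h e.
  by exists (size p); apply/asboolP; exists p.
case: (ex_minnP exP) => n /asboolP[p [p0 sp pe]] nmin.
have : size p != 1%N.
  apply/eqP => s1; have := pe; rewrite (evE h (_ : (size p <= 1)%N)) ?s1//.
  rewrite big_ord1 expr0 -scalerAle mul1r => /eqP.
  rewrite scaler_eq0 (negbTE e0) orbF => /eqP p00.
  by move: p0; rewrite -lead_coef_eq0 lead_coefE s1 /= p00 eqxx.
move=> /closed_rootP[z /factor_theorem[q pq]].
have q0 : q != 0 by apply: contraNneq p0 => q0; rewrite pq q0 mul0r.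
have sq : (size q < n)%N.
  rewrite -sp pq size_Mmonic ?monicXsubC// size_XsubC addn2 /=.
  exact: ltnSn.
have small (g : {poly R[i]}) : g != 0 -> (size g < n)%N -> ev h g * e != 0.
  move=> g0 gn; apply/eqP => ge.
  have /nmin : P (size g) by apply/asboolP; exists g.
  by rewrite leqNgt gn.
have [u uE] : exists u, u = ev h q * e by eexists.
have u0 : u != 0 by rewrite uE; exact: small.
have hu : h * u = z *: u.
  apply/eqP; rewrite -subr_eq0 uE mulrA scalerAle -mulrBl -ev_factor -pq.
  by rewrite pe.
have uu0 : star u * u != 0.
  by rewrite -nrm_eq0 nrm_starM expf_eq0 /= nrm_eq0.
(* u^* h u is self-adjoint and equals z u^* u, where u^* u is nonzero. *)
have zr : conjc z = z.
  have h1 : star u * (h * u) = z *: (star u * u) by rewrite hu scalerAre.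
  have h2 : star (star u * (h * u)) = star u * (h * u).
    by rewrite starM [star (h * u)]starM starK hs mulrA.
  move: h2; rewrite h1 starZ [star (_ * u)]starM starK => /eqP.
  by rewrite -subr_eq0 -scalerBl scaler_eq0 (negbTE uu0) orbF subr_eq0 => /eqP.
have zE : z = (complex.Re z)%:C.
  move: zr; case: z {pq hu} => a b /= [] /eqP; rewrite eq_sym -addr_eq0.
  by rewrite -mulr2n mulrn_eq0 /= => /eqP->.
have hue : u * e = u by rewrite uE -mulrA ee.
have eu : e * u = u by rewrite uE mulrA -ev_comm// -mulrA ee.
(* A double root would give u = (h - z) v, hence u^* u = v^* (h - z) u = 0. *)
have qz : q.[z] != 0.
  apply/negP => /factor_theorem[g qg].
  have g0 : g != 0 by apply: contraNneq q0 => g0; rewrite qg g0 mul0r.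
  have sg : (size g < n)%N.
    apply: leq_ltn_trans sq; rewrite qg size_Mmonic ?monicXsubC// size_XsubC.
    by rewrite addn2 /= leqnSn.
  pose v := ev h g * e.
  have uv : u = h * v - z *: v.
    by rewrite uE qg ev_factor mulrBl -scalerAle mulrA.
  move/negP: uu0; apply; rewrite {1}uv starB starM starZ hs zr.
  by rewrite mulrBl -mulrA hu -scalerAre -scalerAle subrr.
have hq2 : u * u = q.[z] *: u.
  by rewrite {1}uE -mulrA eu (ev_eigen _ hu).
pose Q := (q.[z])^-1 *: u.
have QQ : star Q * Q = Q.
  have hu' : h * u = (complex.Re z)%:C *: u by rewrite -zE.
  have := star_ev_eigen q hs hu'; rewrite -zE => su.
  have su2 : star u * u = conjc q.[z] *: u.
    by rewrite {1}uE starM es -mulrA su -scalerAre eu.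
  rewrite /Q starZ -scalerAle -scalerAre su2 !scalerA; congr (_ *: _).
  rewrite rmorphV ?unitfE// mulrAC mulVf ?mul1r//.
  by rewrite conjc_eq0.
have Qs : star Q = Q by rewrite -{1}QQ starM starK QQ.
have hQ : h * Q = (complex.Re z)%:C *: Q.
  by rewrite /Q -scalerAre hu -zE !scalerA mulrC.
exists Q, (complex.Re z); split=> //.
- by split=> //; rewrite -{1}Qs.
- by rewrite scaler_eq0 negb_or invr_eq0 qz u0.
- by rewrite /Q -scalerAre eu.
- by rewrite -{2}Qs -{2}hs -starM hQ starZr Qs.
Qed.

End FiniteDimensional.

(** * Spectral resolutions *)

Section Spectral.
Variables (R : realType) (C : cStarAlgType R).
Implicit Types (h e q x y : C).

Definition resolution D (e : 'I_D -> C) : Prop :=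
  [/\ forall a, is_projection (e a), forall a b, a != b -> e a * e b = 0
    & \sum_a e a = 1].

Definition minimal_resolution D (e : 'I_D -> C) : Prop :=
  resolution e /\ forall a, minimal_projection (e a).

Hypothesis Cfd : finite_dimensional C.

Let orth_family h (s : seq C) : Prop :=
  [/\ uniq s, forall x, x \in s -> [/\ is_projection x, x != 0 & h * x = x * h],
      forall x y, x \in s -> y \in s -> x != y -> x * y = 0
    & \sum_(x <- s) x = 1].

(** Nonzero orthogonal projections are linearly independent. *)
Lemma orth_family_bound : exists N, forall h s, orth_family h s -> (size s <= N)%N.
Proof.
have [N hN] := fd_dependent Cfd; exists N => h s [us sp so _].
rewrite leqNgt; apply/negP => Ns.
have [c [i ci] /(congr1 (fun x => s`_i * x)) c0] := hN (fun i => s`_i).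
have mem (j : 'I_N.+1) : s`_j \in s by rewrite mem_nth// (leq_trans (ltn_ord j)).
have [[_ ii] i0 _] := sp _ (mem i).
have E : s`_i * (\sum_j c j *: s`_j) = c i *: s`_i.
  rewrite mulr_sumr (bigD1 i)//= big1 ?addr0 => [|j ji].
    by rewrite -scalerAre ii.
  rewrite -scalerAre so ?scaler0//.
  by rewrite nth_uniq ?(leq_trans (ltn_ord _))// eq_sym.
move: c0; rewrite E mulr0 => /eqP; rewrite scaler_eq0 (negbTE ci) /=.
by rewrite (negbTE i0).
Qed.

Lemma projection_sub e q : is_projection e -> is_projection q -> e * q = q ->
  [/\ q * e = q, is_projection (e - q), q * (e - q) = 0 & (e - q) * q = 0].
Proof.
move=> [es ee] [qs qq] eq.
have qe : q * e = q by rewrite -{1}qs -{1}es -starM eq qs.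
split=> //.
- split; first by rewrite starB es qs.
  by rewrite mulrBl !mulrBr ee eq qe qq subrr subr0.
- by rewrite mulrBr qe qq subrr.
- by rewrite mulrBl eq qq subrr.
Qed.

Lemma orth_family_split h s e q : star h = h -> orth_family h s -> e \in s ->
  is_projection q -> q != 0 -> q != e -> e * q = q -> h * q = q * h ->
  orth_family h (q :: (e - q) :: rem e s).
Proof.
move=> hs [us sp so s1] es qp q0 qe eq hq.
have [ep e0 he] := sp _ es.
have [qe' rp qr rq] := projection_sub ep qp eq.
have rem_s x : x \in rem e s -> x \in s /\ x != e.
  by rewrite mem_rem_uniq// inE => /andP[].
have er : e * (e - q) = e - q by case: ep => _ ee; rewrite mulrBr ee eq.
have re : (e - q) * e = e - q by case: ep => _ ee; rewrite mulrBl ee qe'.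
have Sub x y : y * e = y -> e * y = y -> x \in rem e s -> x * y = 0 /\ y * x = 0.
  move=> ye ey /rem_s[xs xe]; split.
    by rewrite -ey mulrA (so x e)// mul0r.
  by rewrite -ye -mulrA (so e x)// ?mulr0// eq_sym.
have nin y : is_projection y -> y != 0 -> y * e = y -> e * y = y -> y \notin rem e s.
  move=> [_ yy] y0 ye ey; apply/negP => /(Sub y y ye ey)[].
  by rewrite yy => yz; rewrite yz eqxx in y0.
have r0 : e - q != 0 by rewrite subr_eq0 eq_sym.
have qr' : q != e - q.
  apply/eqP => E; have [_ qq] := qp.
  by move: q0; rewrite -qq {2}E qr eqxx.
split.
- by rewrite /= inE negb_or qr' !nin//= rem_uniq.
- move=> x; rewrite !inE => /or3P[/eqP->|/eqP->|/rem_s[/sp//]].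
    by split.
  by split=> //; rewrite mulrBr mulrBl he hq.
- move=> x y; rewrite !inE => /or3P[/eqP->|/eqP->|xs] /or3P[/eqP->|/eqP->|ys].
  + by rewrite eqxx.
  + by [].
  + by have [] := Sub y q qe' eq ys.
  + by [].
  + by rewrite eqxx.
  + by have [] := Sub y (e - q) re er ys.
  + by have [] := Sub x q qe' eq xs.
  + by have [] := Sub x (e - q) re er xs.
  + by have [xs' _] := rem_s _ xs; have [ys' _] := rem_s _ ys; exact: so.
- by rewrite !big_cons addrA [q + _]addrC subrK -s1 (perm_big _ (perm_to_rem es)) big_cons.
Qed.

(** In a largest family of orthogonal projections that commute with h and sum to 1, no member splits
    within the commutant of h. So [eigen_projection] below e returns e, and h is a scalar on e; then
    every projection below e commutes with h, and e is minimal. *)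
Theorem spectral h : star h = h -> exists D (e : 'I_D -> C) (la : 'I_D -> R),
  minimal_resolution e /\ h = \sum_a (la a)%:C *: e a.
Proof.
move=> hs.
pose P n := `[< exists s, orth_family h s /\ size s = n >].
have exP : exists n, P n.
  have [/eqP o0|o0] := eqVneq (1 : C) 0.
    exists 0%N; apply/asboolP; exists [::]; split=> //; split=> //.
    by rewrite big_nil; apply/eqP; rewrite eq_sym.
  exists 1%N; apply/asboolP; exists [:: 1]; split=> //; split=> //.
  - move=> x; rewrite inE => /eqP->; split=> //; last by rewrite mulr1 mul1r.
    by split; rewrite ?star1 ?mulr1.
  - by move=> x y; rewrite !inE => /eqP-> /eqP->; rewrite eqxx.
  - by rewrite big_seq1.
have [N hN] := orth_family_bound.
have Pub n : P n -> (n <= N)%N by move=> /asboolP[s [/hN + <-]].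
case: (ex_maxnP exP Pub) => n /asboolP[s [sf sn]] nmax.
have [us sp so s1] := sf.
have nosplit e q : e \in s -> is_projection q -> q != 0 -> e * q = q ->
    h * q = q * h -> q = e.
  move=> es qp q0 eq hq; apply/eqP/negPn/negP => qe.
  have /nmax : P n.+1.
    apply/asboolP; exists (q :: (e - q) :: rem e s); split.
      exact: orth_family_split.
    by rewrite /= size_rem// -sn prednK//; case: (s) es.
  by rewrite ltnn.
have Hla (a : 'I_(size s)) : exists la : R, h * s`_a = la%:C *: s`_a.
  have es : s`_a \in s by rewrite mem_nth.
  have [ep e0 he] := sp _ es.
  have [q [z [qp q0 eq hq hz]]] := eigen_projection Cfd hs ep e0 he.
  by exists z; rewrite -(nosplit _ q es).
have [la laE] := choice Hla.
exists (size s), (fun a => s`_a), la.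
have mem (a : 'I_(size s)) : s`_a \in s by rewrite mem_nth.
split; first split.
- split=> [a|a b ab|]; first by have [] := sp _ (mem a).
    by apply: so; rewrite ?mem// nth_uniq.
  by rewrite -s1 (big_nth 0) big_mkord.
- move=> a; have [ep e0 he] := sp _ (mem a); split=> // q qp eq.
  have [->|q0] := eqVneq q 0; first by left.
  right; apply: (nosplit _ _ (mem a)) => //.
  have hq : h * q = (la a)%:C *: q by rewrite -eq mulrA laE -scalerAle.
  by case: (qp) => qs _; rewrite -{2}qs -{2}hs -starM hq starZr qs.
- rewrite -[LHS]mulr1 -s1 (big_nth 0) big_mkord mulr_sumr.
  by apply: eq_bigr => a _; rewrite laE.
Qed.

End Spectral.

Section Resolution.
Variables (R : realType) (C : cStarAlgType R) (D : nat) (e : 'I_D -> C).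
Hypothesis eR : resolution e.

Lemma resolution_mul (la mu : 'I_D -> R[i]) :
  (\sum_a la a *: e a) * (\sum_a mu a *: e a) = \sum_a (la a * mu a) *: e a.
Proof.
have [ep eo e1] := eR.
rewrite mulr_suml; apply: eq_bigr => a _; rewrite mulr_sumr (bigD1 a)//= big1.
  by have [_ ee] := ep a; rewrite addr0 -scalerAle -scalerAre ee scalerA.
by move=> b ba; rewrite -scalerAle -scalerAre eo ?scaler0// eq_sym.
Qed.

Lemma resolution_pow (la : 'I_D -> R[i]) n :
  (\sum_a la a *: e a) ^+ n = \sum_a (la a ^+ n) *: e a.
Proof.
have [ep eo e1] := eR.
elim: n => [|n ih].
  by rewrite expr0 -e1; apply: eq_bigr => a _; rewrite scale1r.
by rewrite exprS ih resolution_mul; apply: eq_bigr => a _; rewrite exprS.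
Qed.

(** The partial sums of the series are combinations of the same projections, with the numerical
    partial sums as coefficients. *)
Lemma resolution_exp (la : 'I_D -> R) :
  cstar_exp (\sum_a (la a)%:C *: e a) = \sum_a (expR (la a))%:C *: e a.
Proof.
set h := \sum_a _; set l := \sum_a (expR _)%:C *: _.
pose u (n : nat) : C := \sum_(k < n) (k`!%:R : R[i])^-1 *: h ^+ k.
have uE n : u n = \sum_a (\sum_(k < n) (k`!%:R)^-1 * la a ^+ k)%:C *: e a.
  rewrite /u; under eq_bigr => k _ do rewrite resolution_pow scaler_sumr.
  rewrite exchange_big /=; apply: eq_bigr => a _.
  rewrite rmorph_sum scaler_suml; apply: eq_bigr => k _.
  by rewrite scalerA rmorphM fmorphV rmorph_nat rmorphXn.
suff ul : cvgs u l.
  apply: (@cvg_lim (cs_space C)); first exact: norm_hausdorff.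
  have /cvgs_cvg := ul; rewrite (_ : u = series (fun k => (k`!%:R : R[i])^-1 *: h ^+ k))//.
  by apply/funext => n; rewrite /series /= big_mkord.
move=> eps eps0.
pose M : R := \sum_a nrm (e a) + 1.
have s0 : 0 <= \sum_a nrm (e a) by apply: sumr_ge0 => a _; exact: nrm_ge0.
have M0 : 0 < M by rewrite ltr_wpDl.
have eM : 0 < eps / M by rewrite divr_gt0.
have H a : exists N, forall n, (N <= n)%N ->
    `|\sum_(k < n) (k`!%:R)^-1 * la a ^+ k - expR (la a)| < eps / M.
  have : series (exp_coeff (la a)) n @[n --> \oo] --> expR (la a).
    by rewrite /expR; exact: is_cvg_series_exp_coeff.
  move=> /cvgrPdist_lt/(_ _ eM)[N _ hN]; exists N => n Nn.
  have := hN n Nn; rewrite /= /series /= big_mkord distrC.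
  congr (`|_ - _| < _); apply: eq_bigr => k _.
  by rewrite /exp_coeff /= mulrC.
have [N hN] := choice H.
exists (\sum_a N a)%N => n Nn.
rewrite uE /l -sumrB (le_lt_trans (nrm_sum _ _ _))//.
apply: (@le_lt_trans _ _ (\sum_a (eps / M) * nrm (e a))).
  apply: ler_sum => a _; rewrite -scalerBl -rmorphB nrmZr ler_wpM2r ?nrm_ge0//.
  by rewrite ltW// hN// (leq_trans _ Nn)// (bigD1 a)//= leq_addr.
rewrite -mulr_sumr -mulrA gtr_pMr// mulrC ltr_pdivrMr// mul1r ltrDl.
exact: ltr01.
Qed.

End Resolution.

(** * The canonical trace and densities *)

Section Trace.
Variables (R : realType) (C : cStarAlgType R) (tr : {scalar C}).
Hypotheses (Cfd : finite_dimensional C) (trP : canonical_trace tr).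
Implicit Types (x y : C).

Lemma trC x y : tr (x * y) = tr (y * x).
Proof. by case: trP => + _; exact. Qed.

Lemma tr_minimal e : minimal_projection e -> tr e = 1.
Proof. by case: trP => _; exact. Qed.

Lemma trZ (z : R[i]) x : tr (z *: x) = z * tr x.
Proof. by rewrite linearZ. Qed.

(** The compression of y to an eigenprojection is la_a e_a and is positive, so a negative la_a would
    make e_a vanish. *)
Lemma psd_spectral y : psd y -> exists D (e : 'I_D -> C) (la : 'I_D -> R),
  [/\ minimal_resolution e, y = \sum_a (la a)%:C *: e a & forall a, 0 <= la a].
Proof.
move=> py; have [D [e [la [eR yE]]]] := spectral Cfd (psd_sa py).
exists D, e, la; split=> // a.
have [[ep eo _] em] := eR; have [es ee] := ep a.
have E : star (e a) * y * e a = (la a)%:C *: e a.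
  rewrite es yE mulr_sumr mulr_suml (bigD1 a)//= big1 ?addr0.
    by rewrite -scalerAre -scalerAle !ee.
  by move=> b ba; rewrite -scalerAre -scalerAle eo ?mul0r ?scaler0// eq_sym.
rewrite leNgt; apply/negP => l0.
have p1 : psd ((la a)%:C *: e a) by rewrite -E; exact: psd_conj.
have p2 : psd (- ((la a)%:C *: e a)).
  rewrite -scaleNr -rmorphN; apply: psdZ; first by rewrite oppr_ge0 ltW.
  by rewrite -ee; exact: psd_sq.
have := psd_anti p1 p2; have [_ e0 _] := em a.
move=> /eqP; rewrite scaler_eq0 (negbTE e0) orbF => /eqP/complexI l00.
by rewrite l00 ltxx in l0.
Qed.

Lemma tr_spectral D (e : 'I_D -> C) (la : 'I_D -> R) : minimal_resolution e ->
  tr (\sum_a (la a)%:C *: e a) = (\sum_a la a)%:C.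
Proof.
move=> [_ em]; rewrite linear_sum rmorph_sum; apply: eq_bigr => a _.
by rewrite trZ tr_minimal// mulr1.
Qed.

Lemma tr_pos_functional : pos_functional tr.
Proof.
split=> [z a b|y]; first exact: linearP.
have [D [e [la [eR -> l0]]]] := psd_spectral (psd_starM y).
by rewrite tr_spectral// ler0c sumr_ge0.
Qed.

Lemma tr_faithful y : tr (star y * y) = 0 -> y = 0.
Proof.
move=> t0; have [D [e [la [eR yE l0]]]] := psd_spectral (psd_starM y).
move: t0; rewrite yE tr_spectral// => /complexI s0.
have la0 a : la a = 0.
  by move/eqP: s0; rewrite psumr_eq0// => /allP/(_ a)/=; rewrite mem_index_enum => /(_ isT)/eqP.
apply: nrm0_eq0; apply/eqP; have := nrm_starM y.
rewrite yE big1 ?nrm0 => [/esym/eqP|a _]; first by rewrite expf_eq0.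
by rewrite la0 scale0r.
Qed.

(* Riesz representation, through the Gram matrix of a spanning family. *)
Lemma trace_density (om : C -> R[i]) : linear (om : C -> R[i]^o) ->
  exists r, forall x, om x = tr (r * x).
Proof.
move=> oml; have [b hb] := Cfd.
pose G : 'M[R[i]]_(size b) := \matrix_(i, j) tr (star b`_i * b`_j).
pose w : 'rV[R[i]]_(size b) := \row_j om b`_j.
have : (w <= G)%MS.
  (* A column of the cokernel of G gives x with tr (b_i^* x) = 0 for all i, so x = 0 and [om]
     vanishes on it: w lies in the row space of G. *)
  rewrite submxE; apply/eqP/rowP => k.
  rewrite [RHS]mxE mxE.
  pose x := \sum_j cokermx G j k *: b`_j.
  have Gx (i : 'I_(size b)) : tr (star b`_i * x) = 0.
    have /matrixP/(_ i k) := mulmx_coker G; rewrite [RHS]mxE mxE => <-.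
    rewrite mulr_sumr linear_sum; apply: eq_bigr => j _.
    by rewrite -scalerAre trZ [G i j]mxE mulrC.
  have x0 : x = 0.
    apply: tr_faithful.
    rewrite {1}/x star_sum mulr_suml linear_sum big1// => j _.
    by rewrite starZ -scalerAle trZ Gx mulr0.
  transitivity (om x); last by rewrite x0 (linf_0 oml).
  rewrite /x (linf_sum oml); apply: eq_bigr => j _.
  by rewrite (linf_Z oml) [w _ _]mxE mulrC.
move=> /submxP[c wc].
exists (\sum_i c 0 i *: star b`_i) => x.
have [d ->] := hb x.
rewrite (linf_sum oml) mulr_sumr linear_sum; apply: eq_bigr => j _.
rewrite (linf_Z oml) -scalerAre trZ; congr (_ * _).
have /rowP/(_ j) := wc; rewrite !mxE => ->.
rewrite mulr_suml linear_sum; apply: eq_bigr => i _.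
by rewrite -scalerAle trZ mxE.
Qed.

Lemma pos_functional_spectral (om : C -> R[i]) : pos_functional om ->
  exists D (f : 'I_D -> C) (la : 'I_D -> R), [/\ minimal_resolution f,
    forall a, 0 <= la a & forall x, om x = \sum_a (la a)%:C * tr (f a * x)].
Proof.
move=> omP; have [r rE] := trace_density (pos_functional_lin omP).
have trp := tr_pos_functional.
have rs_ : star r = r.
  have E x : tr (star r * x) = tr (r * x).
    rewrite -[x]starK -starM (pos_functional_star trp) trC -rE.
    by rewrite -(pos_functional_star omP) starK rE.
  apply/eqP; rewrite -subr_eq0; apply/eqP.
  rewrite -[LHS]starK; apply/eqP; rewrite -star0; apply/eqP; congr star.
  apply: tr_faithful; rewrite starK mulrBl linearB /=.
  by rewrite E subrr.
have [D [f [la [fR rla]]]] := spectral Cfd rs_.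
have omE x : om x = \sum_a (la a)%:C * tr (f a * x).
  rewrite rE rla mulr_suml linear_sum; apply: eq_bigr => a _.
  by rewrite -scalerAle trZ.
exists D, f, la; split=> // a.
have [[fp fo _] fm] := fR; have [fs ff] := fp a.
have : 0 <= om (star (f a) * f a) by case: omP.
rewrite fs ff omE (bigD1 a)//= big1 ?addr0.
  by rewrite ff tr_minimal// mulr1 ler0c.
by move=> b ba; rewrite fo// linear0 mulr0.
Qed.

End Trace.

(** * Entropy and approximate decoding *)

Section RealEntropy.
Variable R : realType.
Implicit Types x y : R.

Definition xlnx x : R := - (x * ln x).

Lemma ln_leB1 x : 0 < x -> ln x <= x - 1.
Proof.
move=> x0; have h : -1 < x - 1 by lra.
by have := le_ln1Dx h; rewrite (_ : 1 + (x - 1) = x)//; ring.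
Qed.

(** s is the threshold of a likelihood test. If s mu <= la, the logarithm is at least ln s.
    Otherwise the minimum is la, and ln y <= y - 1 at y = r mu / la bounds the deficit by r mu,
    while X pays for replacing ln s by ln r. *)
Lemma entropy_term (la mu G s r X : R) :
  0 <= la -> 0 <= mu -> 0 <= G -> la * G <= mu -> 0 < s -> 0 < r -> 0 <= X ->
  ln s - ln r <= X ->
  la * G * ln s - X * (Num.min la (s * mu) * G) - r * mu * G <=
  la * G * (ln la - ln mu).
Proof.
move=> la0 mu0 G0 lm s0 r0 X0 sr.
have m0 : 0 <= Num.min la (s * mu) by rewrite le_min la0 mulr_ge0// ltW.
have [P0|P0] := eqVneq (la * G) 0.
  rewrite P0 !mul0r sub0r -opprD oppr_le0 addr_ge0// !mulr_ge0//.
  by rewrite ltW.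
have Pp : 0 < la * G by rewrite lt_neqAle eq_sym P0 mulr_ge0.
have lap : 0 < la.
  by rewrite lt_neqAle la0 andbT eq_sym; apply: contraNneq P0 => ->; rewrite mul0r.
have Gp : 0 < G.
  by rewrite lt_neqAle G0 andbT eq_sym; apply: contraNneq P0 => ->; rewrite mulr0.
have mup : 0 < mu by exact: lt_le_trans Pp lm.
have [good|bad] := leP (s * mu) la.
  have h : ln s <= ln la - ln mu.
    by rewrite lerBrDr -lnM ?posrE// ler_ln ?posrE// mulr_gt0.
  have h2 : la * G * ln s <= la * G * (ln la - ln mu) by rewrite ler_wpM2l// ltW.
  have h3 : 0 <= X * (s * mu * G) by rewrite !mulr_ge0// ltW.
  have h4 : 0 <= r * mu * G by rewrite !mulr_ge0// ltW.
  lra.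
have h : ln r + ln mu - ln la <= r * mu / la.
  have y0 : 0 < r * mu / la by rewrite divr_gt0// mulr_gt0.
  have := ln_leB1 y0; rewrite ln_div ?posrE ?mulr_gt0// lnM ?posrE//.
  by move=> /le_trans; apply; rewrite gerBl.
have h2 : la * G * (ln r + ln mu - ln la) <= r * mu * G.
  rewrite (_ : r * mu * G = la * G * (r * mu / la)); last by field; rewrite gt_eqF.
  by rewrite ler_wpM2l// ltW.
have h3 : la * G * (ln s - ln r) <= la * G * X by rewrite ler_wpM2l// ltW.
rewrite -mulrA in h2 *; lra.
Qed.

(** In the application [la i] are the eigenvalues of the i-th functional, [G i a b] the squared
    overlaps of its eigenvectors with a fixed basis, and [mu] the diagonal of the mixture in that
    basis. [test] bounds the error of deciding between [la i] and [s * mu]. *)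
Variables (I : finType) (D : nat) (Di : I -> nat).
Variables (la : forall i, 'I_(Di i) -> R) (G : forall i, 'I_(Di i) -> 'I_D -> R).
Variables (q : I -> R) (eps : R).
Hypotheses (la0 : forall i a, 0 <= @la i a) (G0 : forall i a b, 0 <= @G i a b).
Hypotheses (Gr : forall i a, \sum_b @G i a b = 1) (Gc : forall i b, \sum_a @G i a b = 1).
Let t i := \sum_a @la i a.
Let tt := \sum_i t i.
Let mu b := \sum_i \sum_a @la i a * @G i a b.
Hypotheses (q0 : forall i, 0 <= q i) (qt : \sum_i q i <= tt).
Hypotheses (eps0 : 0 < eps) (eps1 : eps <= 1).
Hypothesis test : forall i s, 0 <= s ->
  \sum_a \sum_b Num.min (@la i a) (s * mu b) * @G i a b <= 2 * (eps * t i + s * q i).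

(* The entropy, per unit of mass, left open by a decoding among [K] messages
   whose probability of error is [ep]. *)
Definition loss (K : nat) (ep : R) : R := - ln ep + 6 * ep * ln (2 * K%:R) + 1.

Let t0 i : 0 <= t i. Proof. by apply: sumr_ge0 => a _; exact: la0. Qed.
Let tt0 : 0 <= tt. Proof. by apply: sumr_ge0 => i _; exact: t0. Qed.
Let P0 i a b : 0 <= @la i a * @G i a b. Proof. by rewrite mulr_ge0. Qed.
Let mu0 b : 0 <= mu b.
Proof. by do 2 (apply: sumr_ge0 => ? _); exact: P0. Qed.

Let sum_mu : \sum_b mu b = tt.
Proof.
rewrite /mu exchange_big; apply: eq_bigr => i _.
rewrite exchange_big; apply: eq_bigr => a _ /=.
by rewrite -mulr_sumr Gr mulr1.
Qed.

(** Averaging q with the uniform weight keeps q' at least tt / (2 #|I|), the source of ln (2 K) in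
    [loss], and at least q / 2. *)
Let q' i : R := (q i + tt / #|I|%:R) / 2.

(** [entropy_term] with s = eps t_i / q'_i and r = t_i / tt. The test gives 2 (eps t_i + s q_i) <= 6
    eps t_i, the origin of the 6 in [loss]; the terms r mu add up to t_i, the origin of the 1. *)
Let part i : t i * ln eps + (t i - q' i) - 6 * eps * ln (2 * #|I|%:R) * t i - t i <=
  \sum_a \sum_b @la i a * @G i a b * (ln (@la i a) - ln (mu b)).
Proof.
have I0 : (0 < #|I|)%N by apply/card_gt0P; exists i.
have K0 : 0 < #|I|%:R :> R by rewrite ltr0n.
have [ti0|ti0] := eqVneq (t i) 0.
  have lai a : @la i a = 0.
    move/eqP: ti0; rewrite psumr_eq0// => /allP/(_ a)/=.
    by rewrite mem_index_enum => /(_ isT)/eqP.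
  rewrite big1 => [|a _]; last by rewrite big1// => b _; rewrite lai !mul0r.
  rewrite ti0 !(mul0r, mulr0) !add0r !subr0 oppr_le0.
  by rewrite divr_ge0// addr_ge0// divr_ge0.
have tip : 0 < t i by rewrite lt_neqAle eq_sym ti0 t0.
have ttp : 0 < tt.
  by rewrite (lt_le_trans tip)// /tt (bigD1 i)//= lerDl sumr_ge0.
have qp : 0 < q i + tt / #|I|%:R by rewrite ltr_wpDl// divr_gt0.
have q'p : 0 < q' i by rewrite divr_gt0.
pose s := eps * t i / q' i; pose r := t i / tt.
have sp : 0 < s by rewrite divr_gt0// mulr_gt0.
have rp : 0 < r by rewrite divr_gt0.
have X0 : 0 <= ln (2 * #|I|%:R : R).
  by rewrite ln_ge0// -natrM ler1n muln_gt0.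
have sr : ln s - ln r <= ln (2 * #|I|%:R).
  rewrite -ln_div ?posrE// ler_ln ?posrE ?divr_gt0 ?mulr_gt0//.
  have -> : s / r = eps * tt / q' i.
    by rewrite /s /r; field; rewrite !gt_eqF.
  rewrite ler_pdivrMr//.
  have h1 : eps * tt <= tt by rewrite ler_piMl.
  apply: (le_trans h1).
  have -> : 2 * #|I|%:R * q' i = #|I|%:R * q i + tt.
    by rewrite /q'; field; rewrite gt_eqF.
  by rewrite lerDr mulr_ge0// ltW.
have muge a b : @la i a * @G i a b <= mu b.
  rewrite /mu (bigD1 i)//= (bigD1 a)//= -addrA lerDl addr_ge0//.
    by apply: sumr_ge0 => c _.
  by apply: sumr_ge0 => j _; apply: sumr_ge0 => c _.
apply: (@le_trans _ _ (\sum_a \sum_b (@la i a * @G i a b * ln s -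
   ln (2 * #|I|%:R) * (Num.min (@la i a) (s * mu b) * @G i a b) -
   r * mu b * @G i a b))); last first.
  by apply: ler_sum => a _; apply: ler_sum => b _; apply: entropy_term.
have -> : \sum_a \sum_b (@la i a * @G i a b * ln s -
   ln (2 * #|I|%:R) * (Num.min (@la i a) (s * mu b) * @G i a b) -
   r * mu b * @G i a b) = t i * ln s - ln (2 * #|I|%:R) *
   (\sum_a \sum_b Num.min (@la i a) (s * mu b) * @G i a b) - r * tt.
  under eq_bigr => a _ do rewrite !sumrB.
  rewrite !sumrB; congr (_ - _ - _).
  - rewrite /t mulr_suml; apply: eq_bigr => a _.
    by rewrite -mulr_suml -mulr_sumr Gr mulr1.
  - rewrite mulr_sumr; apply: eq_bigr => a _.
    by rewrite mulr_sumr.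
  - rewrite exchange_big /= -sum_mu mulr_sumr; apply: eq_bigr => b _.
    by rewrite -mulr_sumr Gc mulr1.
have -> : r * tt = t i by rewrite /r divfK// gt_eqF.
have lns : ln s = ln eps + ln (t i / q' i).
  by rewrite /s -mulrA lnM ?posrE// divr_gt0.
have tq : t i - q' i <= t i * ln (t i / q' i).
  have y0 : 0 < q' i / t i by rewrite divr_gt0.
  have := ln_leB1 y0; rewrite !ln_div ?posrE// => h.
  have := ler_wpM2l (ltW tip) h.
  have -> : t i * (q' i / t i - 1) = q' i - t i by field.
  by move=> h2; lra.
have tst := test i (ltW sp).
have sq : s * q i <= 2 * (eps * t i).
  have -> : 2 * (eps * t i) = s * (2 * q' i).
    by rewrite /s; field; rewrite gt_eqF.
  rewrite ler_wpM2l ?(ltW sp)// /q' mulrC divfK// lerDl divr_ge0//.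
have bd : \sum_a \sum_b Num.min (@la i a) (s * mu b) * @G i a b <= 6 * eps * t i.
  by apply: (le_trans tst); lra.
have := ler_wpM2l X0 bd.
move: (\sum_a \sum_b _) bd => M bd h; rewrite lns mulrDr.
by move: (ln (2 * _)) X0 h => X X0 h; lra.
Qed.

(** The difference of the entropies is a sum of relative entropies la G (ln la - ln mu), bounded
    below by [part]; the leftover differences t_i - q'_i have a nonnegative sum. *)
Lemma entropy_step :
  \sum_i \sum_a xlnx (@la i a) - loss #|I| eps * tt <= \sum_b xlnx (mu b).
Proof.
have E : \sum_b xlnx (mu b) - \sum_i \sum_a xlnx (@la i a) =
    \sum_i \sum_a \sum_b @la i a * @G i a b * (ln (@la i a) - ln (mu b)).
  have -> : \sum_b xlnx (mu b) =
      - \sum_i \sum_a \sum_b @la i a * @G i a b * ln (mu b).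
    rewrite -sumrN; under [RHS]eq_bigr => i _ do rewrite exchange_big -sumrN.
    rewrite exchange_big; apply: eq_bigr => b _ /=; rewrite /xlnx sumrN; congr -%R.
    rewrite {1}/mu mulr_suml; apply: eq_bigr => i _.
    by rewrite mulr_suml.
  have -> : \sum_i \sum_a xlnx (@la i a) =
      - \sum_i \sum_a \sum_b @la i a * @G i a b * ln (@la i a).
    rewrite -sumrN; apply: eq_bigr => i _; rewrite -sumrN; apply: eq_bigr => a _.
    by rewrite -mulr_suml -mulr_sumr Gr mulr1.
  rewrite opprK addrC -sumrB; apply: eq_bigr => i _; rewrite -sumrB.
  by apply: eq_bigr => a _; rewrite -sumrB; apply: eq_bigr => b _; rewrite mulrBr.
suff : - (loss #|I| eps * tt) <=
    \sum_b xlnx (mu b) - \sum_i \sum_a xlnx (@la i a) by lra.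
rewrite E.
have S := ler_sum (index_enum I) (P := xpredT) (fun i _ => part i).
apply: le_trans S.
rewrite !sumrB big_split /= sumrB -!mulr_suml -!mulr_sumr -/tt.
have sq' : \sum_i q' i <= tt.
  have [/eqP I0|I0] := eqVneq #|I| 0%N.
    rewrite big1 ?tt0// => i _; exfalso.
    by move: I0; rewrite -leqn0 leqNgt => /negP; apply; apply/card_gt0P; exists i.
  rewrite /q' -mulr_suml big_split /= sumr_const -[_ *+ #|_|]mulr_natr divfK.
    by rewrite ler_pdivrMr// mulr_natr mulr2n lerD.
  by rewrite pnatr_eq0.
move: sq'; rewrite /loss /q' -mulr_suml => sq'.
lra.
Qed.

End RealEntropy.

(** * One quantum measurement *)

Section QuantumEntropy.
Variables (R : realType) (C : cStarAlgType R) (tr : {scalar C}).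
Hypotheses (Cfd : finite_dimensional C) (trP : canonical_trace tr).
Local Notation Re := (@complex.Re R).

Let trp : pos_functional tr. Proof. exact: tr_pos_functional. Qed.

Lemma pos_functional_sum (T : finType) (V : {set T}) (om : T -> C -> R[i]) :
  (forall w, pos_functional (om w)) ->
  pos_functional (fun x => \sum_(w in V) om w x).
Proof.
move=> omP; split=> [z a b|y].
  transitivity (\sum_(w in V) (z * om w a + om w b)).
    by apply: eq_bigr => w _; exact: (pos_functional_lin (omP w)).
  by rewrite big_split /= -mulr_sumr.
by apply: sumr_ge0 => w _; case: (omP w).
Qed.

Let B (f e x y : C) : R := Re (tr (f * x * e * star y)).

(* For rank one projections this is [|<f, x e>|^2]. *)
Let T (f e x : C) : R := B f e x x.

Let BDl f e x y z : B f e (x + y) z = B f e x z + B f e y z.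
Proof. by rewrite /B mulrDr !mulrDl linearD raddfD. Qed.

Let BDr f e x y z : B f e x (y + z) = B f e x y + B f e x z.
Proof. by rewrite /B starD mulrDr linearD raddfD. Qed.

Let BNl f e x y : B f e (- x) y = - B f e x y.
Proof. by rewrite /B mulrN !mulNr linearN raddfN. Qed.

Let BNr f e x y : B f e x (- y) = - B f e x y.
Proof. by rewrite /B starN mulrN linearN raddfN. Qed.

Let T_ge0 f e x : is_projection f -> is_projection e -> 0 <= T f e x.
Proof.
move=> [fs ff] [es ee]; rewrite /T /B.
have -> : tr (f * x * e * star x) = tr (star (e * star x * f) * (e * star x * f)).
  have -> : star (e * star x * f) * (e * star x * f) = (f * x * e * star x) * f.
    by rewrite !starM starK fs es !mulrA -(mulrA (f * x) e e) ee.
  by rewrite [RHS]trC// !mulrA ff.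
by have [_ /(_ (e * star x * f))] := trp; rewrite lecE => /andP[].
Qed.

(** T is a nonnegative quadratic form, so the parallelogram law applies. It is used for 1 = (1 -
    b_i) + b_i. *)
Let T_parallelogram f e x y : is_projection f -> is_projection e ->
  T f e (x + y) <= 2 * T f e x + 2 * T f e y.
Proof.
move=> fp ep; have := T_ge0 (x - y) fp ep.
rewrite /T !BDl !BDr !BNl !BNr; lra.
Qed.

Section Step.
Variables (I : finType) (Om : I -> C -> R[i]).
Hypothesis OmP : forall i, pos_functional (Om i).
Variables (Di : I -> nat) (f : forall i, 'I_(Di i) -> C) (la : forall i, 'I_(Di i) -> R).
Hypothesis fR : forall i, minimal_resolution (@f i).
Hypothesis la0 : forall i a, 0 <= @la i a.
Hypothesis Omla : forall i x, Om i x = \sum_a (@la i a)%:C * tr (@f i a * x).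
Variable b : I -> C.
Hypotheses (b0 : forall i, psd (b i)) (bb : forall i, psd (b i - b i * b i)).
Hypothesis b1 : \sum_i b i = 1.
Variable eps : R.
Hypotheses (eps0 : 0 < eps) (eps1 : eps <= 1).
Hypothesis Omb : forall i, Re (Om i (1 - b i)) <= eps * Re (Om i 1).
Variables (D : nat) (e : 'I_D -> C).
Hypothesis eR : minimal_resolution e.

Let G i (a : 'I_(Di i)) (c : 'I_D) : R := T (@f i a) (e c) 1.

Let mu c : R := \sum_i \sum_a @la i a * G a c.

Let fp i a : is_projection (@f i a). Proof. by have [[] ] := fR i. Qed.
Let ep c : is_projection (e c). Proof. by have [[] ] := eR. Qed.

Let ReM (t : R) z : Re (t%:C * z) = t * Re z.
Proof. by case: z => ? ? /=; rewrite mul0r subr0. Qed.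

Let sum_e (x y : C) : \sum_c Re (tr (x * e c * y)) = Re (tr (x * y)).
Proof.
have [[_ _ e1] _] := eR.
by rewrite -raddf_sum -linear_sum -mulr_suml -mulr_sumr e1 mulr1.
Qed.

Let sum_f i (x : C) : \sum_a Re (tr (@f i a * x)) = Re (tr x).
Proof.
have [[_ _ f1] _] := fR i.
by rewrite -raddf_sum -linear_sum -mulr_suml f1 mul1r.
Qed.

Let muE c : mu c = \sum_i Re (Om i (e c)).
Proof.
apply: eq_bigr => i _; rewrite Omla raddf_sum /=; apply: eq_bigr => a _.
by rewrite ReM /G /T /B mulr1 star1 mulr1.
Qed.

Let ti i : \sum_a @la i a = Re (Om i 1).
Proof.
rewrite Omla raddf_sum /=; apply: eq_bigr => a _.
by rewrite ReM mulr1 tr_minimal ?mulr1//; have [] := fR i.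
Qed.

(** The weight of outcome i for the mixture made diagonal in the basis e. *)
Let q i : R := \sum_c mu c * Re (tr (e c * b i)).

Let mu0 c : 0 <= mu c.
Proof. by do 2 (apply: sumr_ge0 => ? _); rewrite mulr_ge0// T_ge0. Qed.

Let tr_proj_psd (p x : C) : is_projection p -> psd x -> 0 <= Re (tr (p * x)).
Proof.
move=> [ps pp] px.
have -> : tr (p * x) = tr (star p * x * p).
  by rewrite ps trC// [RHS]trC// !mulrA pp -[LHS]trC.
by have := pos_functional_psd trp (psd_conj p px); rewrite lecE => /andP[].
Qed.

Let tr_proj_le (p x y : C) : is_projection p -> psd (y - x) ->
  Re (tr (p * x)) <= Re (tr (p * y)).
Proof.
move=> pp /(tr_proj_psd pp); rewrite mulrBr linearB raddfB /=.
by rewrite subr_ge0.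
Qed.

(** The overlaps G are doubly stochastic, so [entropy_step] applies. For its [test], the minimum is
    bounded by la on the part 1 - b_i of 1 and by s mu on the part b_i; summing over one of the
    bases leaves traces with (1 - b_i)^2 <= 1 - b_i and b_i^2 <= b_i, which are the two errors of
    the test. *)
Lemma quantum_step :
  \sum_i \sum_a xlnx (@la i a) - loss #|I| eps * \sum_i Re (Om i 1) <=
  \sum_c xlnx (\sum_i Re (Om i (e c))).
Proof.
have -> : \sum_i Re (Om i 1) = \sum_i \sum_a @la i a.
  by apply: eq_bigr => i _; rewrite ti.
have -> : \sum_c xlnx (\sum_i Re (Om i (e c))) = \sum_c xlnx (mu c).
  by apply: eq_bigr => c _; rewrite muE.
have sG i (a : 'I_(Di i)) : \sum_c G a c = 1.
  transitivity (\sum_c Re (tr (@f i a * e c * 1))).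
    by apply: eq_bigr => c _; rewrite /G /T /B star1 !mulr1.
  by rewrite sum_e mulr1 tr_minimal//; have [] := fR i.
have sG' i (c : 'I_D) : \sum_a @G i a c = 1.
  transitivity (Re (tr (e c))); last by rewrite tr_minimal//; have [] := eR.
  rewrite -(sum_f i); apply: eq_bigr => a _.
  by rewrite /G /T /B star1 !mulr1.
apply: (entropy_step (q := q)) => //.
- by move=> i a c; exact: T_ge0.
- move=> i; apply: sumr_ge0 => c _; rewrite mulr_ge0 ?mu0//.
  exact: tr_proj_psd.
- rewrite /q exchange_big /=.
  under eq_bigr => c _ do rewrite -mulr_sumr -raddf_sum -linear_sum -mulr_sumr b1 mulr1.
  rewrite le_eqVlt; apply/orP; left; apply/eqP.
  under eq_bigr => c _.
    rewrite (tr_minimal trP) ?mulr1; last by have [] := eR.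
    over.
  rewrite /mu exchange_big; apply: eq_bigr => i _.
  rewrite exchange_big; apply: eq_bigr => a _.
  by rewrite -mulr_sumr sG mulr1.
move=> i s s0; rewrite ti.
have bs : star (b i) = b i by exact: psd_sa.
have cs : star (1 - b i) = 1 - b i by rewrite starB star1 bs.
have pc : psd ((1 - b i) - (1 - b i) * (1 - b i)).
  rewrite -{1}[1 - b i]mul1r -mulrBl opprB addrC subrK mulrBr mulr1.
  exact: bb.
have m0 a c : 0 <= Num.min (@la i a) (s * mu c) by rewrite le_min la0 mulr_ge0.
apply: (@le_trans _ _ (\sum_a \sum_c (2 * (@la i a * T (@f i a) (e c) (1 - b i)) +
    2 * (s * (mu c * T (@f i a) (e c) (b i)))))).
  apply: ler_sum => a _; apply: ler_sum => c _.
  apply: (@le_trans _ _ (Num.min (@la i a) (s * mu c) *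
      (2 * T (@f i a) (e c) (1 - b i) + 2 * T (@f i a) (e c) (b i)))).
    apply: ler_wpM2l; first exact: m0.
    have := T_parallelogram (1 - b i) (b i) (fp a) (ep c).
    by rewrite subrK.
  rewrite mulrDr; apply: lerD; rewrite mulrCA; apply: ler_wpM2l => //.
    by apply: ler_wpM2r; [exact: T_ge0|rewrite ge_min lexx].
  rewrite mulrA; apply: ler_wpM2r; first exact: T_ge0.
  by rewrite ge_min lexx orbT.
under eq_bigr => a _ do rewrite big_split /= -!mulr_sumr.
rewrite big_split /= -!mulr_sumr -mulrDr ler_wpM2l// lerD//.
  apply: le_trans (Omb i).
  apply: (@le_trans _ _ (\sum_a @la i a * Re (tr (@f i a * ((1 - b i) * (1 - b i)))))).
    apply: ler_sum => a _; rewrite ler_wpM2l// /T /B sum_e cs.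
    by rewrite mulrA.
  rewrite Omla raddf_sum /=; apply: ler_sum => a _; rewrite ReM ler_wpM2l//.
  exact: tr_proj_le.
rewrite ler_wpM2l// exchange_big /=; apply: ler_sum => c _.
rewrite -mulr_sumr ler_wpM2l ?mu0//.
apply: (@le_trans _ _ (Re (tr (e c * (b i * b i))))); last exact: tr_proj_le.
rewrite /T /B; under eq_bigr => a _ do rewrite -!mulrA.
rewrite sum_f bs trC//.
by rewrite -!mulrA.
Qed.

End Step.

End QuantumEntropy.

(** * Successive measurements and the trace of the exponential *)

Section EntropyChain.
Variables (R : realType) (C : cStarAlgType R) (tr : {scalar C}).
Hypotheses (Cfd : finite_dimensional C) (trP : canonical_trace tr).
Local Notation Re := (@complex.Re R).

Section Chain.
Variables (I T : finType) (om : T -> C -> R[i]).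
Hypothesis omP : forall w, pos_functional (om w).
Variables (b : nat -> I -> C) (lab : nat -> T -> I) (eps : R).
Hypotheses (eps0 : 0 < eps) (eps1 : eps <= 1).
Local Notation p w := (Re (om w 1)).

Definition decoder k : Prop :=
  [/\ forall i, psd (b k i), forall i, psd (b k i - b k i * b k i),
      \sum_i b k i = 1 & forall w, Re (om w (1 - b k (lab k w))) <= eps * p w].

Let p0 w : 0 <= p w.
Proof. by have := pos_functional_psd (omP w) (psd1 C); rewrite lecE => /andP[]. Qed.

(** Splitting a number into nonnegative parts raises - x ln x, since ln of a part is at most ln of
    the whole. *)
Lemma xlnx_leaf D (e : 'I_D -> C) w : minimal_resolution e ->
  xlnx (p w) <= \sum_c xlnx (Re (om w (e c))).
Proof.
move=> [[ep _ e1] _].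
have oe0 c : 0 <= Re (om w (e c)).
  have [es ee] := ep c; rewrite -ee -{1}es.
  by have [_ /(_ (e c))] := omP w; rewrite lecE => /andP[].
have s1 : p w = \sum_c Re (om w (e c)).
  by rewrite -e1 (linf_sum (pos_functional_lin (omP w))) raddf_sum.
rewrite /xlnx {1}s1 mulr_suml -sumrN; apply: ler_sum => c _.
rewrite lerN2; have [->|n0] := eqVneq (Re (om w (e c))) 0; first by rewrite !mul0r.
have cp : 0 < Re (om w (e c)) by rewrite lt_neqAle eq_sym n0 oe0.
have le : Re (om w (e c)) <= p w by rewrite s1 (bigD1 c)//= lerDl sumr_ge0.
by rewrite ler_wpM2l ?oe0// ler_ln ?posrE// (lt_le_trans cp).
Qed.

(* Splitting along the label read at time [k] costs one [loss]. *)
Lemma entropy_chain m : (forall k, (k < m)%N -> decoder k) ->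
  forall (V : {set T}) D (e : 'I_D -> C), minimal_resolution e ->
  (forall w w', w \in V -> w' \in V ->
    (forall k, (k < m)%N -> lab k w = lab k w') -> w = w') ->
  \sum_(w in V) xlnx (p w) - m%:R * loss #|I| eps * \sum_(w in V) p w <=
  \sum_c xlnx (\sum_(w in V) Re (om w (e c))).
Proof.
elim: m => [|m ih] dec V D e eR inj.
  rewrite !mul0r subr0.
  have [->|[w wV]] := set_0Vmem V.
    rewrite big_set0 sumr_ge0// => c _.
    by rewrite big_set0 /xlnx mul0r oppr0.
  have -> : V = [set w]%SET.
    apply/setP => w'; rewrite !inE; apply/idP/eqP => [w'V|->//].
    exact: inj.
  rewrite big_set1; under eq_bigr => c _ do rewrite big_set1.
  exact: xlnx_leaf.
pose V' i : {set T} := [set w in V | lab m w == i]%SET.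
pose Om i x := \sum_(w in V' i) om w x.
have OmP i : pos_functional (Om i) by exact: pos_functional_sum.
have Hsp i : exists Dfl : {D : nat & (('I_D -> C) * ('I_D -> R))%type},
    [/\ minimal_resolution (tagged Dfl).1, forall a, 0 <= (tagged Dfl).2 a &
     forall x, Om i x = \sum_a ((tagged Dfl).2 a)%:C * tr ((tagged Dfl).1 a * x)].
  have [Df [f [la [fR la0 E]]]] := pos_functional_spectral Cfd trP (OmP i).
  by exists (existT (fun D => (('I_D -> C) * ('I_D -> R))%type) Df (f, la)).
have [S hS] := choice Hsp.
have [b0 bb b1 hb] := dec m (leqnn _).
have ReOm i x : Re (Om i x) = \sum_(w in V' i) Re (om w x) by rewrite raddf_sum.
have split_V (F : T -> R) : \sum_(w in V) F w = \sum_i \sum_(w in V' i) F w.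
  rewrite (partition_big (lab m) xpredT)//=; apply: eq_bigr => i _.
  by apply: eq_bigl => w; rewrite inE.
have Omb i : Re (Om i (1 - b m i)) <= eps * Re (Om i 1).
  rewrite !ReOm mulr_sumr; apply: ler_sum => w; rewrite inE => /andP[_ /eqP <-].
  exact: hb.
have st := @quantum_step R C tr Cfd trP I Om (fun i => tag (S i)) (fun i => (tagged (S i)).1)
  (fun i => (tagged (S i)).2) (fun i => let: And3 h _ _ := hS i in h)
  (fun i => let: And3 _ h _ := hS i in h) (fun i => let: And3 _ _ h := hS i in h)
  (b m) b0 bb b1 eps eps0 eps1 Omb D e eR.
have -> : \sum_c xlnx (\sum_(w in V) Re (om w (e c))) =
    \sum_c xlnx (\sum_i Re (Om i (e c))).
  apply: eq_bigr => c _; rewrite split_V; congr xlnx.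
  by apply: eq_bigr => i _; rewrite ReOm.
apply: le_trans st.
have t1 : \sum_(w in V) p w = \sum_i Re (Om i 1).
  by rewrite split_V; apply: eq_bigr => i _; rewrite ReOm.
rewrite -natr1 mulrDl mul1r mulrDl opprD addrA -t1 lerD2r.
rewrite split_V (split_V (fun w => p w)) mulr_sumr -sumrB; apply: ler_sum => i _.
have [fR la0 E] := hS i.
have dec' k : (k < m)%N -> decoder k by move=> km; apply: dec; exact: leqW.
(* The basis for the induction hypothesis is the eigenbasis of [Om i], in which the diagonal of
   [Om i] consists of its eigenvalues. *)
apply: le_trans (ih dec' (V' i) _ _ fR _) _.
  move=> w w'; rewrite !inE => /andP[wV /eqP wi] /andP[w'V /eqP w'i] h.
  apply: inj => // k; rewrite ltnS leq_eqVlt => /orP[/eqP->|]; last exact: h.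
  by rewrite wi w'i.
apply: ler_sum => a _; rewrite -ReOm E.
have [[fp fo _] fm] := fR.
rewrite (bigD1 a)//= big1 ?addr0 => [|a' aa].
  by have [_ ->] := fp a; rewrite (tr_minimal trP)// mulr1.
by rewrite fo// linear0 mulr0.
Qed.

End Chain.

(** Termwise ln y <= y - 1 at y = e^la t / (Z mu), with t the total mass of mu and Z the sum of the
    exponentials. *)
Lemma gibbs D (la mu : 'I_D -> R) : (forall a, 0 <= mu a) -> 0 < \sum_a mu a ->
  \sum_a mu a * la a + \sum_a xlnx (mu a) <=
  (\sum_a mu a) * ln ((\sum_a expR (la a)) / \sum_a mu a).
Proof.
move=> mu0; set t := \sum_a mu a; set Z := \sum_a expR _ => t0.
have Z0 : 0 < Z.
  case: D la mu mu0 @t @Z t0 => [|D] la mu mu0 t Z t0.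
    by move: t0; rewrite /t big_ord0 ltxx.
  rewrite /Z (bigD1 ord0)//= ltr_pwDl ?expR_gt0// sumr_ge0//.
rewrite ln_div ?posrE// -subr_ge0 {1}/t mulr_suml -big_split -sumrB /=.
apply: (@le_trans _ _ (\sum_a (mu a - expR (la a) * t / Z))).
  rewrite sumrB -/t -mulr_suml -mulr_suml -/Z mulrAC mulfV ?gt_eqF// mul1r.
  by rewrite subrr.
apply: ler_sum => a _.
have [->|n0] := eqVneq (mu a) 0.
  rewrite /xlnx !mul0r oppr0 addr0 subr0 sub0r oppr_le0.
  by rewrite divr_ge0 ?mulr_ge0 ?expR_ge0// ltW.
have mp : 0 < mu a by rewrite lt_neqAle eq_sym n0 mu0.
have y0 : 0 < expR (la a) * t / Z / mu a.
  by rewrite !divr_gt0// mulr_gt0// expR_gt0.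
have := ln_leB1 y0.
rewrite !ln_div ?posrE ?divr_gt0 ?mulr_gt0 ?expR_gt0// lnM ?posrE ?expR_gt0// expRK.
move=> h; have := ler_wpM2l (mu0 a) h.
have -> : mu a * (expR (la a) * t / Z / mu a - 1) = expR (la a) * t / Z - mu a.
  by field; rewrite n0 gt_eqF.
by rewrite /xlnx => ?; lra.
Qed.

(* Gibbs' variational principle for the eigenbasis of [h], combined with the
   lower bound of the entropy in that basis. *)
Theorem trace_exp_lower (I T : finType) (om : T -> C -> R[i])
  (b : nat -> I -> C) (lab : nat -> T -> I) (eps : R) m (S : T -> R) (kap : R) h :
  (forall w, pos_functional (om w)) -> 0 < eps -> eps <= 1 ->
  (forall k, (k < m)%N -> decoder om b lab eps k) ->
  (forall w w', (forall k, (k < m)%N -> lab k w = lab k w') -> w = w') ->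
  (forall w, Re (om w 1) = expR (S w)) -> star h = h ->
  (forall w, expR (S w) * (S w - kap) <= Re (om w h)) ->
  (\sum_w expR (S w)) * expR (- (kap + m%:R * loss #|I| eps)) <=
  Re (tr (cstar_exp h)).
Proof.
move=> omP eps0 eps1 dec inj omS hs hkap.
have [D [e [la [eR hE]]]] := spectral Cfd hs.
have [eR' em] := eR; have [ep _ e1] := eR'.
rewrite hE (resolution_exp eR') (tr_spectral trP)// /=.
set t := \sum_w expR (S w).
have [T0|[w0 _]] := set_0Vmem [set: T]%SET.
  rewrite /t big1 => [|w _]; last by have := finset.in_setT w; rewrite T0 inE.
  by rewrite mul0r; apply: sumr_ge0 => a _; exact: expR_ge0.
have t0 : 0 < t.
  rewrite /t (bigD1 w0)//= ltr_pwDl ?expR_gt0// sumr_ge0//.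
pose mu a := \sum_(w in [set: T]%SET) Re (om w (e a)).
have mu0 a : 0 <= mu a.
  apply: sumr_ge0 => w _; have [es ee] := ep a; rewrite -ee -{1}es.
  by have [_ /(_ (e a))] := omP w; rewrite lecE => /andP[].
have st : \sum_a mu a = t.
  rewrite exchange_big /= /t; apply: eq_big => [w|w _]; first by rewrite inE.
  by rewrite -raddf_sum /= -(linf_sum (pos_functional_lin (omP w))) e1 omS.
have inj' w w' : w \in [set: T]%SET -> w' \in [set: T]%SET ->
  (forall k, (k < m)%N -> lab k w = lab k w') -> w = w' by move=> _ _; exact: inj.
have H1 := entropy_chain omP eps0 eps1 dec eR inj'.
have H2 : \sum_a mu a * la a = \sum_w Re (om w h).
  transitivity (\sum_w \sum_a Re (om w (e a)) * la a).
    rewrite exchange_big /=; apply: eq_bigr => a _; rewrite /mu mulr_suml.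
    by apply: eq_bigl => w; rewrite inE.
  apply: eq_bigr => w _.
  rewrite hE (linf_sum (pos_functional_lin (omP w))) raddf_sum.
  apply: eq_bigr => a _ /=; rewrite (linf_Z (pos_functional_lin (omP w))).
  by rewrite /GRing.scale /=; case: (om w (e a)) => ? ? /=; rewrite mul0r subr0 mulrC.
have mt : 0 < \sum_a mu a by rewrite st.
have G := gibbs la mu0 mt.
have H3 : \sum_(w in [set: T]%SET) Re (om w 1) = t.
  by apply: eq_big => [w|w _]; rewrite ?inE ?omS.
have H4 : \sum_(w in [set: T]%SET) xlnx (Re (om w 1)) = - \sum_w expR (S w) * S w.
  rewrite -sumrN; apply: eq_big => [w|w _]; first by rewrite inE.
  by rewrite omS /xlnx expRK.
have H5 : \sum_w expR (S w) * S w - kap * t <= \sum_w Re (om w h).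
  rewrite /t mulr_sumr -sumrB; apply: ler_sum => w _.
  by apply: le_trans (hkap w); rewrite mulrBr [kap * _]mulrC.
rewrite H3 H4 in H1; rewrite H2 st in G.
set Z := \sum_a expR (la a) in G *.
have Zp : 0 < Z.
  have D0 : (0 < D)%N.
    rewrite lt0n; apply/eqP => D0; move: mt; rewrite big1 ?ltxx// => a _.
    by have := ltn_ord a; rewrite {2}D0 ltn0.
  rewrite /Z (bigD1 (Ordinal D0))//= ltr_pwDl ?expR_gt0// sumr_ge0//.
have h1 : t * (- (kap + m%:R * loss #|I| eps)) <= t * ln (Z / t) by lra.
have h2 : expR (- (kap + m%:R * loss #|I| eps)) <= expR (ln (Z / t)).
  by rewrite ler_expR -(ler_pM2l t0).
by rewrite mulrC -ler_pdivlMr// -[leRHS]lnK// posrE divr_gt0.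
Qed.

End EntropyChain.

(** * Words and paths *)

Section Degrees.
Variable r : nat.
Implicit Types m n k l : deg r.

Lemma le_degP m n : reflect (forall i, (m i <= n i)%N) (le_deg m n).
Proof. exact: forallP. Qed.

Definition dsub n m : deg r := [ffun i => (n i - m i)%N].

Lemma dsubK m n : le_deg m n -> m + dsub n m = n.
Proof. by move=> /le_degP h; apply/ffunP => i; rewrite !ffunE; exact: subnKC. Qed.

Lemma deg_addI m : injective (+%R m : deg r -> deg r).
Proof. by move=> n k /ffunP h; apply/ffunP => i; have := h i; rewrite !ffunE => /addnI. Qed.

Lemma le_deg_addr m n : le_deg m (m + n).
Proof. by apply/le_degP => i; rewrite ffunE leq_addr. Qed.

Lemma le_deg_trans m n k : le_deg m n -> le_deg n k -> le_deg m k.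
Proof.
by move=> /le_degP h /le_degP h'; apply/le_degP => i; exact: leq_trans (h i) (h' i).
Qed.

Lemma le_deg_add2l m n k : le_deg (m + n) (m + k) = le_deg n k.
Proof.
by apply/le_degP/le_degP => h i; have := h i; rewrite !ffunE leq_add2l.
Qed.

Definition dconst (k : nat) : deg r := [ffun=> k].

(** A bound for all coordinates; the sum serves as well as the maximum. *)
Definition dmax m : nat := \sum_i m i.

Lemma le_dconst m (k : nat) : (dmax m <= k)%N -> le_deg m (dconst k).
Proof.
move=> h; apply/le_degP => i; rewrite ffunE (leq_trans _ h)//.
by rewrite /dmax (bigD1 i)//= leq_addr.
Qed.

Lemma dconst_le (k k' : nat) : (k <= k')%N -> le_deg (dconst k) (dconst k').
Proof. by move=> h; apply/le_degP => i; rewrite !ffunE. Qed.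

End Degrees.

Section Words.
Variables (r : nat) (L : kGraph r).
Implicit Types (u v w : L) (m n : deg r).

Lemma kmul_inj u v u' v' : trm u = org v -> trm u' = org v' ->
  kshape u = kshape u' -> kmul u v = kmul u' v' -> u = u' /\ v = v'.
Proof.
move=> uv uv' uu E.
have vv : kshape v' = kshape v.
  apply: (@deg_addI _ (kshape u)); rewrite -(shape_mul uv) E (shape_mul uv').
  by rewrite uu.
have [x [_ ux]] := factorisation (shape_mul uv).
have h1 := ux (u, v); have h2 := ux (u', v'); move: h1 h2 => /= h1 h2.
have e1 : x = (u, v) by apply: h1.
have e2 : x = (u', v') by apply: h2; split; rewrite -?uu.
by move: e2; rewrite e1 => -[].
Qed.

(* Junk value [(w, w)] unless [m <= kshape w]. *)
Definition fac m w : L * L := xget (w, w)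
  [set uv : L * L | [/\ kshape uv.1 = m, trm uv.1 = org uv.2 & w = kmul uv.1 uv.2]].

Definition hd m w : L := (fac m w).1.
Definition tl m w : L := (fac m w).2.

Lemma facP m w : le_deg m (kshape w) ->
  [/\ kshape (hd m w) = m, trm (hd m w) = org (tl m w) & w = kmul (hd m w) (tl m w)].
Proof.
move=> /dsubK/esym mw; have [uv [[h1 h2 h3 h4] _]] := factorisation mw.
rewrite /hd /tl /fac; set S := [set _ | _].
by case: (xgetPex (w, w) (ex_intro S uv (And3 h1 h3 h4))).
Qed.

Lemma fac_kmul u v : trm u = org v -> hd (kshape u) (kmul u v) = u /\ tl (kshape u) (kmul u v) = v.
Proof.
move=> uv; have [|h1 h2 h3] := @facP (kshape u) (kmul u v).
  by rewrite (shape_mul uv) le_deg_addr.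
by have [<- <-] := kmul_inj uv h2 (esym h1) h3.
Qed.

Lemma hd_kmul u v : trm u = org v -> hd (kshape u) (kmul u v) = u.
Proof. by move=> /fac_kmul[]. Qed.

Lemma tl_kmul u v : trm u = org v -> tl (kshape u) (kmul u v) = v.
Proof. by move=> /fac_kmul[]. Qed.

Lemma shape_tl m w : le_deg m (kshape w) -> m + kshape (tl m w) = kshape w.
Proof. by move=> /facP[h1 h2 h3]; rewrite [in RHS]h3 (shape_mul h2) h1. Qed.

Lemma shape_hd m w : le_deg m (kshape w) -> kshape (hd m w) = m.
Proof. by move=> /facP[]. Qed.

Lemma trm_tl m w : le_deg m (kshape w) -> trm (tl m w) = trm w.
Proof. by move=> /facP[h1 h2 h3]; rewrite [in RHS]h3 (trm_mul h2). Qed.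

Lemma org_hd m w : le_deg m (kshape w) -> org (hd m w) = org w.
Proof. by move=> /facP[h1 h2 h3]; rewrite [in RHS]h3 (org_mul h2). Qed.

Lemma trm_hd m w : le_deg m (kshape w) -> trm (hd m w) = org (tl m w).
Proof. by move=> /facP[]. Qed.

Lemma hd_tl m w : le_deg m (kshape w) -> kmul (hd m w) (tl m w) = w.
Proof. by move=> /facP[]. Qed.

Lemma trm_org u : trm (org u) = org u.
Proof. by rewrite trm_id ?shape_org. Qed.

Lemma org_trm u : org (trm u) = trm u.
Proof. by rewrite org_id ?shape_trm. Qed.

Lemma org_obj u : objects L (org u). Proof. exact: shape_org. Qed.
Lemma trm_obj u : objects L (trm u). Proof. exact: shape_trm. Qed.

(* The segment [w_(m, m + n)]; a junk value unless [m + n <= kshape w]. *)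
Definition sub m n w : L := hd n (tl m w).

Lemma sub_kmul m n u v : trm u = org v -> le_deg (m + n) (kshape u) ->
  sub m n (kmul u v) = sub m n u.
Proof.
move=> uv mn.
have mu : le_deg m (kshape u) by apply: le_deg_trans mn; exact: le_deg_addr.
have [h1 h2 h3] := facP mu.
have nt : le_deg n (kshape (tl m u)) by rewrite -(le_deg_add2l m) shape_tl.
have [g1 g2 g3] := facP nt.
have tv : trm (tl m u) = org v by rewrite trm_tl.
have -> : kmul u v = kmul (hd m u) (kmul (tl m u) v).
  by rewrite kmulA// -h3.
rewrite /sub; rewrite -{1}h1 tl_kmul ?(org_mul tv)//.
have tv2 : trm (tl n (tl m u)) = org v by rewrite trm_tl.
rewrite {1}g3 -kmulA// -{1}g1 hd_kmul// ?(org_mul tv2)//.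
Qed.

Section Paths.
Implicit Types x y : infpath L.

(** [seg] without the proof argument; a junk value unless m <= n. *)
Definition sg x m n : L :=
  if pselect (le_deg m n) is left h then seg x h else seg x (le_deg_refl 0).

Lemma sgE x m n (h : le_deg m n) : sg x m n = seg x h.
Proof.
by rewrite /sg; case: pselect => [h'|//]; rewrite (bool_irrelevance h' h).
Qed.

Lemma sg_shape x m n : le_deg m n -> m + kshape (sg x m n) = n.
Proof. by move=> h; rewrite (sgE x h) seg_shape. Qed.

Lemma sg_shape0 x n : kshape (sg x 0 n) = n.
Proof. by have := sg_shape x (le0_deg n); rewrite add0r. Qed.

Lemma sg_mul x m k n : le_deg m k -> le_deg k n ->
  trm (sg x m k) = org (sg x k n) /\ sg x m n = kmul (sg x m k) (sg x k n).
Proof.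
move=> mk kn; have mn := le_deg_trans mk kn.
by rewrite (sgE x mk) (sgE x kn) (sgE x mn); exact: seg_mul.
Qed.

Lemma cylinderE u x : cylinder u x <-> sg x 0 (kshape u) = u.
Proof. by rewrite (sgE x (le0_deg _)). Qed.

Lemma hd_sg x m n : le_deg m n -> hd m (sg x 0 n) = sg x 0 m.
Proof.
move=> mn; have [h1 ->] := sg_mul x (le0_deg m) mn.
by rewrite -{1}(sg_shape0 x m) hd_kmul.
Qed.

Lemma tl_sg x m n : le_deg m n -> tl m (sg x 0 n) = sg x m n.
Proof.
move=> mn; have [h1 ->] := sg_mul x (le0_deg m) mn.
by rewrite -{1}(sg_shape0 x m) tl_kmul.
Qed.

Lemma hd_sg_gen x m k n : le_deg m k -> le_deg k n ->
  hd (dsub k m) (sg x m n) = sg x m k.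
Proof.
move=> mk kn; have [h1 ->] := sg_mul x mk kn.
suff -> : dsub k m = kshape (sg x m k) by rewrite hd_kmul.
apply: (@deg_addI _ m).
by rewrite dsubK ?sg_shape.
Qed.

Lemma sub_sg x m n k : le_deg (m + n) k -> sub m n (sg x 0 k) = sg x m (m + n).
Proof.
move=> mnk; have mk : le_deg m k by apply: le_deg_trans mnk; exact: le_deg_addr.
rewrite /sub tl_sg//.
have E : dsub (m + n) m = n.
  by apply: (@deg_addI _ m); rewrite dsubK ?le_deg_addr.
by have := hd_sg_gen x (le_deg_addr m n) mnk; rewrite E.
Qed.

Lemma sg_agree x y k m n : sg x 0 k = sg y 0 k -> le_deg m n -> le_deg n k ->
  sg x m n = sg y m n.
Proof.
move=> xy mn nk; have mk := le_deg_trans mn nk.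
by rewrite -(hd_sg_gen x mn nk) -(hd_sg_gen y mn nk) -(tl_sg x mk) -(tl_sg y mk) xy.
Qed.

Lemma sg_shift p x m n : le_deg m n ->
  sg (path_shift p x) m n = sg x (m + p) (n + p).
Proof. by move=> mn; rewrite (sgE _ mn) (sgE _ (le_degD p mn)). Qed.

Lemma sg_iter_shift p x j m n : le_deg m n ->
  sg (iter j (path_shift p) x) m n = sg x (m + p *+ j) (n + p *+ j).
Proof.
elim: j x m n => [|j ih] x m n mn; first by rewrite mulr0n !addr0.
by rewrite iterS sg_shift// ih ?le_degD// -!addrA -!mulrS.
Qed.

(* If two shifts of [x] agreed, the difference of their degrees would be a period. *)
Lemma aperiodic_separates x m m' : m != m' ->
  (forall (n : deg r) (q : {ffun 'I_r -> int}),
      q != 0 -> ~ period (path_shift n x) q) ->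
  exists l, sg x m (m + l) <> sg x m' (m' + l).
Proof.
move=> mm' ap; apply: contrapT => h.
have E l : sg x m (m + l) = sg x m' (m' + l).
  by apply: contrapT => hl; apply: h; exists l.
have E2 a b : le_deg a b -> sg x (m + a) (m + b) = sg x (m' + a) (m' + b).
  move=> ab.
  have := sg_agree (x := path_shift m x) (y := path_shift m' x) (k := b) _ ab (le_deg_refl b).
  rewrite !sg_shift ?le0_deg// !add0r !(addrC b) E => /(_ erefl).
  by rewrite !(addrC a).
pose q : {ffun 'I_r -> int} := [ffun i => (m' i)%:Z - (m i)%:Z].
apply: (ap m q).
  apply: contraNneq mm' => /ffunP q0; apply/eqP/ffunP => i.
  by have := q0 i; rewrite !ffunE => /eqP; rewrite subr_eq0 => /eqP[->].
move=> a b a' b' ab ab' ha hb.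
rewrite -!sgE !sg_shift// !(addrC _ m) [RHS]E2//.
have H (c c' : deg r) : (forall i, (c' i)%:Z = (c i)%:Z + q i) -> m + c' = m' + c.
  move=> hc; apply/ffunP => i; have := hc i; rewrite !ffunE => hi.
  by apply/eqP; rewrite -eqz_nat !PoszD hi addrCA subrKC addrC.
by rewrite (H _ _ ha) (H _ _ hb).
Qed.

End Paths.

End Words.

(** * Norm closures of star-algebras *)

Section Closure.
Variables (R : realType) (A : cStarAlgType R) (S : set A).
Hypotheses (S0 : S 0) (Sl : forall (z : R[i]) a b, S a -> S b -> S (z *: a + b)).
Hypotheses (Sm : forall a b, S a -> S b -> S (a * b)) (Ss : forall a, S a -> S (star a)).

Definition nclosure : set A :=
  [set a | forall e : R, 0 < e -> exists2 b, S b & nrm (a - b) < e].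

Lemma nclosure_sub a : S a -> nclosure a.
Proof. by move=> Sa e e0; exists a; rewrite // subrr nrm0. Qed.

Lemma nclosure_subalg : cstar_subalgebra nclosure.
Proof.
split.
  apply: closed_nrmP => a h e e0; have e2 : 0 < e / 2 by rewrite divr_gt0.
  have [b hb ab] := h _ e2; have [c Sc bc] := hb _ e2.
  exists c => //; rewrite (le_lt_trans (nrm_dist_add b _ _))// (splitr e).
  exact: ltrD.
split; first exact: nclosure_sub.
split.
  move=> z a b ha hb e e0; have e2 : 0 < e / 2 by rewrite divr_gt0.
  have z0 : 0 < nc z + 1 by rewrite ltr_wpDl ?nc_ge0.
  have [c Sc ac] := ha _ (divr_gt0 e2 z0); have [d Sd bd] := hb _ e2.
  exists (z *: c + d); first exact: Sl.
  rewrite opprD addrACA -scalerBr (le_lt_trans (nrmD _ _))// (splitr e).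
  rewrite ler_ltD// nrmZ.
  apply: (@le_trans _ _ (nc z * (e / 2 / (nc z + 1)))).
    by rewrite ler_wpM2l ?nc_ge0// ltW.
  by rewrite mulrCA ler_piMr ?(ltW e2)// ler_pdivrMr// mul1r lerDl.
split.
  move=> a b ha hb e e0.
  pose M := nrm a + nrm b + 1.
  have M0 : 0 < M by rewrite ltr_wpDl// addr_ge0 ?nrm_ge0.
  pose d := Num.min 1 (e / (2 * M)).
  have d0 : 0 < d by rewrite lt_min ltr01 divr_gt0// mulr_gt0.
  have [a' Sa' aa'] := ha _ d0; have [b' Sb' bb'] := hb _ d0.
  exists (a' * b'); first exact: Sm.
  have -> : a * b - a' * b' = (a - a') * b + a' * (b - b').
    by rewrite mulrBl mulrBr addrA subrK.
  have a'n : nrm a' <= nrm a + 1.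
    rewrite -[a'](subrK a) (le_trans (nrmD _ _))// addrC lerD2l nrm_distC.
    by rewrite (le_trans (ltW aa'))// ge_min lexx.
  have dM : d * (2 * M) <= e by rewrite -ler_pdivlMr ?mulr_gt0// ge_min lexx orbT.
  apply: (@le_lt_trans _ _ (d * nrm b + (nrm a + 1) * d)).
    rewrite (le_trans (nrmD _ _))// lerD// (le_trans (nrmM _ _))//.
      by rewrite ler_wpM2r ?nrm_ge0// ltW.
    by rewrite ler_pM ?nrm_ge0// ltW.
  apply: lt_le_trans dM; rewrite mulrC -mulrDl mulrC ltr_pM2l//.
  by have := nrm_ge0 a; have := nrm_ge0 b; rewrite /M; lra.
move=> a ha e e0; have [b Sb ab] := ha _ e0.
by exists (star b); [exact: Ss|rewrite -starB nrm_star].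
Qed.

End Closure.

(** * The algebra of the graph *)

Section GraphRelations.
Variables (R : realType) (r : nat) (L : kGraph r).
Hypotheses (Lrow : row_finite L) (Lfin : finite_set (objects L)).
Variables (O : cStarAlgType R) (s : L -> O).
Hypotheses (sF : graph_family s) (sgen : cstar_gen (range s) = setT).
Implicit Types (u v w : L) (m n : deg r) (Y : O).

Lemma finite_words m : finite_set (words_of L m).
Proof.
have -> : words_of L m = \bigcup_(a in objects L) words_from m a.
  apply/seteqP; split=> [w wm|w [a _ []]//].
  by exists (org w) => //; exact: org_obj.
by apply: bigcup_finite => // a ao; exact: Lrow.
Qed.

Definition wds m : {fset L} := fset_set (words_of L m).

Lemma wdsP m w : (w \in wds m) = (kshape w == m).
Proof.
rewrite (in_fset_set (finite_words m)).
by apply/idP/eqP => [/set_mem|wm]; last exact/mem_set.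
Qed.

Lemma fsum_words m (V : nmodType) (F : L -> V) :
  \sum_(w \in words_of L m) F w = \sum_(w <- wds m) F w.
Proof. by rewrite (fsbig_finite _ _ (finite_words m)). Qed.

Lemma s_proj u : is_projection (s (org u)).
Proof. by case: sF => h _; apply: h; exact: org_obj. Qed.

Lemma s_mul u v : trm u = org v -> s (kmul u v) = s u * s v.
Proof. by case: sF => _ [_ [h _]]; exact: h. Qed.

Lemma star_s u : star (s u) * s u = s (trm u).
Proof. by case: sF => _ [_ [_ [h _]]]; exact: h. Qed.

Lemma s_org u : s (org u) * s u = s u.
Proof. by rewrite -s_mul ?trm_org// kmul1l. Qed.

Lemma s_trm u : s u * s (trm u) = s u.
Proof. by rewrite -s_mul ?org_trm// kmul1r. Qed.

Lemma s_obj a : objects L a -> is_projection (s a).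
Proof. by case: sF => h _; exact: h. Qed.

Lemma s_obj_orth a b : objects L a -> objects L b -> a <> b -> s a * s b = 0.
Proof. by case: sF => _ [h _]; exact: h. Qed.

Lemma star_s_org u : star (s u) * s (org u) = star (s u).
Proof. by have [es _] := s_proj u; rewrite -{1}es -starM s_org. Qed.

Lemma star_s_trm u : s (trm u) * star (s u) = star (s u).
Proof. by have [es _] := s_obj (trm_obj u); rewrite -{1}es -starM s_trm. Qed.

Lemma star_s_orth_org u v : org u <> org v -> star (s u) * s v = 0.
Proof.
move=> uv; rewrite -star_s_org -(s_org v) -mulrA (mulrA (s (org u))).
by rewrite s_obj_orth ?mul0r ?mulr0//; exact: org_obj.
Qed.

Lemma s_trm_neq u v : trm u <> org v -> s u * s v = 0.
Proof.
move=> uv; rewrite -s_trm -(s_org v) -mulrA (mulrA (s (trm u))).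
by rewrite s_obj_orth ?mul0r ?mulr0//; [exact: trm_obj|exact: org_obj].
Qed.

Let unit_mul n v : (\sum_(u <- wds n) s u * star (s u)) * s v = s v.
Proof.
case: (sF) => _ [_ [_ [_ h]]].
have fin : finite_set (words_from n (org v)) by apply: Lrow; exact: org_obj.
rewrite -[in RHS](s_org v) (h _ n (org_obj v)) fsbig_finite//= mulr_suml.
rewrite (bigID (fun u => org u == org v))/= [X in _ + X]big1 ?addr0.
  rewrite -mulr_suml; congr (_ * _); rewrite -[LHS]big_filter; apply: perm_big.
  apply: uniq_perm; rewrite ?filter_uniq ?fset_uniq// => u.
  rewrite mem_filter wdsP in_fset_set//; apply/andP/idP.
    by move=> [/eqP uo /eqP un]; apply/mem_set.
  by move=> /set_mem[-> ->].
by move=> u /eqP uv; rewrite -mulrA star_s_orth_org// mulr0.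
Qed.

(** The relations give P s_v = s_v, and P is a unit on both sides of every generator. The elements
    with this property form a C*-subalgebra, which is everything, so P = 1. *)
Lemma s_unit n : \sum_(u <- wds n) s u * star (s u) = 1.
Proof.
set P := \sum_(u <- _) _.
have Ps : star P = P.
  by rewrite star_sum; apply: eq_bigr => u _; rewrite starM starK.
pose S := [set b : O | P * b = b /\ b * P = b].
have SA : cstar_subalgebra S.
  split.
    have -> : S = [set b | P * b = b] `&` [set b | b * P = b] by [].
    apply: closed_nrmP => a h; suff : P * a = a /\ a * P = a by [].
    have H (x y : O) : (forall e, 0 < e -> nrm (x - y) <= e) -> x = y.
      move=> hh; apply/eqP; rewrite -subr_eq0 -nrm_eq0 eq_le nrm_ge0 andbT.
      by apply/ler_addgt0Pr => e e0; rewrite add0r hh.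
    have M0 : 0 < nrm P + 1 by rewrite ltr_wpDl ?nrm_ge0.
    split; apply: H => e e0; have [b [b1 b2] ab] := h _ (divr_gt0 e0 M0).
      have -> : P * a - a = P * (a - b) - (a - b).
        by rewrite mulrBr b1 opprB addrA subrK.
      rewrite (le_trans (nrmB _ _))// (le_trans (lerD (nrmM _ _) (lexx _)))//.
      by rewrite -{2}[nrm (a - b)]mul1r -mulrDl mulrC -ler_pdivlMr// ltW.
    have -> : a * P - a = (a - b) * P - (a - b).
      by rewrite mulrBl b2 opprB addrA subrK.
    rewrite (le_trans (nrmB _ _))// (le_trans (lerD (nrmM _ _) (lexx _)))//.
    by rewrite -{2}[nrm (a - b)]mulr1 -mulrDr -ler_pdivlMr// ltW.
  split; first by rewrite /S /= mulr0 mul0r.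
  split.
    move=> z a b [a1 a2] [b1 b2]; split.
      by rewrite mulrDr -scalerAre a1 b1.
    by rewrite mulrDl -scalerAle a2 b2.
  split.
    by move=> a b [a1 a2] [b1 b2]; split; [rewrite mulrA a1|rewrite -mulrA b2].
  by move=> a [a1 a2]; split; rewrite -{1}Ps -starM ?a1 ?a2.
have sub : range s `<=` S.
  move=> _ [v _ <-]; split; first exact: unit_mul.
  have h : P * s (trm v) = s (trm v) by exact: unit_mul.
  have [es _] := s_obj (trm_obj v).
  by rewrite -{1}(s_trm v) -mulrA -{1}es -{1}Ps -starM h es s_trm.
have : S 1.
  suff : cstar_gen (range s) `<=` S by apply; rewrite sgen.
  exact: smallest_sub.
by move=> [_]; rewrite mul1r.
Qed.

Lemma psd_sum_eq0_seq (A : cStarAlgType R) (I : eqType) (t : seq I) (F : I -> A) :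
  (forall i, i \in t -> psd (F i)) -> \sum_(i <- t) F i = 0 ->
  forall i, i \in t -> F i = 0.
Proof.
move=> pF s0 i it; apply: nrm0_eq0; apply/eqP; rewrite eq_le nrm_ge0 andbT.
have := psd_mono (pF i it) (z := \sum_(i <- t) F i); rewrite s0 nrm0; apply.
rewrite -s0 (big_rem i it)/= addrAC subrr add0r.
by apply: psd_sum => j /mem_rem jt _; exact: pF.
Qed.

Lemma s_psd u : psd (s u * star (s u)).
Proof. by rewrite -{1}[s u]starK; exact: psd_starM. Qed.

Lemma s_partial u : s u * star (s u) * s u = s u.
Proof. by rewrite -mulrA star_s s_trm. Qed.

(** The relations assert orthogonality only for objects. The range projections q_w of one shape sum
    to 1; compressing this by q_v shows that the positive elements (q_w q_v)^* (q_w q_v), w <> v,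
    sum to 0. *)
Lemma star_s_orth u v : kshape u = kshape v -> u != v -> star (s u) * s v = 0.
Proof.
move=> uv unv.
have [q qE] : exists q : L -> O, forall w, q w = s w * star (s w) by eexists.
have qs w : star (q w) = q w by rewrite qE starM starK.
have qq w : q w * q w = q w by rewrite qE mulrA s_partial.
have vin : v \in wds (kshape v) by rewrite wdsP.
have uin : u \in rem v (wds (kshape v)).
  by rewrite mem_rem_uniq ?fset_uniq// inE unv wdsP uv eqxx.
have s0 : \sum_(w <- rem v (wds (kshape v))) star (q w * q v) * (q w * q v) = 0.
  have E : q v * (\sum_(w <- wds (kshape v)) q w) * q v = q v.
    have -> : \sum_(w <- wds (kshape v)) q w = 1.
      by rewrite -(s_unit (kshape v)); apply: eq_bigr => w _; rewrite qE.
    by rewrite mulr1; exact: qq.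
  rewrite (big_rem v vin)/= mulrDr mulrDl !qq in E.
  move/eqP: E; rewrite -subr_eq0 addrAC subrr add0r => /eqP E.
  rewrite -[RHS]E mulr_sumr mulr_suml; apply: eq_bigr => w _.
  by rewrite starM !qs mulrA -(mulrA _ (q w) (q w)) qq.
have z := psd_sum_eq0_seq (fun w _ => psd_starM (q w * q v)) s0 uin.
have quv : q u * q v = 0.
  apply: nrm0_eq0; apply/eqP; have := nrm_starM (q u * q v).
  by rewrite z nrm0 => /esym/eqP; rewrite expf_eq0.
have E1 : star (s u) * q u = star (s u).
  by rewrite qE mulrA star_s star_s_trm.
have E2 : q v * s v = s v by rewrite qE s_partial.
by rewrite -E1 -E2 mulrA -(mulrA _ (q u)) quv mulr0 mul0r.
Qed.

Lemma star_s_mul u w : le_deg (kshape u) (kshape w) ->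
  star (s u) * s w = if hd (kshape u) w == u then s (tl (kshape u) w) else 0.
Proof.
move=> uw; have [h1 h2 h3] := facP uw.
rewrite {1}h3 (s_mul h2) mulrA; case: eqP => [hu|hu].
  by rewrite hu in h2 *; rewrite star_s h2 s_org.
by rewrite star_s_orth ?mul0r//; apply/eqP => E; apply: hu.
Qed.

Lemma s_mul_star w u : le_deg (kshape u) (kshape w) ->
  star (s w) * s u = if hd (kshape u) w == u then star (s (tl (kshape u) w)) else 0.
Proof.
move=> uw; rewrite -[LHS]starK starM starK star_s_mul//.
by case: ifP => _; rewrite ?star0.
Qed.

Definition shift_map m Y : O := \sum_(w <- wds m) s w * Y * star (s w).

Lemma canonical_shiftE m Y : canonical_shift s m Y = shift_map m Y.
Proof. exact: fsum_words. Qed.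

Lemma shift_map_lin m : linear (shift_map m).
Proof.
move=> z a b; rewrite /shift_map scaler_sumr -big_split; apply: eq_bigr => w _ /=.
by rewrite mulrDr mulrDl -scalerAre -scalerAle.
Qed.

Lemma shift_map_pos m : pos_unital (shift_map m).
Proof.
split; first exact: shift_map_lin.
  by rewrite /shift_map; under eq_bigr => w _ do rewrite mulr1; exact: s_unit.
move=> y; apply: psd_sum => w _ _.
have -> : s w * (star y * y) * star (s w) = star (y * star (s w)) * (y * star (s w)).
  by rewrite starM starK !mulrA.
exact: psd_starM.
Qed.

Lemma star_s_shift m u v Y : le_deg m (kshape u) -> le_deg m (kshape v) ->
  star (s u) * shift_map m Y * s v =
  if hd m u == hd m v then star (s (tl m u)) * Y * s (tl m v) else 0.
Proof.
move=> mu mv.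
have uin : hd m u \in wds m by rewrite wdsP shape_hd.
have hu := @s_mul_star u (hd m u); rewrite shape_hd// eqxx in hu.
have hv := @star_s_mul (hd m u) v; rewrite shape_hd// in hv.
rewrite mulr_sumr mulr_suml (big_rem _ uin)/= big_seq big1 ?addr0.
  rewrite !mulrA (hu mu) -mulrA (hv mv) eq_sym.
  by case: ifP => _; rewrite ?mulr0.
move=> w; rewrite mem_rem_uniq ?fset_uniq// inE wdsP => /andP[wu /eqP wm].
have := @s_mul_star u w; rewrite wm => /(_ mu).
by rewrite eq_sym (negbTE wu) !mulrA => ->; rewrite !mul0r.
Qed.

Lemma allpairs_f_mem (I J : eqType) (t : seq I) (t' : seq J) x y :
  ((x, y) \in [seq (i, j) | i <- t, j <- t']) = (x \in t) && (y \in t').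
Proof.
apply/allpairsP/andP => [[[i j] /= [hi hj [-> ->]]]|[hx hy]] //.
by exists (x, y).
Qed.

(** The factorisation property as a bijection of finite lists, to reindex sums over words of shape m
    + n. *)
Lemma fac_perm m n :
  perm_eq [seq x <- [seq (u, v) | u <- wds m, v <- wds n] | trm x.1 == org x.2]
    [seq (hd m w, tl m w) | w <- wds (m + n)].
Proof.
apply: uniq_perm.
- rewrite filter_uniq// allpairs_uniq ?fset_uniq// => -[? ?] [? ?] _ _ /= [-> ->] //.
- rewrite map_inj_in_uniq ?fset_uniq// => w w'.
  rewrite !wdsP => /eqP wm /eqP w'm [e1 e2].
  by rewrite -(@hd_tl _ _ m w) ?wm ?le_deg_addr// e1 e2 hd_tl// w'm le_deg_addr.
move=> [u v]; rewrite mem_filter /=; apply/andP/mapP.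
  move=> [/eqP uv]; rewrite allpairs_f_mem => /andP[].
  rewrite !wdsP => /eqP um /eqP vn; exists (kmul u v).
    by rewrite wdsP (shape_mul uv) um vn.
  by rewrite -{1}um -um hd_kmul// tl_kmul.
move=> [w]; rewrite wdsP => /eqP wmn [-> ->].
have mw : le_deg m (kshape w) by rewrite wmn le_deg_addr.
rewrite trm_hd// eqxx allpairs_f_mem !wdsP shape_hd// eqxx; split=> //.
by apply/eqP/(@deg_addI _ m); rewrite shape_tl.
Qed.

Lemma shift_mapD m n Y : shift_map m (shift_map n Y) = shift_map (m + n) Y.
Proof.
rewrite /shift_map; under eq_bigr => u _ do rewrite mulr_sumr mulr_suml.
transitivity (\sum_(x <- [seq (u, v) | u <- wds m, v <- wds n])
   s x.1 * (s x.2 * Y * star (s x.2)) * star (s x.1)).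
  by rewrite big_allpairs_dep.
rewrite (bigID (fun x => trm x.1 == org x.2))/= [X in _ + X]big1 ?addr0.
  rewrite -big_filter (perm_big _ (fac_perm m n)) big_map /= big_seq [RHS]big_seq.
  apply: eq_bigr => w; rewrite wdsP => /eqP wm.
  have mw : le_deg m (kshape w) by rewrite wm le_deg_addr.
  have [h1 h2 h3] := facP mw.
  by rewrite [in RHS]h3 (s_mul h2) starM !mulrA.
by move=> x /eqP wn; rewrite !mulrA s_trm_neq// !mul0r.
Qed.

End GraphRelations.

(** * Monomials and diagonal elements *)

Section Span.
Variables (R : realType) (r : nat) (L : kGraph r).
Hypotheses (Lrow : row_finite L) (Lfin : finite_set (objects L)).
Variables (O : cStarAlgType R) (s : L -> O).
Hypotheses (sF : graph_family s) (sgen : cstar_gen (range s) = setT).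
Implicit Types (u v w : L) (m n : deg r) (Y : O).
Local Notation wds := (@wds r L).

Inductive spn : O -> Prop :=
| spn0 : spn 0
| spnS c u v b : spn b -> spn (c *: (s u * star (s v)) + b).

Lemma spn_mono c u v : spn (c *: (s u * star (s v))).
Proof. by rewrite -[_ *: _]addr0; apply: spnS; exact: spn0. Qed.

Lemma spnD a b : spn a -> spn b -> spn (a + b).
Proof.
by move=> ha hb; elim: ha => [|c u v a' _ ih]; rewrite ?add0r// -addrA; exact: spnS.
Qed.

Lemma spnZ z a : spn a -> spn (z *: a).
Proof.
elim=> [|c u v a' _ ih]; first by rewrite scaler0; exact: spn0.
by rewrite scalerDr scalerA; exact: spnS.
Qed.

Lemma spn_sum (I : Type) (t : seq I) (P : pred I) (F : I -> O) :
  (forall i, P i -> spn (F i)) -> spn (\sum_(i <- t | P i) F i).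
Proof. by move=> h; apply: big_ind => //; [exact: spn0|exact: spnD]. Qed.

Lemma spn_star a : spn a -> spn (star a).
Proof.
elim=> [|c u v a' _ ih]; first by rewrite star0; exact: spn0.
by rewrite starD starZ starM starK; exact: spnS.
Qed.

Lemma s_s u v : s u * s v = 0 \/ s u * s v = s (kmul u v).
Proof.
have [uv|uv] := eqVneq (trm u) (org v); first by right; rewrite (s_mul sF).
by left; rewrite (s_trm_neq sF)//; exact/eqP.
Qed.

Definition dsum m n : deg r := [ffun i => maxn (m i) (n i)].

Lemma le_maxl m n : le_deg m (dsum m n).
Proof. by apply/le_degP => i; rewrite ffunE leq_maxl. Qed.

Lemma le_maxr m n : le_deg n (dsum m n).
Proof. by apply/le_degP => i; rewrite ffunE leq_maxr. Qed.

(** The unit, inserted as a sum over the words of shape m, leaves only the common extensions of u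
    and v. *)
Lemma star_s_s m u v : le_deg (kshape u) m -> le_deg (kshape v) m ->
  star (s u) * s v = \sum_(w <- wds m)
    (if (hd (kshape u) w == u) && (hd (kshape v) w == v)
     then s (tl (kshape u) w) * star (s (tl (kshape v) w)) else 0).
Proof.
move=> um vm; rewrite -{1}[star (s u)]mulr1 -(s_unit Lrow Lfin sF sgen m).
rewrite mulr_sumr mulr_suml big_seq [RHS]big_seq; apply: eq_bigr => w.
rewrite (wdsP Lrow Lfin) => /eqP wm.
rewrite mulrA -mulrA (star_s_mul Lrow Lfin sF sgen) ?wm//.
rewrite (s_mul_star Lrow Lfin sF sgen) ?wm//.
by case: eqP => _; case: eqP => _; rewrite ?mul0r ?mulr0.
Qed.

Lemma spnM a b : spn a -> spn b -> spn (a * b).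
Proof.
move=> ha hb; elim: ha => [|c u v a' _ ih]; first by rewrite mul0r; exact: spn0.
rewrite mulrDl -scalerAle; apply: spnD => //; apply: spnZ => {ih a' c}.
elim: hb => [|c al be b' _ ih]; first by rewrite mulr0; exact: spn0.
rewrite mulrDr -scalerAre; apply: spnD => //; apply: spnZ => {ih b' c}.
rewrite mulrA -(mulrA _ (star _)) (star_s_s (le_maxl _ (kshape al)) (le_maxr _ _)).
rewrite mulr_sumr mulr_suml; apply: spn_sum => w _.
case: ifP => _; last by rewrite mulr0 mul0r; exact: spn0.
rewrite mulrA; set x := tl _ w; set y := tl _ w.
rewrite -[_ * star (s y) * _]mulrA -starM.
have [->|->] := s_s u x; first by rewrite mul0r; exact: spn0.
have [->|->] := s_s be y; first by rewrite star0 mulr0; exact: spn0.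
by rewrite -[_ * _]scale1r; exact: spn_mono.
Qed.

Lemma spn_dense a e : 0 < e -> exists2 b, spn b & nrm (a - b) < e.
Proof.
move=> e0; suff : nclosure spn a by apply.
have sub : cstar_gen (range s) `<=` nclosure spn.
  apply: smallest_sub.
    apply: nclosure_subalg; [exact: spn0| |exact: spnM|exact: spn_star].
    by move=> z x y hx hy; apply: spnD => //; exact: spnZ.
  move=> _ [u _ <-]; apply: nclosure_sub.
  have [es _] := s_obj sF (trm_obj u).
  by rewrite -(s_trm sF u) -es -[_ * _]scale1r; exact: spn_mono.
by apply: sub; rewrite sgen.
Qed.

Definition chi u : O := s u * star (s u).

Lemma chi_sum m u : le_deg (kshape u) m ->
  chi u = \sum_(w <- wds m) (if hd (kshape u) w == u then chi w else 0).
Proof.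
move=> um; rewrite -[LHS]mulr1 -(s_unit Lrow Lfin sF sgen m).
rewrite mulr_sumr big_seq [RHS]big_seq; apply: eq_bigr => w.
rewrite (wdsP Lrow Lfin) => /eqP wm; rewrite /chi mulrA -(mulrA (s u)).
rewrite (star_s_mul Lrow Lfin sF sgen) ?wm//; case: eqP => hu; last by rewrite mulr0 mul0r.
have uw : le_deg (kshape u) (kshape w) by rewrite wm.
have [h1 h2 h3] := facP uw.
by rewrite -{1}hu -(s_mul sF h2) -h3.
Qed.

Lemma chi_mul u w : le_deg (kshape u) (kshape w) ->
  chi u * chi w = if hd (kshape u) w == u then chi w else 0.
Proof.
move=> uw; rewrite /chi mulrA -(mulrA (s u)) (star_s_mul Lrow Lfin sF sgen)//.
case: eqP => hu; last by rewrite mulr0 mul0r.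
have [h1 h2 h3] := facP uw.
by rewrite -{1}hu -(s_mul sF h2) -h3.
Qed.

Lemma star_chi u : star (chi u) = chi u.
Proof. by rewrite starM starK. Qed.

(** The diagonal element that corresponds to the function x -> g (x_(0,m)) on paths. *)
Definition level m (g : L -> R[i]) : O := \sum_(w <- wds m) g w *: chi w.

Lemma level_raise m n g : le_deg m n -> level m g = level n (fun w => g (hd m w)).
Proof.
move=> mn; rewrite /level.
transitivity (\sum_(u <- wds m) \sum_(w <- wds n)
    g u *: (if hd (kshape u) w == u then chi w else 0)).
  rewrite big_seq [RHS]big_seq; apply: eq_bigr => u; rewrite (wdsP Lrow Lfin) => /eqP um.
  by rewrite -scaler_sumr -chi_sum// um.
rewrite exchange_big /= big_seq [RHS]big_seq; apply: eq_bigr => w.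
rewrite (wdsP Lrow Lfin) => /eqP wn.
have mw : le_deg m (kshape w) by rewrite wn.
have hin : hd m w \in wds m by rewrite (wdsP Lrow Lfin) shape_hd.
rewrite (big_rem _ hin)/= shape_hd// eqxx big_seq big1 ?addr0// => u.
rewrite mem_rem_uniq ?fset_uniq// inE (wdsP Lrow Lfin) => /andP[uh /eqP ->].
by rewrite eq_sym (negbTE uh) scaler0.
Qed.

Lemma level_mul m g g' : level m g * level m g' = level m (fun w => g w * g' w).
Proof.
rewrite /level mulr_suml big_seq [RHS]big_seq; apply: eq_bigr => u um.
rewrite mulr_sumr (big_rem _ um)/= big_seq big1 ?addr0.
  rewrite -scalerAle -scalerAre scalerA chi_mul ?le_deg_refl//.
  have := hd_kmul (esym (org_trm u)); rewrite kmul1r => ->.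
  by rewrite eqxx.
move=> w; rewrite mem_rem_uniq ?fset_uniq// inE => /andP[uw wm].
rewrite !(wdsP Lrow Lfin) in um wm.
rewrite -scalerAle -scalerAre chi_mul; last by rewrite (eqP um) (eqP wm) le_deg_refl.
have -> : kshape u = kshape w by rewrite (eqP um) (eqP wm).
have := hd_kmul (esym (org_trm w)); rewrite kmul1r => ->.
by rewrite (negbTE uw) !scaler0.
Qed.

Lemma star_level m g : star (level m g) = level m (fun w => conjc (g w)).
Proof. by rewrite star_sum; apply: eq_bigr => w _; rewrite starZ star_chi. Qed.

Lemma level_lin m z g g' : z *: level m g + level m g' = level m (fun w => z * g w + g' w).
Proof.
rewrite /level scaler_sumr -big_split; apply: eq_bigr => w _ /=.
by rewrite scalerDl scalerA.
Qed.

Definition dspn : set O := [set b | exists m g, b = level m g].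

Lemma dspn2 a b : dspn a -> dspn b -> exists m g g', a = level m g /\ b = level m g'.
Proof.
move=> [m [g ->]] [n [g' ->]]; exists (dsum m n).
by do 2 eexists; split; apply: level_raise; [exact: le_maxl|exact: le_maxr].
Qed.

(** Valid for all n >= m, since a function of fewer coordinates is one of more; this leaves room for
    other demands on n. *)
Lemma dspn_dense a e : diag_alg s a -> 0 < e -> exists m, forall n, le_deg m n ->
  exists g, nrm (a - level n g) < e.
Proof.
move=> ha e0; have sub : diag_alg s `<=` nclosure dspn.
  apply: smallest_sub.
    apply: nclosure_subalg.
    - by exists 0, (fun=> 0); rewrite /level big1// => w _; rewrite scale0r.
    - move=> z x y hx hy; have [m [g [g' [-> ->]]]] := dspn2 hx hy.
      by rewrite level_lin; do 2 eexists.
    - move=> x y hx hy; have [m [g [g' [-> ->]]]] := dspn2 hx hy.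
      by rewrite level_mul; do 2 eexists.
    - by move=> _ [m [g ->]]; rewrite star_level; do 2 eexists.
  move=> _ [u _ <-]; apply: nclosure_sub.
  exists (kshape u), (fun w => if w == u then 1 else 0).
  have uin : u \in wds (kshape u) by rewrite (wdsP Lrow Lfin).
  rewrite /level (big_rem _ uin)/= eqxx scale1r big_seq big1 ?addr0// => w.
  by rewrite mem_rem_uniq ?fset_uniq// inE => /andP[/negPf-> _]; rewrite scale0r.
have [_ [m [g ->]] ag] := sub _ ha _ e0.
by exists m => n mn; exists (fun w => g (hd m w)); rewrite -level_raise.
Qed.

Lemma psd_level m (g : L -> R) : (forall w, w \in wds m -> 0 <= g w) ->
  psd (level m (fun w => (g w)%:C)).
Proof.
move=> g0; apply: psd_sum => w wm _; apply: psdZ; first exact: g0.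
exact: s_psd.
Qed.

Lemma level_rs m t : level m (fun=> t%:C) = rs O t.
Proof. by rewrite /level -scaler_sumr (s_unit Lrow Lfin sF sgen). Qed.

(** |a|^2 = |a^* a|, and a^* a has the coefficients |g|^2, which lie between 0 and t^2. *)
Lemma level_nrm m g t : 0 <= t -> (forall w, w \in wds m -> nc (g w) <= t) ->
  nrm (level m g) <= t.
Proof.
move=> t0 h; rewrite -(@ler_pXn2r _ 2%N)// ?nnegrE ?nrm_ge0//.
rewrite -nrm_starM star_level level_mul.
have -> : level m (fun w => conjc (g w) * g w) = level m (fun w => (nc (g w) ^+ 2)%:C).
  by apply: eq_bigr => w _; rewrite nc_sqr.
apply: psd_nrm_le; rewrite ?exprn_ge0//.
  by apply: psd_level => w _; rewrite exprn_ge0 ?nc_ge0.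
rewrite -(level_rs m) addrC -scaleN1r level_lin.
have -> : level m (fun w => -1 * (nc (g w) ^+ 2)%:C + (t ^+ 2)%:C) =
    level m (fun w => (t ^+ 2 - nc (g w) ^+ 2)%:C).
  by apply: eq_bigr => w _; rewrite mulN1r addrC -rmorphN -rmorphD.
apply: psd_level => w wm; rewrite subr_ge0 lerXn2r ?nnegrE ?nc_ge0//.
exact: h.
Qed.

Lemma diag_alg_chi u : diag_alg s (chi u).
Proof. by apply: sub_gen_smallest; exists u. Qed.

Lemma diag_alg_lin z a b : diag_alg s a -> diag_alg s b -> diag_alg s (z *: a + b).
Proof.
move=> ha hb S HS; have [[Sc [S0 [Sl [Sm Ss]]]] sub] := HS.
by apply: Sl; [exact: ha|exact: hb].
Qed.

Lemma diag_alg0 : diag_alg s 0.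
Proof. by move=> S [[_ [S0 _]] _]. Qed.

Lemma diag_alg_level m g : diag_alg s (level m g).
Proof.
rewrite /level; apply: big_ind => [|a b ha hb|w _]; first exact: diag_alg0.
  by rewrite -[a]scale1r; exact: diag_alg_lin.
by rewrite -[_ *: _]addr0; apply: diag_alg_lin; [exact: diag_alg_chi|exact: diag_alg0].
Qed.

Lemma diag_alg_subalg : unital_closed_subalg (diag_alg s).
Proof.
split.
- move=> a ha S HS; have [[Sc _] _] := HS; apply: Sc; move: a ha.
  by apply: closureS => a; exact.
- by rewrite -(rs1 O) -(level_rs 0); exact: diag_alg_level.
- exact: diag_alg_lin.
- move=> a b ha hb S HS; have [[Sc [S0 [Sl [Sm Ss]]]] sub] := HS.
  by apply: Sm; [exact: ha|exact: hb].
Qed.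

End Span.

(** * The diagonal as an algebra of functions on paths *)

Section Kappa.
Variables (R : realType) (r : nat) (L : kGraph r).
Hypotheses (Lrow : row_finite L) (Lfin : finite_set (objects L)) (Laper : aperiodic L).
Variables (O : cStarAlgType R) (s : L -> O).
Hypotheses (sF : graph_family s) (sgen : cstar_gen (range s) = setT).
Variable kappa : O -> infpath L -> R[i]^o.
Hypothesis kappaP : diagonal_iso s kappa.
Implicit Types (u v w : L) (m n : deg r) (x : infpath L).
Local Notation level := (@level R r L O s).

Let k_lin z a b x : diag_alg s a -> diag_alg s b ->
  kappa (z *: a + b) x = z * kappa a x + kappa b x.
Proof. by case: kappaP => _ [h _]; exact: h. Qed.

Let k_mul a b x : diag_alg s a -> diag_alg s b ->
  kappa (a * b) x = kappa a x * kappa b x.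
Proof. by case: kappaP => _ [_ [h _]]; exact: h. Qed.

Let k_star a x : diag_alg s a -> kappa (star a) x = conjc (kappa a x).
Proof. by case: kappaP => _ [_ [_ [h _]]]; exact: h. Qed.

Let k_chi u x : kappa (chi s u) x = \1_(cylinder u) x.
Proof. by case: kappaP => _ [_ [_ [_ h]]]; exact: h. Qed.

Let k_0 x : kappa 0 x = 0.
Proof.
have d0 : diag_alg s 0 by exact: diag_alg0.
have := k_lin 1 x d0 d0.
rewrite scale1r addr0 mul1r => h.
by apply: (@addrI _ (kappa 0 x)); rewrite addr0 -h.
Qed.

Lemma kappa_level m g x : kappa (level m g) x = g (sg x 0 m).
Proof.
have E (t : seq L) : kappa (\sum_(w <- t) g w *: chi s w) x =
    \sum_(w <- t) g w * \1_(cylinder w) x.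
  elim: t => [|w t ih]; first by rewrite !big_nil k_0.
  rewrite !big_cons k_lin ?k_chi ?ih//; first exact: diag_alg_chi.
  apply: big_ind => [|a b ha hb|w' _]; first exact: diag_alg0.
    by rewrite -[a]scale1r; exact: diag_alg_lin.
  by rewrite -[_ *: _]addr0; apply: diag_alg_lin; [exact: diag_alg_chi|exact: diag_alg0].
rewrite E.
have xin : sg x 0 m \in wds L m by rewrite (wdsP Lrow Lfin) sg_shape0.
rewrite (big_rem _ xin)/= big_seq big1 ?addr0.
  rewrite indicE mem_set ?mulr1//.
  by apply/cylinderE; rewrite sg_shape0.
move=> w; rewrite mem_rem_uniq ?fset_uniq// inE (wdsP Lrow Lfin) => /andP[wx /eqP wm].
rewrite indicE memNset ?mulr0// => /cylinderE; rewrite wm => E'.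
by rewrite E' eqxx in wx.
Qed.

(** |a|^2 - a^* a = b^2 with b self-adjoint and again diagonal, so [kappa] sends it to |kappa b|^2
    >= 0. *)
Lemma kappa_nrm a x : diag_alg s a -> nc (kappa a x) <= nrm a.
Proof.
move=> ha; have [Sc S1 Sl Sm] := diag_alg_subalg Lrow Lfin sF sgen.
have hs : diag_alg s (star a).
  move=> S HS; have [[_ [_ [_ [_ Ss]]]] _] := HS.
  by apply: Ss; exact: ha.
have haa : diag_alg s (star a * a) by exact: Sm.
have hr t : diag_alg s (rs O t).
  by rewrite -(level_rs Lrow Lfin sF sgen 0); exact: diag_alg_level.
pose y := rs O (nrm a ^+ 2) - star a * a.
have hy : diag_alg s y.
  by rewrite /y addrC -scaleN1r; apply: Sl.
have py : psd y.
  by apply: psd_rsB; [rewrite starM starK|rewrite nrm_starM].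
have [b [bs bb _ bS]] := psd_sqrt py.
have hb : diag_alg s b := bS _ (diag_alg_subalg Lrow Lfin sF sgen) hy.
have k1 t : kappa (rs O t) x = t%:C.
  by rewrite -(level_rs Lrow Lfin sF sgen 0) kappa_level.
have : kappa y x = (nrm a ^+ 2)%:C - (nc (kappa a x) ^+ 2)%:C.
  by rewrite /y addrC -scaleN1r k_lin// k1 k_mul// k_star// nc_sqr mulN1r addrC.
rewrite -bb k_mul//.
have -> : kappa b x * kappa b x = conjc (kappa b x) * kappa b x.
  by rewrite -k_star// bs.
rewrite nc_sqr -rmorphB => /complexI h.
rewrite -(@ler_pXn2r _ 2%N)// ?nnegrE ?nrm_ge0 ?nc_ge0// -subr_ge0 -h.
by rewrite exprn_ge0// nc_ge0.
Qed.

Lemma s_obj_neq0 a : objects L a -> s a != 0.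
Proof.
move=> ao; have [x [xa _]] := Laper ao.
apply/eqP => sa0.
have : kappa (chi s a) x = 1.
  rewrite k_chi indicE mem_set//; apply/cylinderE.
  rewrite (_ : kshape a = 0)// -xa /origin (sgE x (le_deg_refl 0)).
  by rewrite org_id// -(sgE x (le_deg_refl 0)) sg_shape0.
rewrite /chi sa0 mul0r k_0 => /eqP; rewrite eq_sym oner_eq0.
by [].
Qed.

Lemma nrm_s_obj a : objects L a -> nrm (s a) = 1.
Proof.
move=> ao; have [as_ aa] := s_obj sF ao.
have n0 : nrm (s a) != 0 by rewrite nrm_eq0 s_obj_neq0.
by apply: (mulfI n0); rewrite mulr1 -expr2 -nrm_starM as_ aa.
Qed.

Lemma nrm_s u : nrm (s u) = 1.
Proof.
have := nrm_starM (s u); rewrite (star_s sF) nrm_s_obj; last exact: trm_obj.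
move=> /esym/eqP; rewrite sqrf_eq1 => /orP[/eqP//|/eqP h].
by have := nrm_ge0 (s u); rewrite h; rewrite oppr_ge0 ler10.
Qed.

(** An empty cylinder would give [chi s u] the image 0, hence [chi s u = 0] by injectivity of
    [kappa], against |s_u| = 1. *)
Lemma cylinder_nonempty u : exists x, sg x 0 (kshape u) = u.
Proof.
apply: contrapT => h.
have c0 : chi s u = 0.
  have [[_ kinj _] _] := kappaP.
  apply: kinj; rewrite ?inE; [exact: diag_alg_chi|exact: diag_alg0|].
  apply/funext => x; rewrite k_chi k_0 indicE memNset// => /cylinderE hx.
  by apply: h; exists x.
have := s_partial sF u; rewrite -/(chi s u) c0 mul0r => /esym/(congr1 (@nrm R O)).
by rewrite nrm_s nrm0 => /eqP; rewrite oner_eq0.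
Qed.

(** The approximating coefficients g are complex. They are replaced by the values of f at one point
    X w of each cylinder, which are real; this costs another e / 3, in the norm and on every
    path. *)
Lemma diagonal_approx (ft : O) (f : infpath L -> R) (e : R) : diag_alg s ft ->
  (forall x, kappa ft x = (f x)%:C) -> 0 < e ->
  exists m, forall n, le_deg m n -> exists c : L -> R,
    nrm (ft - level n (fun w => (c w)%:C)) < e /\
    forall x, `|f x - c (sg x 0 n)| < e.
Proof.
move=> hft kf e0; have e3 : 0 < e / 3 by rewrite divr_gt0.
have [m hm] := dspn_dense Lrow Lfin sF sgen hft e3.
exists m => n mn; have [g hg] := hm n mn.
have gx x : nc ((f x)%:C - g (sg x 0 n)) < e / 3.
  rewrite -kf -(kappa_level n g) addrC.
  have := @kappa_nrm (ft - level n g) x.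
  rewrite -[ft - _]addrC -scaleN1r k_lin ?mulN1r//; last exact: diag_alg_level.
  move=> h; apply: le_lt_trans (h _) _; last by rewrite scaleN1r addrC.
  by apply: diag_alg_lin => //; exact: diag_alg_level.
have [X hX] := choice cylinder_nonempty.
exists (fun w => f (X w)).
have wX w : kshape w = n -> sg (X w) 0 n = w by move=> <-; exact: hX.
split.
  rewrite (le_lt_trans (nrm_dist_add (level n g) _ _))//.
  have h2 : nrm (level n g - level n (fun w => (f (X w))%:C)) <= e / 3.
    rewrite -nrmN opprB addrC -scaleN1r level_lin.
    apply: level_nrm => //; first exact: ltW.
    move=> w; rewrite (wdsP Lrow Lfin) => /eqP wn.
    by rewrite mulN1r addrC -{2}(wX w wn) ltW.
  lra.
move=> x; have sn : kshape (sg x 0 n) = n by exact: sg_shape0.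
have h1 := gx x; have h2 := gx (X (sg x 0 n)); rewrite (wX _ sn) in h2.
rewrite -nc_real rmorphB.
have -> : (f x)%:C - (f (X (sg x 0 n)))%:C = ((f x)%:C - g (sg x 0 n)) -
   ((f (X (sg x 0 n)))%:C - g (sg x 0 n)) by rewrite opprB addrA subrK.
by rewrite (le_lt_trans (ncD _ _))// ncN; lra.
Qed.

End Kappa.

(** * States along aperiodic paths *)

Section States.
Variables (R : realType) (r : nat) (L : kGraph r).
Hypotheses (Lrow : row_finite L) (Lfin : finite_set (objects L)).
Variables (O : cStarAlgType R) (s : L -> O).
Hypotheses (sF : graph_family s) (sgen : cstar_gen (range s) = setT).
Hypothesis s1 : forall u, nrm (s u) = 1.
Variable x : infpath L.
Hypothesis xap : forall (n : deg r) (q : {ffun 'I_r -> int}),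
      q != 0 -> ~ period (path_shift n x) q.
Implicit Types (u v w : L) (m n : deg r) (b : O) (la mu : R[i]).

Let vk (k : nat) : L := sg x 0 (dconst r k).

Let vk_shape k : kshape (vk k) = dconst r k. Proof. exact: sg_shape0. Qed.

Let cmp k b : O := star (s (vk k)) * b * s (vk k).

Let cmp_nrm k b : nrm (cmp k b) <= nrm b.
Proof.
rewrite (le_trans (nrmM _ _))// s1 mulr1 (le_trans (nrmM _ _))//.
by rewrite nrm_star s1 mul1r.
Qed.

(* Along the aperiodic path [x] the compressions of [b] become scalar. *)
Definition comp_lim b la : Prop :=
  forall e : R, 0 < e -> exists K, forall k, (K <= k)%N ->
    nrm (cmp k b - la *: s (trm (vk k))) < e.

Lemma comp_lim_nrm b la : comp_lim b la -> nc la <= nrm b.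
Proof.
move=> h; apply/ler_addgt0Pr => e e0; have [K hK] := h _ e0.
have := hK K (leqnn _).
have -> : nc la = nrm (la *: s (trm (vk K))) by rewrite nrmZ s1 mulr1.
rewrite nrm_distC => hh; rewrite -[_ *: _](subrK (cmp K b)).
by rewrite (le_trans (nrmD _ _))// addrC lerD// ltW.
Qed.

Lemma comp_lim_lin z a b la mu : comp_lim a la -> comp_lim b mu ->
  comp_lim (z *: a + b) (z * la + mu).
Proof.
move=> ha hb e e0; have z0 : 0 < nc z + 1 by rewrite ltr_wpDl ?nc_ge0.
have e2 : 0 < e / 2 by rewrite divr_gt0.
have [K hK] := ha _ (divr_gt0 e2 z0); have [M hM] := hb _ e2.
exists (maxn K M) => k; rewrite geq_max => /andP[Kk Mk].
have -> : cmp k (z *: a + b) - (z * la + mu) *: s (trm (vk k)) =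
   z *: (cmp k a - la *: s (trm (vk k))) + (cmp k b - mu *: s (trm (vk k))).
  rewrite /cmp mulrDr mulrDl -scalerAre -scalerAle scalerDl -scalerA scalerBr.
  by rewrite opprD addrACA.
rewrite (le_lt_trans (nrmD _ _))// (splitr e) ler_ltD ?hM//.
rewrite nrmZ; apply: (@le_trans _ _ (nc z * (e / 2 / (nc z + 1)))).
  by rewrite ler_wpM2l ?nc_ge0// ltW// hK.
by rewrite mulrCA ler_piMr ?(ltW e2)// ler_pdivrMr// mul1r lerDl.
Qed.

Lemma comp_lim0 : comp_lim 0 0.
Proof.
by move=> e e0; exists 0%N => k _; rewrite /cmp mulr0 mul0r scale0r subrr nrm0.
Qed.

Lemma comp_lim_dist a b la mu : comp_lim a la -> comp_lim b mu ->
  nc (la - mu) <= nrm (a - b).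
Proof.
move=> ha hb; have := comp_lim_lin (-1) hb ha.
by rewrite scaleN1r mulN1r addrC [- mu + _]addrC => /comp_lim_nrm.
Qed.

Lemma comp_lim_uniq b la mu : comp_lim b la -> comp_lim b mu -> la = mu.
Proof.
move=> ha hb; have := comp_lim_dist ha hb.
rewrite subrr nrm0 => h; apply/eqP; rewrite -subr_eq0 -nc_eq0.
by rewrite eq_le h nc_ge0.
Qed.

Lemma comp_lim_star b la : comp_lim b la -> comp_lim (star b) (conjc la).
Proof.
move=> h e e0; have [K hK] := h _ e0; exists K => k Kk.
have -> : cmp k (star b) - conjc la *: s (trm (vk k)) =
    star (cmp k b - la *: s (trm (vk k))).
  have [es _] := s_obj sF (trm_obj (vk k)).
  by rewrite starB starZ es /cmp !starM starK mulrA.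
by rewrite nrm_star hK.
Qed.

(** Beyond some k the compression is exactly 0. Unless a prefix already fails to match, it contains
    s_y^* s_z for the segments y = x_(m,m+l) and z = x_(m',m'+l), where m and m' are the shapes of u
    and v; y and z have the same shape and differ by aperiodicity. *)
Lemma comp_lim_neq u v : kshape u != kshape v ->
  comp_lim (s u * star (s v)) 0.
Proof.
move=> uv; have [l hl] := aperiodic_separates uv xap.
move=> e e0; exists (dmax (kshape u + l)%R + dmax (kshape v + l)%R)%N => k hk.
have ul : le_deg (kshape u + l) (dconst r k).
  by apply: le_dconst; rewrite (leq_trans _ hk)// leq_addr.
have vl : le_deg (kshape v + l) (dconst r k).
  by apply: le_dconst; rewrite (leq_trans _ hk)// leq_addl.
have uk := le_deg_trans (le_deg_addr _ _) ul.
have vk' := le_deg_trans (le_deg_addr _ _) vl.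
suff -> : cmp k (s u * star (s v)) = 0 by rewrite scale0r subrr nrm0.
rewrite /cmp mulrA -mulrA (s_mul_star Lrow Lfin sF sgen) ?vk_shape//.
rewrite (star_s_mul Lrow Lfin sF sgen) ?vk_shape//.
case: eqP => _; last by rewrite mul0r.
case: eqP => _; last by rewrite mulr0.
rewrite /vk !tl_sg//.
have [a1 ->] := sg_mul x (le_deg_addr (kshape u) l) ul.
have [b1 ->] := sg_mul x (le_deg_addr (kshape v) l) vl.
rewrite (s_mul sF a1) (s_mul sF b1) starM mulrA -(mulrA _ (star _) (s _)).
rewrite (star_s_orth Lrow Lfin sF sgen) ?mulr0 ?mul0r//; last exact/eqP.
apply: (@deg_addI _ (kshape u)); rewrite sg_shape ?le_deg_addr//.
congr (_ + _); apply: (@deg_addI _ (kshape v)).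
by rewrite sg_shape ?le_deg_addr.
Qed.

Lemma comp_lim_mono u v : exists la, comp_lim (s u * star (s v)) la.
Proof.
have [uv|/comp_lim_neq h] := eqVneq (kshape u) (kshape v); last by exists 0.
exists (if (sg x 0 (kshape u) == u) && (u == v) then 1 else 0) => e e0.
exists (dmax (kshape u)) => k /le_dconst hk.
have hv : le_deg (kshape v) (dconst r k) by rewrite -uv.
have -> : cmp k (s u * star (s v)) = (if (sg x 0 (kshape u) == u) && (u == v)
    then 1 else 0) *: s (trm (vk k)); last by rewrite subrr nrm0.
rewrite /cmp mulrA -mulrA (s_mul_star Lrow Lfin sF sgen) ?vk_shape//.
rewrite (star_s_mul Lrow Lfin sF sgen) ?vk_shape// /vk !hd_sg// -uv.
have [hu|hu] := eqVneq (sg x 0 (kshape u)) u; last by rewrite mul0r scale0r.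
have [<-|nuv] := eqVneq u v.
  rewrite hu eqxx scale1r (star_s sF) trm_tl// sg_shape0//.
by rewrite hu (negbTE nuv) mulr0 scale0r.
Qed.

Lemma comp_lim_spn b : spn s b -> exists la, comp_lim b la.
Proof.
elim=> [|c u v a _ [la hla]]; first by exists 0; exact: comp_lim0.
have [mu hmu] := comp_lim_mono u v.
by exists (c * mu + la); exact: comp_lim_lin.
Qed.

(** Linear combinations of monomials have limits. By [comp_lim_dist] the limits that belong to
    approximants of b are Cauchy, and their limit serves b. *)
Lemma comp_lim_ex b : exists la, comp_lim b la.
Proof.
have n1 (n : nat) : 0 < (n.+1%:R : R)^-1 by rewrite invr_gt0.
have H (n : nat) : exists al : O * R[i], nrm (b - al.1) < n.+1%:R^-1 /\ comp_lim al.1 al.2.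
  have [a /comp_lim_spn[la hla] ab] := spn_dense Lrow Lfin sF sgen b (n1 n).
  by exists (a, la).
have [al hal] := choice H.
have small (e : R) : 0 < e -> exists N, forall n : nat, (N <= n)%N -> n.+1%:R^-1 < e.
  move=> e0; exists (Num.bound e^-1) => n Nn.
  rewrite invf_plt ?posrE//.
  have ei : 0 <= e^-1 by rewrite invr_ge0 ltW.
  have := archi_boundP ei.
  move=> /lt_le_trans; apply; rewrite ler_nat.
  exact: leq_trans Nn _.
have [e e0|la hla] := @complex_seq_complete R (fun n : nat => (al n).2).
  have [N hN] := small _ (divr_gt0 e0 (ltr0Sn _ 1)).
  exists N => n m Nn Nm; rewrite ncE ltcR.
  have [h1 h2] := hal n; have [g1 g2] := hal m.
  rewrite (le_lt_trans (comp_lim_dist h2 g2))//.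
  rewrite (le_lt_trans (nrm_dist_add b _ _))// (splitr e) nrm_distC.
  by apply: ltrD; [exact: lt_trans h1 (hN n Nn)|exact: lt_trans g1 (hN m Nm)].
exists la => e e0; have e3 : 0 < e / 3 by rewrite divr_gt0.
have [N hN] := small _ e3; have [M hM] := hla _ e3.
pose n := (N + M)%N; have [h1 h2] := hal n.
have [K hK] := h2 _ e3; exists K => k Kk.
have -> : cmp k b - la *: s (trm (vk k)) = cmp k (b - (al n).1) +
   ((cmp k (al n).1 - (al n).2 *: s (trm (vk k))) +
   ((al n).2 - la) *: s (trm (vk k))).
  by rewrite /cmp mulrBr mulrBl scalerBl !addrA !subrK.
have := le_lt_trans (cmp_nrm k _) (lt_trans h1 (hN n (leq_addr _ _))).
have := hK k Kk; have := hM n (leq_addl _ _); rewrite ncE ltcR => g1 g2 g3.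
rewrite (le_lt_trans (nrmD _ _))// (_ : e = e / 3 + (e / 3 + e / 3)); last by field.
apply: ltrD => //; rewrite (le_lt_trans (nrmD _ _))//; apply: ltrD => //.
by rewrite nrmZ s1 mulr1.
Qed.

Lemma comp_lim_org : comp_lim (s (sg x 0 0)) 1.
Proof.
move=> e e0; exists 0%N => k _.
have [h _] := sg_mul x (le0_deg 0) (le0_deg (dconst r k)).
have h0 : sg x 0 0 = org (vk k) by rewrite -h trm_id// sg_shape0.
by rewrite /cmp -mulrA h0 (s_org sF) (star_s sF) scale1r subrr nrm0.
Qed.

Lemma aperiodic_state : exists tau : O -> R[i],
  [/\ pos_functional tau, tau (s (sg x 0 0)) = 1, forall b, nc (tau b) <= nrm b &
    forall u v, kshape u != kshape v -> tau (s u * star (s v)) = 0].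
Proof.
have [tau ht] := choice comp_lim_ex.
have tlin : linear (tau : O -> R[i]^o).
  move=> z a b; apply: (comp_lim_uniq (ht _)).
  exact: comp_lim_lin.
exists tau; split.
- split=> // y.
  have ys : star (star y * y) = star y * y by rewrite starM starK.
  have lr : conjc (tau (star y * y)) = tau (star y * y).
    apply: (comp_lim_uniq _ (ht _)); rewrite -{1}ys.
    exact: comp_lim_star.
  move: lr (ht (star y * y)); case: (tau _) => a b /= [] /eqP.
  rewrite eq_sym -addr_eq0 -mulr2n mulrn_eq0 /= => /eqP-> h.
  (* If the limit a were negative, the compression minus a s_t(v) would dominate - a s_t(v), of norm
     - a, and yet have norm less than - a. *)
  rewrite lecE /= eqxx leNgt; apply/negP => a0.
  have na : 0 < - a by rewrite oppr_gt0.
  have [K hK] := h _ na; have := hK K (leqnn _).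
  have -> : a +i* 0 = - (- a)%:C by rewrite rmorphN opprK.
  rewrite scaleNr opprK => hh.
  have [es ee] := s_obj sF (trm_obj (vk K)).
  have ps : psd ((- a)%:C *: s (trm (vk K))).
    by apply: psdZ; [exact: ltW|rewrite -ee; exact: psd_sq].
  have := psd_mono ps (z := cmp K (star y * y) + (- a)%:C *: s (trm (vk K))).
  rewrite addrK nrmZr s1 mulr1 gtr0_norm// => h3.
  have pc : psd (cmp K (star y * y)) by apply: psd_conj; exact: psd_starM.
  by have := le_lt_trans (h3 pc) hh; rewrite ltxx.
- by apply: (comp_lim_uniq (ht _)); exact: comp_lim_org.
- by move=> b; exact: comp_lim_nrm.
- by move=> u v uv; apply: (comp_lim_uniq (ht _)); exact: comp_lim_neq.
Qed.

End States.

(** * Cylinders and compatible metrics *)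

Section PathTopology.
Variables (r : nat) (L : kGraph r).
Implicit Types (x y z : infpath L).

(** Cylinders are a subbase; finitely many of them around z are decided by one prefix of z of cubic
    shape, and such a prefix defines a cylinder itself. *)
Lemma nbhs_pathP z (U : set (infpath L)) : nbhs z U <->
  exists k : nat, forall y, sg y 0 (dconst r k) = sg z 0 (dconst r k) -> U y.
Proof.
split=> [|[k hk]].
  rewrite nbhsE => -[B [Bop Bz] BU]; case: Bop => D' sD' DB.
  move: Bz; rewrite -DB => -[W DW Wz].
  have [E sE EW] := sD' _ DW; move: Wz; rewrite -EW => Wz.
  have H (C : set (infpath L)) : exists k : nat, C \in E ->
      forall y, sg y 0 (dconst r k) = sg z 0 (dconst r k) -> C y.
    case: (boolP (C \in E)) => [CE|_]; last by exists 0%N.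
    have [u _ uC] : range (@cylinder r L) C by apply/set_mem/sE.
    have /cylinderE zu : cylinder u z by rewrite uC; exact: Wz.
    exists (dmax (kshape u)) => _ y yz; rewrite -uC; apply/cylinderE.
    rewrite -[RHS]zu; apply: (sg_agree yz); first exact: le0_deg.
    exact: le_dconst.
  have [K hK] := choice H.
  exists (\sum_(C <- E) K C)%N => y yz; apply: BU; rewrite -DB; exists W => //.
  suff Wy : W y by exact: Wy.
  rewrite -EW => C CE; apply: (hK _ CE).
  apply: (sg_agree yz); first exact: le0_deg.
  by apply: dconst_le; rewrite (big_rem _ CE)/= leq_addr.
rewrite nbhsE; exists (cylinder (sg z 0 (dconst r k))).
  split; last by apply/cylinderE; rewrite sg_shape0.
  exists [set cylinder (sg z 0 (dconst r k))]; last by rewrite bigcup_set1.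
  move=> _ ->; exists [fset cylinder (sg z 0 (dconst r k))]%fset.
    by move=> C /fset1P ->; apply/mem_set; exists (sg z 0 (dconst r k)).
  rewrite predeqE => y; split=> [hy|yC C /fset1P ->//].
  by apply: (hy (cylinder (sg z 0 (dconst r k)))); exact/fset1P.
by move=> y /cylinderE; rewrite sg_shape0; exact: hk.
Qed.

Hypotheses (Lrow : row_finite L) (Lfin : finite_set (objects L)).

Section Konig.
Variable xs : nat -> infpath L.
Let pre (k j : nat) : L := sg (xs j) 0 (dconst r k).
Let good (k : nat) (u : L) : Prop := forall M, exists2 j, (M <= j)%N & pre k j = u.

Let pigeonhole (k : nat) (P : nat -> Prop) : (forall M, exists2 j, (M <= j)%N & P j) ->
  exists u, forall M, exists2 j, (M <= j)%N & P j /\ pre k j = u.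
Proof.
move=> hP; apply: contrapT => h.
have H u : exists M, forall j, (M <= j)%N -> P j -> pre k j <> u.
  apply: contrapT => hu; apply: h; exists u => M; apply: contrapT => hM.
  apply: hu; exists M => j Mj Pj ju; apply: hM; exists j => //.
have [M hM] := choice H.
have [j Mj Pj] := hP (\sum_(u <- wds L (dconst r k)) M u)%N.
apply: (hM (pre k j) j _ Pj erefl).
have uin : pre k j \in wds L (dconst r k) by rewrite (wdsP Lrow Lfin) sg_shape0.
by rewrite (leq_trans _ Mj)// (big_rem _ uin)/= leq_addr.
Qed.

Let chain : exists U : nat -> L, forall k, good k (U k) /\
  hd (dconst r k) (U k.+1) = U k.
Proof.
have [u0 hu0] : exists u, good 0 u.
  have [u hu] := pigeonhole 0 (P := fun=> True) (fun M => ex_intro2 _ _ M (leqnn M) I).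
  by exists u => M; have [j Mj [_ ju]] := hu M; exists j.
have step (ku : nat * L) : exists u', good ku.1 ku.2 ->
    good ku.1.+1 u' /\ hd (dconst r ku.1) u' = ku.2.
  case: ku => k u /=; have [gu|ngu] := pselect (good k u); last by exists u.
  have [u' hu'] := pigeonhole k.+1 (P := fun j => pre k j = u) gu.
  exists u' => _; split=> [M|].
    by have [j Mj [_ ju]] := hu' M; exists j.
  have [j _ [ju <-]] := hu' 0%N.
  by rewrite /pre hd_sg -?ju//; apply: dconst_le.
have [F hF] := choice step.
pose U := fix U k := if k is k'.+1 then F (k', U k') else u0.
have gU k : good k (U k) by elim: k => [//|k ih]; have [] := hF (k, U k) ih.
by exists U => k; split=> //; have [] := hF (k, U k) (gU k).
Qed.

(** Compactness in the form of Konig's lemma: there are finitely many words of each shape, so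
    prefixes that occur infinitely often can be chosen successively, each extending the one before,
    and glued to a path. *)
Lemma konig : exists z, forall k : nat, exists2 j, (k <= j)%N &
  sg (xs j) 0 (dconst r k) = sg z 0 (dconst r k).
Proof.
have [U hU] := chain.
have Hj k : exists j, (k <= j)%N /\ pre k j = U k.
  by have [gU _] := hU k; have [j] := gU k; exists j.
have [J hJ] := choice Hj.
have comp k i : sg (xs (J (k + i)%N)) 0 (dconst r k) = U k.
  elim: i k => [|i ih] k; first by rewrite addn0; have [_] := hJ k.
  have [_ <-] := hU k; rewrite -(ih k.+1) addnS addSn hd_sg//.
  exact: dconst_le.
have agree k k' m n : (k <= k')%N -> le_deg n (dconst r k) -> le_deg m n ->
    sg (xs (J k)) m n = sg (xs (J k')) m n.
  move=> kk nk mn; apply: (sg_agree (k := dconst r k)) => //.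
  by have := comp k 0%N; rewrite addn0 => ->; rewrite -(comp k (k' - k)%N) subnKC.
pose zs m n (mn : le_deg m n) := seg (xs (J (dmax n))) mn.
have zsE m n (mn : le_deg m n) k : (dmax n <= k)%N -> zs m n mn = sg (xs (J k)) m n.
  by move=> nk; rewrite /zs -sgE; apply: agree => //; exact: le_dconst.
have z1 m n (mn : le_deg m n) : m + kshape (zs m n mn) = n by exact: seg_shape.
have z2 m k n (mk : le_deg m k) (kn : le_deg k n) (mn : le_deg m n) :
    trm (zs m k mk) = org (zs k n kn) /\ zs m n mn = kmul (zs m k mk) (zs k n kn).
  rewrite !(@zsE _ _ _ (dmax k + dmax n)%N) ?leq_addr ?leq_addl//.
  exact: sg_mul.
exists (Path z1 z2) => k; have [kj jU] := hJ k; exists (J k) => //.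
rewrite (sgE (Path z1 z2) (le0_deg _)) /= (@zsE _ _ _ (k + dmax (dconst r k))%N) ?leq_addl//.
by rewrite comp.
Qed.

End Konig.

Section Metric.
Variables (R : realType) (d : infpath L -> infpath L -> R).
Hypothesis dP : compatible_metric d.

Let small (e : R) : 0 < e -> exists k : nat, forall j : nat, (k <= j)%N -> j.+1%:R^-1 < e.
Proof.
move=> e0; exists (Num.bound e^-1) => n Nn.
rewrite invf_plt ?posrE//.
have ei : 0 <= e^-1 by rewrite invr_ge0 ltW.
have := archi_boundP ei.
move=> /lt_le_trans; apply; rewrite ler_nat.
exact: leq_trans Nn _.
Qed.

(** Otherwise there are pairs with ever longer common prefixes and distance above e. Near an
    accumulation point z of their first members, both members of a pair are within e / 2 of z. *)
Lemma cylinder_small (e : R) : 0 < e -> exists k : nat, forall x y,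
  sg x 0 (dconst r k) = sg y 0 (dconst r k) -> d x y <= e.
Proof.
move=> e0; apply: contrapT => h.
have H (k : nat) : exists xy : infpath L * infpath L,
    sg xy.1 0 (dconst r k) = sg xy.2 0 (dconst r k) /\ e < d xy.1 xy.2.
  apply: contrapT => hk; apply: h; exists k => x y xy; rewrite leNgt; apply/negP => dxy.
  by apply: hk; exists (x, y).
have [xy hxy] := choice H.
have [z hz] := konig (fun k => (xy k).1).
have [_ dsym dtri dn] := dP.
have e2 : 0 < e / 2 by rewrite divr_gt0.
have /nbhs_pathP[k hk] : nbhs z [set y | d z y < e / 2] by apply/dn; exists (e / 2).
have [j kj jz] := hz k.
have [xyj dj] := hxy j.
have h1 : d z (xy j).1 < e / 2 by exact: hk.
have h2 : d z (xy j).2 < e / 2.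
  apply: hk; rewrite -jz; apply: (sg_agree (k := dconst r j)) => //.
    exact: le0_deg.
  exact: dconst_le.
have := dtri (xy j).1 z (xy j).2; rewrite (dsym _ z).
by move: dj h1 h2; lra.
Qed.

(** Dually, pairs at distance at most 1 / (k + 1) with different prefixes of shape n would
    accumulate at some z, around which this prefix is constant. *)
Lemma small_cylinder (n : deg r) : exists2 e : R, 0 < e & forall x y,
  d x y <= e -> sg x 0 n = sg y 0 n.
Proof.
apply: contrapT => h.
have H (k : nat) : exists xy : infpath L * infpath L,
    d xy.1 xy.2 <= k.+1%:R^-1 /\ sg xy.1 0 n <> sg xy.2 0 n.
  apply: contrapT => hk; apply: h; exists k.+1%:R^-1; first by rewrite invr_gt0.
  by move=> x y dxy; apply: contrapT => hxy; apply: hk; exists (x, y).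
have [xy hxy] := choice H.
have [z hz] := konig (fun k => (xy k).1).
have [_ dsym dtri dn] := dP.
have /dn[e e0 he] : nbhs z [set y | sg y 0 n = sg z 0 n].
  apply/nbhs_pathP; exists (dmax n) => y yz /=.
  by apply: (sg_agree yz); [exact: le0_deg|exact: le_dconst].
have e2 : 0 < e / 2 by rewrite divr_gt0.
have /nbhs_pathP[k hk] : nbhs z [set y | d z y < e / 2] by apply/dn; exists (e / 2).
have [M hM] := small e2.
have [j kj jz] := hz (k + M)%N.
have [dj nj] := hxy j.
have h1 : d z (xy j).1 < e / 2.
  apply: hk; apply: (sg_agree jz); first exact: le0_deg.
  by apply: dconst_le; exact: leq_addr.
have hj := hM j (leq_trans (leq_addl _ _) kj).
have h4 := le_lt_trans dj hj.
have h2 : d z (xy j).2 < e.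
  by rewrite (le_lt_trans (dtri _ (xy j).1 _))// (splitr e) ltrD.
have h3 : d z (xy j).1 < e by rewrite (lt_trans h1)// gtr_pMr// invf_lt1// ltr1n.
by apply: nj; rewrite (he _ h3) (he _ h2).
Qed.

End Metric.

End PathTopology.

(** * Approximation of the identity through matrices *)

Section ComplexMatrices.
Variables (R : realType) (K : nat).
Local Notation M := (mxC (cplx R) K).

Lemma mxC_scaleE (z : R[i]) (x : M) i j : (z *: x) i j = z * (x i j : R[i]).
Proof. by rewrite [LHS]mxE. Qed.

Lemma mxC_sumE (I : Type) (t : seq I) (P : pred I) (F : I -> M) i j :
  (\sum_(k <- t | P k) F k) i j = \sum_(k <- t | P k) (F k i j : R[i]).
Proof.
elim/big_rec2: _ => [|k y x _ <-]; first by rewrite [LHS]mxE.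
by rewrite [LHS]mxE.
Qed.

Definition mx_unit (i j : 'I_K) : M := \matrix_(k, l) (((k == i) && (l == j))%:R : cplx R).

Lemma mx_unit_decomp (x : M) : x = \sum_i \sum_j (x i j : R[i]) *: mx_unit i j.
Proof.
apply/matrixP => k l; rewrite mxC_sumE (bigD1 k)//= [X in _ + X]big1 ?addr0 => [|i ik].
  rewrite mxC_sumE (bigD1 l)//= big1 ?addr0 => [|j jl].
    by rewrite mxC_scaleE mxE !eqxx mulr1.
  by rewrite mxC_scaleE mxE [l == j]eq_sym (negbTE jl) andbF mulr0.
rewrite mxC_sumE big1// => j _.
by rewrite mxC_scaleE mxE [k == i]eq_sym (negbTE ik) mulr0.
Qed.

Lemma mxC_fd : finite_dimensional M.
Proof.
pose v (ij : 'I_K * 'I_K) := mx_unit ij.1 ij.2; pose b := codom v.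
have sb : #|{: 'I_K * 'I_K}| = size b by rewrite size_codom.
exists b => x; exists (fun k => let ij := enum_val (cast_ord (esym sb) k) in x ij.1 ij.2).
rewrite {1}(mx_unit_decomp x) pair_big /=.
rewrite (reindex (fun k : 'I_#|{: 'I_K * 'I_K}| => enum_val k)) /=; last first.
  by apply: onW_bij; exact: enum_val_bij.
rewrite (reindex (cast_ord sb)) /=; last first.
  by exists (cast_ord (esym sb)) => i _; rewrite ?cast_ordK ?cast_ordKV.
by apply: eq_bigr => k _; rewrite cast_ordK /b nth_codom.
Qed.

(** Let e be a minimal projection with nonzero column k. The rank one projection q onto this column
    satisfies e q = q, so q = e, and its trace is 1. *)
Lemma mxC_trace : exists tr : {scalar M}, canonical_trace tr /\
  forall x, tr x = \sum_i (x i i : R[i]).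
Proof.
pose f (x : M) : R[i]^o := \sum_i (x i i : R[i]).
have lf : scalar f.
  move=> z x y; transitivity (\sum_i (z * (x i i : R[i]) + (y i i : R[i]))).
    by apply: eq_bigr => i _; rewrite [LHS]mxE -mxC_scaleE.
  by rewrite big_split /= -mulr_sumr.
have lf' : linear (f : M -> R[i]^o) by exact: lf.
pose tr : {scalar M} := HB.pack f (GRing.isLinear.Build R[i] M R[i]^o *%R f lf').
exists tr; split=> //; split=> [a b|e [[es ee] e0 emin]].
  transitivity (\sum_i \sum_j (a i j : R[i]) * (b j i : R[i])).
    by apply: eq_bigr => i _; rewrite mxC_mulE.
  rewrite exchange_big; apply: eq_bigr => i _; rewrite mxC_mulE.
  by apply: eq_bigr => j _; exact: (@mulrC R[i]).
have [j [k ejk]] : exists j k, e j k != 0.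
  apply: contrapT => h; move/eqP: e0; apply; apply/matrixP => j k.
  rewrite [RHS]mxE; apply/eqP/negPn/negP => jk.
  by apply: h; exists j, k.
pose t : R[i] := \sum_i conjc (e i k : R[i]) * (e i k : R[i]).
have tE : t = (\sum_i nc (e i k : R[i]) ^+ 2)%:C.
  by rewrite rmorph_sum; apply: eq_bigr => i _; rewrite nc_sqr.
have tr0 : 0 < \sum_i nc (e i k : R[i]) ^+ 2.
  rewrite (bigD1 j)//= ltr_pwDl// ?sumr_ge0// => [|i _]; last by rewrite exprn_ge0// nc_ge0.
  by rewrite exprn_gt0// lt_neqAle nc_ge0 eq_sym nc_eq0 ejk.
have t0 : t != 0 by rewrite tE -(rmorph0 (real_complex R)) (inj_eq (@complexI R)) gt_eqF.
have tc : conjc t = t by rewrite tE conjc_real.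
pose q : M := \matrix_(a, b) ((t^-1 * (e a k : R[i]) * conjc (e b k : R[i])) : cplx R).
have qE a b : q a b = t^-1 * (e a k : R[i]) * conjc (e b k : R[i]) by rewrite [LHS]mxE.
have qp : is_projection q.
  split; apply/matrixP => a b.
    rewrite mxC_starE !qE [LHS](_ : _ = conjc (t^-1 * (e b k : R[i]) * conjc (e a k : R[i])))//.
    rewrite !rmorphM /= conjcK rmorphV ?unitfE//= tc mulrAC.
    by [].
  rewrite mxC_mulE.
  transitivity (\sum_c (t^-1 * (e a k : R[i]) * conjc (e c k : R[i])) *
     (t^-1 * (e c k : R[i]) * conjc (e b k : R[i]))).
    by apply: eq_bigr => c _; rewrite !qE.
  transitivity (t^-1 * t^-1 * t * (e a k : R[i]) * conjc (e b k : R[i])).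
    rewrite /t mulr_sumr !mulr_suml; apply: eq_bigr => c _.
    by move: (t^-1) (conjc _) (conjc _) => *; ring.
  by rewrite qE -(mulrA t^-1) mulVf ?mulr1.
have eq : e * q = q.
  apply/matrixP => a b; rewrite mxC_mulE.
  transitivity (\sum_c (e a c : R[i]) * (t^-1 * (e c k : R[i]) * conjc (e b k : R[i]))).
    by apply: eq_bigr => c _; rewrite qE.
  have eak : (e a k : R[i]) = \sum_c (e a c : R[i]) * (e c k : R[i]).
    by rewrite -{1}ee mxC_mulE.
  transitivity ((\sum_c (e a c : R[i]) * (e c k : R[i])) * (t^-1 * conjc (e b k : R[i]))).
    2: by rewrite qE -eak mulrCA mulrA.
  rewrite mulr_suml; apply: eq_bigr => c _.
  by move: (t^-1) (conjc _) => *; ring.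
have trq : \sum_i (q i i : R[i]) = 1.
  transitivity (t^-1 * t); last by rewrite mulVf.
  rewrite [in RHS]/t mulr_sumr; apply: eq_bigr => i _; rewrite qE.
  by rewrite -mulrA [(e i k : R[i]) * _]mulrC.
have [q0|<-] := emin q qp eq; last exact: trq.
move: trq; rewrite q0 big1 => [/esym/eqP|i _]; first by rewrite oner_eq0.
by rewrite [LHS]mxE.
Qed.

Definition mx_diag (la : 'I_K -> R) : M := \sum_i (la i)%:C *: mx_unit i i.

Lemma mx_unit_resolution : resolution (fun i => mx_unit i i).
Proof.
split.
- move=> i; split; apply/matrixP => a b.
    rewrite mxC_starE ![mx_unit _ _ _ _]mxE [LHS](_ : _ = conjc (((b == i) && (a == i))%:R : R[i]))//.
    by rewrite andbC rmorph_nat.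
  rewrite mxC_mulE (bigD1 i)//= big1 ?addr0 => [|c ci].
    rewrite ![mx_unit _ _ _ _]mxE eqxx andbT /=.
    rewrite [LHS](_ : _ = ((a == i)%:R * (b == i)%:R : R[i]))//.
    by rewrite -natrM mulnb.
  rewrite [mx_unit i i a c]mxE (negbTE ci) andbF.
  exact: (@mul0r R[i]).
- move=> i j ij; apply/matrixP => a b; rewrite mxC_mulE big1 ?[RHS]mxE// => c _.
  rewrite ![mx_unit _ _ _ _]mxE.
  have [ci|_] := eqVneq c i; last by rewrite andbF; exact: (@mul0r R[i]).
  by rewrite ci (negbTE ij) /=; exact: (@mulr0 R[i]).
- apply/matrixP => a b; rewrite mxC_sumE [RHS]mxE.
  have [<-|ab] := eqVneq a b.
    rewrite (bigD1 a)//= big1 ?addr0 => [|i ia]; first by rewrite mxE eqxx.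
    by rewrite mxE [a == i]eq_sym (negbTE ia).
  rewrite big1// => i _; rewrite mxE.
  have [ai|//] := eqVneq a i.
  by rewrite -ai [b == a]eq_sym (negbTE ab).
Qed.

Lemma mx_diag_exp (tr : {scalar M}) (la : 'I_K -> R) :
  (forall x, tr x = \sum_i (x i i : R[i])) ->
  tr (cstar_exp (mx_diag la)) = (\sum_i expR (la i))%:C.
Proof.
move=> trE; rewrite (resolution_exp mx_unit_resolution) linear_sum rmorph_sum.
apply: eq_bigr => i _; rewrite linearZ /= trE (bigD1 i)//= big1 ?addr0 => [|j ji].
  by rewrite mxE eqxx mulr1.
by rewrite mxE (negbTE ji).
Qed.

Lemma mx_diagP (x : M) (la : 'I_K -> R) : (forall i, x i i = (la i)%:C) ->
  (forall i j, i != j -> x i j = 0) -> x = mx_diag la.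
Proof.
move=> xd x0; rewrite (mx_unit_decomp x); apply: eq_bigr => i _.
rewrite (bigD1 i)//= big1 ?addr0 ?xd// => j ji.
by rewrite x0 1?eq_sym// scale0r.
Qed.

End ComplexMatrices.

Lemma star_sandwich (R : realType) (A : cStarAlgType R) (a b c : A) :
  star (star a * b * c) = star c * star b * a.
Proof. by rewrite !starM starK mulrA. Qed.

Lemma starZ_mul_scale (R : realType) (A : cStarAlgType R) (z z' : R[i]) (a b c : A) :
  star (z *: a) * (b * (z' *: c)) = (conjc z * z') *: (star a * b * c).
Proof. by rewrite starZ -!scalerAre -!scalerAle scalerA mulrA mulrC. Qed.

Section MatrixCP.
Variables (R : realType) (A : cStarAlgType R) (K : nat).
Local Notation M := (mxC (cplx R) K).

Lemma inner_mxact_sum (I : Type) (t : seq I) (P : pred I) (F : I -> M) (v : 'I_K -> cplx R) :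
  inner v (mxact (\sum_(k <- t | P k) F k : M) v) =
  \sum_(k <- t | P k) inner v (mxact (F k) v).
Proof.
apply: (big_morph (fun X : M => inner v (mxact X v))) => [X Y|].
  by rewrite mxactD innerDr.
rewrite /inner big1// => i _; rewrite /mxact big1 ?mulr0// => j _.
by rewrite [(0 : M) i j]mxE mul0r.
Qed.

(** Over complex matrices the test vectors of [cp_of_forms] reduce to vectors z i in C^K. *)
Lemma cp_to_matrix (psi : A -> M) : (forall a, psi (star a) = star (psi a)) ->
  (forall n (y : 'M[A]_n) (z : 'I_n -> 'I_K -> R[i]),
    0 <= \sum_i \sum_j \sum_k \sum_l
      conjc (z i k) * ((psi ((mxstar y *m y) i j) k l : R[i]) * z j l)) ->
  completely_positive psi.
Proof.
move=> ps h; apply: cp_of_forms => // n y xi.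
apply: mxC_psd_inner => [|v].
  transitivity (\sum_i \sum_j star (star (xi i) * psi ((mxstar y *m y) i j) * xi j)).
    by rewrite star_sum; apply: eq_bigr => i _; rewrite star_sum.
  rewrite exchange_big; apply: eq_bigr => i _; apply: eq_bigr => j _.
  apply: etrans (star_sandwich _ _ _) _.
  have -> : star (psi ((mxstar y *m y) j i)) = psi ((mxstar y *m y) i j); last by [].
  rewrite -[LHS]ps; congr (psi _).
  by rewrite !mxE star_sum; apply: eq_bigr => k _; rewrite !mxE starM starK.
rewrite inner_mxact_sum; apply/cplx_psdP.
have := h n y (fun i => mxact (xi i) v).
rewrite (_ : \sum_i _ = \sum_i inner v (mxact (\sum_j star (xi i) *
  psi ((mxstar y *m y) i j) * xi j : M) v) :> R[i])//.
apply: eq_bigr => i _; rewrite inner_mxact_sum; apply: eq_bigr => j _.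
rewrite !mxactM -[LHS]/(\sum_k _).
have := inner_mxact (xi i) v (mxact (psi ((mxstar y *m y) i j)) (mxact (xi j) v)).
rewrite /star /= => <-.
by apply: eq_bigr => k _; rewrite -mulr_sumr.
Qed.

End MatrixCP.

(** * Compression to words and dilation back *)

Section Compression.
Variables (R : realType) (r : nat) (L : kGraph r).
Hypotheses (Lrow : row_finite L) (Lfin : finite_set (objects L)).
Variables (O : cStarAlgType R) (s : L -> O).
Hypotheses (sF : graph_family s) (sgen : cstar_gen (range s) = setT).
Variable tau : L -> O -> R[i].
Hypothesis tauP : forall c, objects L c ->
  [/\ pos_functional (tau c), tau c (s c) = 1, forall b, nc (tau c b) <= nrm b &
    forall u v, kshape u != kshape v -> tau c (s u * star (s v)) = 0].
Implicit Types (u v w : L) (m n : deg r).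

Let tlin c (co : objects L c) : linear (tau c : O -> R[i]^o).
Proof. by have [/pos_functional_lin h _ _ _] := tauP co. Qed.

(** Each common extension contributes s_x s_y^* with x and y of different shapes, on which the state
    vanishes. *)
Lemma state_star_s_s c u v : objects L c -> kshape u != kshape v ->
  tau c (star (s u) * s v) = 0.
Proof.
move=> co uv; have [tp _ _ t0] := tauP co.
have um := le_maxl (kshape u) (kshape v); have vm := le_maxr (kshape u) (kshape v).
rewrite (star_s_s Lrow Lfin sF sgen um vm) (linf_sum (tlin co)) big_seq big1// => w.
rewrite (wdsP Lrow Lfin) => /eqP wm; case: ifP => _; last exact: linf_0 (tlin co).
apply: t0; apply: contra uv => /eqP E.
have := shape_tl (m := kshape u) (w := w); have := shape_tl (m := kshape v) (w := w).
rewrite wm => /(_ vm) + /(_ um); rewrite E => <- /eqP.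
by rewrite addrC [X in _ == X]addrC (inj_eq (@deg_addI _ _)).
Qed.

Variables (K : nat) (U : 'I_K -> L).
Hypothesis Uinj : injective U.
Local Notation M := (mxC (cplx R) K).

Definition compress (a : O) : M := \matrix_(i, j)
  (if trm (U i) == trm (U j) then tau (trm (U i)) (star (s (U i)) * a * s (U j)) else 0 : cplx R).

Lemma compress_lin : linear compress.
Proof.
move=> z a b; apply/matrixP => i j; rewrite [RHS]mxE mxC_scaleE !mxE.
case: ifP => _; last by rewrite mulr0 addr0.
have co := trm_obj (U i).
rewrite mulrDr mulrDl -scalerAre -scalerAle (linf_D (tlin co)) (linf_Z (tlin co)).
by [].
Qed.

Lemma compress1 : compress 1 = 1.
Proof.
apply/matrixP => i j; rewrite !mxE mulr1; have co := trm_obj (U i).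
have [<-|ij] := eqVneq i j.
  by rewrite eqxx (star_s sF); have [_ -> _ _] := tauP co.
case: ifP => // _; have [e|ne] := eqVneq (kshape (U i)) (kshape (U j)).
  rewrite (star_s_orth Lrow Lfin sF sgen)//; first exact: linf_0 (tlin co).
  by apply: contra ij => /eqP/Uinj ->.
exact: state_star_s_s.
Qed.

Lemma compress_star a : compress (star a) = star (compress a).
Proof.
apply/matrixP => i j; rewrite mxC_starE !mxE eq_sym; case: eqP => e; last by rewrite star0.
have [tp _ _ _] := tauP (trm_obj (U i)).
by rewrite e -[RHS](pos_functional_star tp) star_sandwich.
Qed.

(** Grouped by the terminus c, the form is a sum of tau_c <y Z_c, y Z_c>, where Z_c collects the s_u
    that end at c. *)
Lemma compress_cp : completely_positive compress.
Proof.
apply: cp_to_matrix => [|n y z]; first exact: compress_star.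
pose Z c i : O := \sum_(k | trm (U k) == c) z i k *: s (U k).
suff -> : \sum_i \sum_j \sum_k \sum_l
    conjc (z i k) * ((compress ((mxstar y *m y) i j) k l : R[i]) * z j l) =
  \sum_(c <- wds L 0) tau c (inner (mxact y (Z c)) (mxact y (Z c))).
  rewrite big_seq; apply: sumr_ge0 => c; rewrite (wdsP Lrow Lfin) => /eqP co.
  have [tp _ _ _] := tauP co.
  by apply: (pos_functional_psd tp); exact: psd_inner.
transitivity (\sum_(c <- wds L 0) \sum_i \sum_j \sum_k \sum_l
   (if (trm (U k) == c) && (trm (U l) == c) then conjc (z i k) *
     (tau c (star (s (U k)) * (mxstar y *m y) i j * s (U l)) * z j l) else 0)).
  rewrite [RHS]exchange_big; apply: eq_bigr => i _; rewrite [RHS]exchange_big.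
  apply: eq_bigr => j _; rewrite [RHS]exchange_big; apply: eq_bigr => k _.
  rewrite [RHS]exchange_big; apply: eq_bigr => l _.
  have kin : trm (U k) \in wds L 0 by rewrite (wdsP Lrow Lfin) shape_trm.
  rewrite (big_rem _ kin) eqxx /= big_seq big1 ?addr0 => [|c].
    by rewrite [trm (U l) == _]eq_sym mxE; case: ifP => // _; rewrite mul0r mulr0.
  by rewrite mem_rem_uniq ?fset_uniq// inE eq_sym => /andP[/negbTE -> _].
rewrite big_seq [RHS]big_seq; apply: eq_bigr => c; rewrite (wdsP Lrow Lfin) => /eqP co.
have tl := tlin co.
have -> : inner (mxact y (Z c)) (mxact y (Z c)) = inner (Z c) (mxact (mxstar y *m y) (Z c)).
  by rewrite inner_mxact mxactM.
rewrite /inner (linf_sum tl); apply: eq_bigr => i _.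
rewrite /mxact mulr_sumr (linf_sum tl); apply: eq_bigr => j _.
rewrite /Z star_sum mulr_suml (linf_sum tl) [RHS]big_mkcond /=.
apply: eq_bigr => k _; case: eqP => kc /=; last by rewrite big1.
rewrite !mulr_sumr (linf_sum tl) [RHS]big_mkcond /=; apply: eq_bigr => l _.
case: eqP => lc //.
rewrite starZ_mul_scale (linf_Z tl) /GRing.scale /= [LHS]mulrA.
exact: mulrAC.
Qed.

Definition dilate (t : R) (x : M) : O :=
  t%:C *: \sum_i \sum_j (x i j : R[i]) *: (s (U i) * star (s (U j))).

Lemma dilate_lin t : linear (dilate t).
Proof.
move=> z x y; rewrite /dilate scalerA mulrC -scalerA -scalerDr; congr (_ *: _).
rewrite scaler_sumr -big_split; apply: eq_bigr => i _ /=.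
rewrite scaler_sumr -big_split; apply: eq_bigr => j _ /=.
by rewrite [(_ + _ : M) _ _]mxE mxC_scaleE scalerDl scalerA.
Qed.

Lemma dilate_star t x : dilate t (star x) = star (dilate t x).
Proof.
rewrite /dilate starZ conjc_real star_sum; congr (_ *: _).
rewrite exchange_big; apply: eq_bigr => i _; rewrite star_sum; apply: eq_bigr => j _.
by rewrite starZ starM starK mxC_starE.
Qed.

(** Up to the factor t the map is x -> V x V^* for the row V of all s_u, so the form is a sum of
    squares. *)
Lemma dilate_cp t : 0 <= t -> completely_positive (dilate t).
Proof.
move=> t0; apply: cp_of_forms => [|n y xi]; first exact: dilate_star.
pose eta (q : 'I_n) (a : 'I_K) : O := \sum_j \sum_l (y q j a l : R[i]) *: (star (s (U l)) * xi j).
suff -> : \sum_i \sum_j star (xi i) * dilate t ((mxstar y *m y) i j) * xi j =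
   t%:C *: \sum_q \sum_a star (eta q a) * eta q a.
  apply: psdZ => //; apply: psd_sum => q _ _; apply: psd_sum => a _ _.
  exact: psd_starM.
have P i j k l : ((mxstar y *m y) i j k l : R[i]) =
    \sum_q \sum_a conjc (y q i a k) * (y q j a l : R[i]).
  rewrite mxE mxC_sumE; apply: eq_bigr => q _; rewrite mxC_mulE; apply: eq_bigr => a _.
  by rewrite /mxstar !mxE.
transitivity (\sum_i \sum_j \sum_k \sum_l \sum_q \sum_a
    t%:C *: ((conjc (y q i a k) * (y q j a l : R[i])) *:
       (star (xi i) * s (U k) * (star (s (U l)) * xi j)))).
  apply: eq_bigr => i _; apply: eq_bigr => j _.
  rewrite /dilate -scalerAre -scalerAle mulr_sumr mulr_suml scaler_sumr; apply: eq_bigr => k _.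
  rewrite mulr_sumr mulr_suml scaler_sumr; apply: eq_bigr => l _.
  rewrite -scalerAre -scalerAle P scaler_suml scaler_sumr; apply: eq_bigr => q _.
  by rewrite scaler_suml scaler_sumr; apply: eq_bigr => a _; rewrite !mulrA.
rewrite scaler_sumr.
transitivity (\sum_q \sum_a \sum_i \sum_k \sum_j \sum_l
    t%:C *: ((conjc (y q i a k) * (y q j a l : R[i])) *:
       (star (xi i) * s (U k) * (star (s (U l)) * xi j)))); last first.
  apply: eq_bigr => q _; rewrite scaler_sumr; apply: eq_bigr => a _.
  rewrite /eta star_sum mulr_suml scaler_sumr; apply: eq_bigr => i _.
  rewrite star_sum mulr_suml scaler_sumr; apply: eq_bigr => k _.
  rewrite mulr_sumr scaler_sumr; apply: eq_bigr => j _.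
  rewrite mulr_sumr scaler_sumr; apply: eq_bigr => l _.
  by rewrite starZ starM starK -scalerAre -scalerAle !scalerA; congr (_ *: _); ring.
(* Exchange j with k, then bring q and a to the front. *)
under eq_bigr => i _ do rewrite exchange_big.
under eq_bigr => i _ do under eq_bigr => k _ do under eq_bigr => j _ do rewrite exchange_big.
under eq_bigr => i _ do under eq_bigr => k _ do rewrite exchange_big.
under eq_bigr => i _ do rewrite exchange_big.
rewrite exchange_big; apply: eq_bigr => q _.
under eq_bigr => i _ do under eq_bigr => k _ do under eq_bigr => j _ do rewrite exchange_big.
under eq_bigr => i _ do under eq_bigr => k _ do rewrite exchange_big.
under eq_bigr => i _ do rewrite exchange_big.
by rewrite exchange_big.
Qed.

(* [Y] moves the shapes by [A - B] without enlarging them; this is what makes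
   [dilate (compress Y)] a multiple of [Y]. *)
Definition graded (A B : deg r) (Y : O) : Prop :=
  forall u v, le_deg A (kshape u) -> le_deg B (kshape v) ->
    star (s u) * Y * s v = 0 \/
    exists u' v', [/\ star (s u) * Y * s v = star (s u') * s v',
      trm u' = trm u, trm v' = trm v, A + kshape u' = kshape u & B + kshape v' = kshape v].

Lemma graded_mono u v : graded (kshape u) (kshape v) (s u * star (s v)).
Proof.
move=> a b ua vb; rewrite mulrA -mulrA (s_mul_star Lrow Lfin sF sgen)//.
rewrite (star_s_mul Lrow Lfin sF sgen)//.
case: eqP => _; last by left; rewrite mul0r.
case: eqP => _; last by left; rewrite mulr0.
by right; exists (tl (kshape u) a), (tl (kshape v) b); split; rewrite ?trm_tl ?shape_tl.
Qed.

Lemma graded_shift m A B Y : graded A B Y -> graded (m + A) (m + B) (shift_map s m Y).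
Proof.
move=> h u v mu mv.
have mu' := le_deg_trans (le_deg_addr m A) mu.
have mv' := le_deg_trans (le_deg_addr m B) mv.
rewrite (star_s_shift Lrow Lfin sF sgen)//; case: eqP => _; last by left.
have [] := h (tl m u) (tl m v).
- by rewrite -(le_deg_add2l m) shape_tl.
- by rewrite -(le_deg_add2l m) shape_tl.
- by left.
move=> [u' [v' [e1 e2 e3 e4 e5]]]; right; exists u', v'; split=> //.
- by rewrite e2 trm_tl.
- by rewrite e3 trm_tl.
- by rewrite -addrA e4 shape_tl.
- by rewrite -addrA e5 shape_tl.
Qed.

(** Unless it is 0, the compressed element is s_u'^* s_v'. The state kills it when these shapes
    differ, orthogonality when they agree and u' <> v'; for u' = v' the entry is 1. The shapes of u'
    and v' agree exactly when the condition on the right holds. *)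
Lemma graded_entry A B Y i j : graded A B Y ->
  le_deg A (kshape (U i)) -> le_deg B (kshape (U j)) ->
  (compress Y i j : R[i]) *: s (U i) =
    if kshape (U i) + B == kshape (U j) + A
    then s (U i) * star (s (U i)) * (Y * s (U j)) else 0.
Proof.
move=> g Ai Bj; rewrite mxE -!mulrA [star _ * (_ * _)]mulrA.
have tl := tlin (trm_obj (U i)).
have [->|[u' [v' [-> tu tv su sv]]]] := g _ _ Ai Bj.
  by rewrite mulr0 !if_same (linf_0 tl) if_same scale0r.
have [e|ne] := eqVneq (kshape u') (kshape v'); last first.
  rewrite state_star_s_s ?if_same ?scale0r//; last exact: trm_obj.
  case: eqP => // E; case/eqP: ne; apply: (@deg_addI _ (A + B)).
  by rewrite addrAC su E -sv addrAC [B + A]addrC.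
have -> : kshape (U i) + B == kshape (U j) + A.
  by rewrite -su -sv e addrAC [X in _ == X]addrAC [B + A]addrC.
have [uv|uv] := eqVneq u' v'.
  rewrite -tu -tv uv eqxx (star_s sF) tv.
  have [_ -> _ _] := tauP (trm_obj (U j)).
  by rewrite scale1r -tv -uv tu (s_trm sF).
by rewrite (star_s_orth Lrow Lfin sF sgen e uv) (linf_0 tl) if_same scale0r mulr0.
Qed.

Variable F : seq (deg r).
Hypothesis Fu : uniq F.
Hypothesis UE : forall (V : nmodType) (G : L -> V),
  \sum_i G (U i) = \sum_(m <- F) \sum_(w <- wds L m) G w.

Lemma dilate1 : F != [::] -> dilate (size F)%:R^-1 1 = 1.
Proof.
move=> F0; rewrite /dilate.
have -> : \sum_i \sum_j ((1 : M) i j : R[i]) *: (s (U i) * star (s (U j))) =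
    \sum_i s (U i) * star (s (U i)).
  apply: eq_bigr => i _; rewrite (bigD1 i)//= big1 ?addr0 => [|j ji].
    by rewrite mxE eqxx scale1r.
  by rewrite mxE eq_sym (negbTE ji) scale0r.
rewrite (UE (fun w => s w * star (s w))); under eq_bigr => m _ do rewrite (s_unit Lrow Lfin sF sgen).
rewrite big_const_seq count_predT iter_addr_0 -[X in _ *: X]scaler_nat scalerA.
rewrite -(rmorph_nat (@real_complex R)) -rmorphM mulVf ?rmorph1 ?scale1r//.
by rewrite pnatr_eq0 size_eq0.
Qed.

(** Counts the m in F for which m + A - B is again in F, written without subtraction. *)
Definition matched (A B : deg r) : nat :=
  count (fun m => has (fun m' => m' + B == m + A) F) F.

(** In column j the words u of the one shape that satisfies the condition contribute the sum of s_u
    s_u^*, which is 1, so the column gives Y s_Uj if that shape is in F and 0 otherwise. Summing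
    over all columns of one shape leaves one Y for each matched shape. *)
Lemma dilate_compress t A B Y : graded A B Y ->
  (forall m, m \in F -> le_deg A m /\ le_deg B m) ->
  dilate t (compress Y) = (t * (matched A B)%:R)%:C *: Y.
Proof.
move=> g AB; rewrite /dilate rmorphM -scalerA; congr (_ *: _).
have shU i : kshape (U i) \in F.
  apply/negPn/negP => iF; have := UE (fun w => ((w == U i) : nat)).
  rewrite (bigD1 i)//= eqxx [X in _ = X]big_seq [X in _ = X]big1 => [|m mF]; first by [].
  rewrite big_seq big1 // => w; rewrite (wdsP Lrow Lfin) => /eqP wm.
  by case: eqP => // E; case/negP: iF; rewrite -E wm.
transitivity (\sum_j (if has (fun m' => m' + B == kshape (U j) + A) F then Y * s (U j) else 0)
   * star (s (U j))).
  rewrite exchange_big; apply: eq_bigr => j _.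
  have [_ Bj] := AB _ (shU j).
  under eq_bigr => i _ do
    rewrite scalerAle (graded_entry g (proj1 (AB _ (shU i))) Bj).
  rewrite -mulr_suml; congr (_ * _).
  rewrite (UE (fun w => if kshape w + B == kshape (U j) + A
    then s w * star (s w) * (Y * s (U j)) else 0)).
  transitivity (\sum_(m <- F) if m + B == kshape (U j) + A then Y * s (U j) else 0).
    apply: eq_bigr => m _; rewrite big_seq.
    transitivity (\sum_(w <- wds L m | w \in wds L m) if m + B == kshape (U j) + A
      then s w * star (s w) * (Y * s (U j)) else 0).
      by apply: eq_bigr => w; rewrite (wdsP Lrow Lfin) => /eqP ->.
    rewrite -big_seq; case: ifP => _; last by rewrite big1.
    by rewrite -mulr_suml (s_unit Lrow Lfin sF sgen) mul1r.
  case: (boolP (has _ F)) => [/hasP[m mF /eqP mE]|/hasPn h].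
    rewrite (big_rem _ mF) mE eqxx /= big_seq big1 ?addr0// => m'.
    rewrite mem_rem_uniq// inE => /andP[m'm _]; case: eqP => // E.
    by case/eqP: m'm; apply: (@deg_addI _ B); rewrite addrC E -mE addrC.
  by rewrite big_seq big1// => m /h /negbTE ->.
rewrite (UE (fun w => (if has (fun m' => m' + B == kshape w + A) F then Y * s w else 0) * star (s w))).
transitivity (\sum_(m <- F) if has (fun m' => m' + B == m + A) F then Y else 0).
  apply: eq_bigr => m _; rewrite big_seq.
  transitivity (\sum_(w <- wds L m | w \in wds L m) if has (fun m' => m' + B == m + A) F
      then Y * (s w * star (s w)) else 0).
    apply: eq_bigr => w; rewrite (wdsP Lrow Lfin) => /eqP ->.
    by case: ifP => _; rewrite ?mul0r// mulrA.
  rewrite -big_seq; case: ifP => _; last by rewrite big1.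
  by rewrite -mulr_sumr (s_unit Lrow Lfin sF sgen) mulr1.
rewrite -big_mkcond big_const_seq iter_addr_0 /matched.
by rewrite rmorph_nat scaler_nat.
Qed.

End Compression.

(** * Boxes of degrees *)

Section Boxes.
Variable r : nat.
Implicit Types (a c m n A B : deg r) (k : nat).

Definition box k : seq (deg r) := [seq [ffun i => (e i : nat)] | e : {ffun 'I_r -> 'I_k}].

Lemma size_box k : size (box k) = (k ^ r)%N.
Proof. by rewrite size_map -cardT card_ffun !card_ord. Qed.

Lemma box_uniq k : uniq (box k).
Proof.
rewrite map_inj_uniq ?enum_uniq// => e e' /ffunP h; apply/ffunP => i; apply/val_inj.
by have := h i; rewrite !ffunE.
Qed.

Lemma boxP k m : (m \in box k) = [forall i, (m i < k)%N].
Proof.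
apply/mapP/forallP => [[e _ ->] i|h]; first by rewrite ffunE.
exists [ffun i => Ordinal (h i)]; first by rewrite mem_enum.
by apply/ffunP => i; rewrite !ffunE.
Qed.

Definition translated_box a k := [seq a + e | e <- box k].

Lemma translated_box_uniq a k : uniq (translated_box a k).
Proof. by rewrite map_inj_uniq ?box_uniq//; exact: deg_addI. Qed.

Lemma size_translated_box a k : size (translated_box a k) = (k ^ r)%N.
Proof. by rewrite size_map size_box. Qed.

Lemma translated_box_ge a k m : m \in translated_box a k -> le_deg a m.
Proof. by move=> /mapP[e _ ->]; exact: le_deg_addr. Qed.

(* Boxes are Folner sets: shifting one by a fixed degree loses few of its points. *)
Lemma matched_box a k c A B : ((dmax A + dmax B)%N <= k)%N ->
  ((k - (dmax A + dmax B)) ^ r <= matched (translated_box a k) (c + A)%R (c + B)%R)%N.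
Proof.
move=> Dk; set D := (dmax A + dmax B)%N; rewrite -(size_translated_box (a + B)) /matched -size_filter.
apply: uniq_leq_size; first exact: translated_box_uniq.
have dle (C : deg r) i : (C i <= dmax C)%N by rewrite /dmax (bigD1 i)//= leq_addr.
move=> x /mapP[e]; rewrite boxP => /forallP he ->; rewrite mem_filter; apply/andP; split.
  apply/hasP; exists (a + (A + e)).
    apply/mapP; exists (A + e) => //; rewrite boxP; apply/forallP => i; rewrite ffunE.
    have := he i; rewrite ltn_subRL; apply: leq_ltn_trans.
    by rewrite leq_add2r (leq_trans (dle _ _))// leq_addr.
  by apply/eqP/ffunP => i; rewrite !ffunE; lia.
apply/mapP; exists (B + e); last by rewrite addrA.
rewrite boxP; apply/forallP => i; rewrite ffunE.
have := he i; rewrite ltn_subRL; apply: leq_ltn_trans.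
by rewrite leq_add2r (leq_trans (dle _ _))// leq_addl.
Qed.

(** Bernoulli's inequality (1 - D / k)^r >= 1 - r D / k. *)
Lemma box_ratio (R : realType) (D : nat) (e : R) : 0 < e ->
  exists k0, forall k, (k0 <= k)%N -> (D <= k)%N /\
    1 - e <= ((k ^ r)%:R : R)^-1 * ((k - D) ^ r)%:R.
Proof.
move=> e0; exists (D + Num.bound (r%:R * D%:R / e)).+1 => k hk.
have Dk : (D <= k)%N by apply: leq_trans hk; rewrite leqW// leq_addr.
have k0 : 0 < k%:R :> R by rewrite ltr0n (leq_ltn_trans _ hk).
split=> //; rewrite !natrX natrB// -exprVn -exprMn.
have -> : k%:R^-1 * (k%:R - D%:R) = 1 - D%:R / k%:R :> R.
  by rewrite mulrBr mulVf ?gt_eqF// mulrC.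
have x1 : 0 <= 1 - D%:R / k%:R :> R by rewrite subr_ge0 ler_pdivrMr// mul1r ler_nat.
have : 1 - r%:R * (D%:R / k%:R) <= (1 - D%:R / k%:R : R) ^+ r.
  have d0 : 0 <= D%:R / k%:R :> R by rewrite divr_ge0.
  elim: r => [|q ih]; first by rewrite mul0r subr0 expr0.
  rewrite exprS (le_trans _ (ler_wpM2l x1 ih))// -[q.+1%:R]natr1 -subr_ge0.
  rewrite (_ : _ - _ = q%:R * (D%:R / k%:R) ^+ 2); last by ring.
  by rewrite mulr_ge0// exprn_ge0.
apply: le_trans; rewrite lerD2l lerN2 mulrA ler_pdivrMr// -ler_pdivrMl// mulrC.
have x0 : 0 <= r%:R * D%:R / e by rewrite divr_ge0 ?mulr_ge0// ltW.
have h := archi_boundP x0.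
by rewrite (le_trans (ltW h))// ler_nat (leq_trans _ hk)// leqW// leq_addl.
Qed.

End Boxes.

Section Enumeration.
Variables (r : nat) (L : kGraph r).
Hypotheses (Lrow : row_finite L) (Lfin : finite_set (objects L)).

Definition words_list (F : seq (deg r)) : seq L := flatten [seq enum_fset (wds L m) | m <- F].

Definition word_enum F (i : 'I_(size (words_list F))) : L := tnth (in_tuple (words_list F)) i.

Lemma words_listP F w : (w \in words_list F) = (kshape w \in F).
Proof.
apply/flatten_mapP/idP => [[m mF]|wF]; first by rewrite (wdsP Lrow Lfin) => /eqP ->.
by exists (kshape w) => //; rewrite (wdsP Lrow Lfin).
Qed.

Lemma words_list_uniq F : uniq F -> uniq (words_list F).
Proof.
elim: F => //= m F ih /andP[mF Fu]; rewrite /words_list /= cat_uniq fset_uniq ih// andbT.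
apply/hasPn => w /=; rewrite words_listP => wF.
by rewrite (wdsP Lrow Lfin); apply: contra mF => /eqP <-.
Qed.

Lemma word_enum_inj F : uniq F -> injective (@word_enum F).
Proof. by move=> Fu; apply/tuple_uniqP => /=; exact: words_list_uniq. Qed.

Lemma word_enum_sum F (V : nmodType) (G : L -> V) :
  \sum_i G (@word_enum F i) = \sum_(m <- F) \sum_(w <- wds L m) G w.
Proof.
transitivity (\sum_(w <- words_list F) G w); first by rewrite [RHS]big_tnth.
by rewrite big_flatten big_map.
Qed.

Lemma word_enum_shape F i : kshape (@word_enum F i) \in F.
Proof. by rewrite -words_listP; exact: mem_tnth. Qed.

End Enumeration.

Lemma pos_unital_id (R : realType) (A : cStarAlgType R) : pos_unital (id : A -> A).
Proof. by split=> // y; exact: psd_starM. Qed.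

Lemma pos_unital_comp (R : realType) (A B C : cStarAlgType R) (f : A -> B) (g : B -> C) :
  pos_unital f -> pos_unital g -> pos_unital (g \o f).
Proof.
move=> fP gP; have [fl f1 fp] := fP; have [gl g1 gp] := gP; split=> /=.
- by move=> z a b /=; rewrite fl gl.
- by rewrite f1 g1.
- by move=> y; apply: (pos_unital_psd gP); exact: fp.
Qed.

(** * The approximating maps *)

Section UpperMaps.
Variables (R : realType) (r : nat) (L : kGraph r).
Hypotheses (Lrow : row_finite L) (Lfin : finite_set (objects L)).
Variables (O : cStarAlgType R) (s : L -> O).
Hypotheses (sF : graph_family s) (sgen : cstar_gen (range s) = setT).
Hypothesis s1 : forall u, nrm (s u) = 1.
Variable tau : L -> O -> R[i].
Hypothesis tauP : forall c, objects L c ->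
  [/\ pos_functional (tau c), tau c (s c) = 1, forall b, nc (tau c b) <= nrm b &
    forall u v, kshape u != kshape v -> tau c (s u * star (s v)) = 0].
Variable p : deg r.
Implicit Types (u v w : L) (a m A B : deg r) (Y : O) (n k j : nat).
Local Notation theta := (canonical_shift s p).

Lemma theta_iter j : iter j.+1 theta = shift_map s (p *+ j.+1).
Proof.
apply/funext; elim: j => [|j ih] Y; first by rewrite /= (canonical_shiftE Lrow Lfin).
by rewrite iterS ih (canonical_shiftE Lrow Lfin) (shift_mapD Lrow Lfin sF) -mulrS.
Qed.

Lemma theta_iter_pos j : pos_unital (iter j theta).
Proof.
case: j => [|j]; first exact: pos_unital_id.
by rewrite theta_iter; exact: shift_map_pos.
Qed.

Lemma theta_iter_graded j A B Y : graded s A B Y ->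
  graded s (p *+ j + A) (p *+ j + B) (iter j theta Y).
Proof.
case: j => [|j] g; first by rewrite mulr0n !add0r.
by rewrite theta_iter; exact: graded_shift.
Qed.

Definition cpa_down a k := compress s tau (@word_enum r L (translated_box a k)).
Definition cpa_up a k := dilate s (@word_enum r L (translated_box a k)) ((k ^ r)%:R^-1).
Arguments cpa_up : clear implicits.
Definition cpa_map a k (Y : O) : O := cpa_up a k (cpa_down a k Y).

Lemma cpa_down_ucp a k : ucp (cpa_down a k).
Proof.
have Ui := word_enum_inj Lrow Lfin (translated_box_uniq a k).
split; first exact: compress_lin.
- exact: compress1.
- exact: compress_cp.
Qed.

Lemma cpa_up_ucp a k : (0 < k)%N -> ucp (cpa_up a k).
Proof.
move=> k0; split; first exact: dilate_lin.
- rewrite /cpa_up -(size_translated_box a); apply: dilate1 => //.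
    by move=> V G; exact: word_enum_sum.
  by rewrite -size_eq0 size_translated_box expn_eq0 negb_and -lt0n k0.
- by apply: dilate_cp => //; rewrite invr_ge0.
Qed.

Lemma cpa_map_pos a k : (0 < k)%N -> pos_unital (cpa_map a k).
Proof.
move=> k0; apply: (@pos_unital_comp _ _ _ _ (cpa_down a k) (cpa_up a k)).
  exact/ucp_pos_unital/cpa_down_ucp.
exact/ucp_pos_unital/cpa_up_ucp.
Qed.

(** The bound on the side k depends neither on the time j nor on the position a. For a monomial s_u
    s_v^* the translation by [dconst r k] makes all shapes of the box exceed those of u and v after
    j shifts, as [dilate_compress] demands. *)
Let good Y := forall e : R, 0 < e -> exists k0, forall k, (k0 <= k)%N ->
  forall a j, le_deg (p *+ j) a ->
  nrm (cpa_map (a + dconst r k) k (iter j theta Y) - iter j theta Y) < e.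

Let good_mono u v : good (s u * star (s v)).
Proof.
(* [cpa_map] multiplies the iterate of the monomial by some q between 1 - e / 3 and 1, and this
   iterate has norm at most 2. *)
move=> e e0; have [k0 hk0] := box_ratio r (dmax (kshape u) + dmax (kshape v)) (divr_gt0 e0 (ltr0Sn R 2)).
exists (maxn k0 (dmax (kshape u) + dmax (kshape v)).+1) => k; rewrite geq_max => /andP[kk Dk] a j ja.
have [Dk' hr] := hk0 _ kk.
have kp : (0 < k)%N by exact: leq_trans Dk.
set Y := iter j theta _.
set F := translated_box (a + dconst r k) k.
set A := p *+ j + kshape u; set B := p *+ j + kshape v.
have g : graded s A B Y by apply: theta_iter_graded; exact: graded_mono.
rewrite /cpa_map /cpa_up /cpa_down.
rewrite (dilate_compress Lrow Lfin sF sgen tauP (translated_box_uniq _ _)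
  (fun V G => word_enum_sum F G) _ g).
- rewrite -[X in _ - X]scale1r -scalerBl nrmZ -(rmorph1 (@real_complex R)) -rmorphB nc_real.
  have nY : nrm Y <= 2.
    rewrite (le_trans (pos_unital_nrm (theta_iter_pos _) _))// -[leRHS]mulr1 ler_wpM2l//.
    by rewrite (le_trans (nrmM _ _))// nrm_star !s1 mulr1.
  set q := _ * (matched F A B)%:R.
  have q1 : q <= 1.
    rewrite /q ler_pdivrMl ?ltr0n ?expn_gt0 ?kp// mulr1 ler_nat.
    by rewrite -(size_translated_box (a + dconst r k) k) count_size.
  have q0 : 1 - e / 3 <= q.
    apply: (le_trans hr); rewrite /q ler_wpM2l ?invr_ge0// ler_nat.
    exact: matched_box.
  rewrite distrC ger0_norm ?subr_ge0//.
  have : (1 - q) * nrm Y <= (e / 3) * 2 by rewrite ler_pM ?subr_ge0 ?nrm_ge0//; lra.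
  by move=> h; apply: (le_lt_trans h); lra.
- move=> m /translated_box_ge am.
  have du : le_deg (kshape u) (dconst r k).
    by apply: le_dconst; apply: leq_trans (ltnW Dk); rewrite leq_addr.
  have dv : le_deg (kshape v) (dconst r k).
    by apply: le_dconst; apply: leq_trans (ltnW Dk); rewrite leq_addl.
  have h C : le_deg C (dconst r k) -> le_deg (p *+ j + C) m.
    move=> Ck; apply: le_deg_trans am.
    apply: le_deg_trans (le_degD _ ja); by rewrite le_deg_add2l.
  by split; apply: h.
Qed.

Let good_lin z Y Y' : good Y -> good Y' -> good (z *: Y + Y').
Proof.
move=> hY hY' e e0; have e2 : 0 < e / 2 by rewrite divr_gt0.
have z0 : 0 < nc z + 1 by rewrite ltr_wpDl ?nc_ge0.
have [k1 h1] := hY _ (divr_gt0 e2 z0); have [k2 h2] := hY' _ e2.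
exists (maxn 1 (maxn k1 k2)) => k; rewrite !geq_max => /and3P[k0 kk1 kk2] a j ja.
have [tl _ _] := theta_iter_pos j; have [cl _ _] := cpa_map_pos (a + dconst r k) k0.
rewrite tl cl opprD addrACA -scalerBr (le_lt_trans (nrmD _ _))// nrmZ.
have g1 := h1 _ kk1 _ _ ja; have g2 := h2 _ kk2 _ _ ja.
rewrite [ltRHS](splitr e) ler_ltD//.
rewrite (le_trans (ler_wpM2l (nc_ge0 _) (ltW g1)))// mulrCA -[leRHS]mulr1 ler_wpM2l ?(ltW e2)//.
by rewrite ler_pdivrMr// mul1r lerDl.
Qed.

Let good_spn Y : spn s Y -> good Y.
Proof.
elim=> [|c u v b _ ih]; last exact: good_lin.
move=> e e0; exists 1%N => k k0 a j _.
have [tl _ _] := theta_iter_pos j; have [cl _ _] := cpa_map_pos (a + dconst r k) k0.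
by rewrite (linf_0 tl) (linf_0 cl) subrr nrm0.
Qed.

Let good_all Y : good Y.
Proof.
(* The iterate of Y - b has norm at most e / 6 and its image at most e / 3: together e / 2. *)
move=> e e0; have e12 : 0 < e / 12 by rewrite divr_gt0.
have [b /good_spn hb Yb] := spn_dense Lrow Lfin sF sgen Y e12.
have [k0 h] := hb _ (divr_gt0 e0 (ltr0Sn R 1)).
exists (maxn 1 k0) => k; rewrite geq_max => /andP[kp kk] a j ja.
have tP := theta_iter_pos j; have cP := cpa_map_pos (a + dconst r k) kp.
have [tl _ _] := tP; have [cl _ _] := cP.
have g := h _ kk _ _ ja.
have n1 := pos_unital_nrm tP (Y - b); have n2 := pos_unital_nrm cP (iter j theta (Y - b)).
rewrite (_ : _ - _ = (cpa_map (a + dconst r k) k (iter j theta (Y - b)) - iter j theta (Y - b)) +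
   (cpa_map (a + dconst r k) k (iter j theta b) - iter j theta b)).
  apply: (le_lt_trans (nrmD _ _)).
  have := nrmB (cpa_map (a + dconst r k) k (iter j theta (Y - b))) (iter j theta (Y - b)).
  by move: n1 n2 g Yb; lra.
by rewrite !(linf_B tl) (linf_B cl) addrACA -opprD !subrK.
Qed.

Lemma cpa_exists (Omega : set O) (eps : R) : finite_set Omega -> 0 < eps ->
  exists2 k, (0 < k)%N & forall a n, le_deg (p *+ n) a ->
    CPA (orbit_set theta Omega n) eps (cpa_up (a + dconst r k) k) (cpa_down (a + dconst r k) k).
Proof.
move=> /finite_seqP[t ->] e0.
have [k0 hk0] : exists k0, forall k, (k0 <= k)%N -> forall Y, Y \in t ->
    forall a j, le_deg (p *+ j) a ->
    nrm (cpa_map (a + dconst r k) k (iter j theta Y) - iter j theta Y) < eps.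
  elim: t => [|Y t [k1 h1]]; first by exists 0%N.
  have [k2 h2] := @good_all Y _ e0; exists (maxn k1 k2) => k.
  rewrite geq_max => /andP[kk1 kk2] Z; rewrite inE => /orP[/eqP ->|]; first exact: h2.
  exact: h1.
exists k0.+1 => // a n na; split.
- exact: mxC_fd.
- exact: cpa_up_ucp.
- exact: cpa_down_ucp.
- move=> _ [j /= jn [Y Yt <-]]; rewrite nrmE ltcR; apply: (hk0 _ (leqnSn _) _ Yt).
  apply: le_deg_trans na; apply/le_degP => i.
  by rewrite -(subnK jn) mulrnDr !ffunE leq_addl.
Qed.

End UpperMaps.
Arguments cpa_up {R r L O} s a k x.

(** * Upper bound for the noncommutative partition function *)

Section Itineraries.
Variables (R : realType) (r : nat) (L : kGraph r).
Implicit Types (p N a : deg r) (c : L -> R) (u v w : L).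

(** There are n + 1 terms, as in [orbit_sum], whereas [birkhoff_sum] has n; hence [topQ] is compared
    at n + 1. *)
Definition itsum p N c (n : nat) w : R := \sum_(j < n.+1) c (sub (p *+ j) N w).

Definition Zsum p N c (n : nat) : R := \sum_(w <- wds L (p *+ n + N)) expR (itsum p N c n w).

Lemma mulrn_le_deg p (j n : nat) : (j <= n)%N -> le_deg (p *+ j) (p *+ n).
Proof.
move=> jn; apply/le_degP => i.
by rewrite -(subnK jn) mulrnDr !ffunE leq_addl.
Qed.

Lemma itsum_kmul p N c (n : nat) u v : trm u = org v -> le_deg (p *+ n + N) (kshape u) ->
  itsum p N c n (kmul u v) = itsum p N c n u.
Proof.
move=> uv h; apply: eq_bigr => j _; rewrite sub_kmul//.
by apply: le_deg_trans h; apply: le_degD; rewrite mulrn_le_deg// -ltnS.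
Qed.

End Itineraries.

Section TraceUpperBound.
Variables (R : realType) (r : nat) (L : kGraph r).
Hypotheses (Lrow : row_finite L) (Lfin : finite_set (objects L)).
Variables (O : cStarAlgType R) (s : L -> O).
Hypotheses (sF : graph_family s) (sgen : cstar_gen (range s) = setT).
Hypothesis s1 : forall u, nrm (s u) = 1.
Variable p : deg r.
Implicit Types (u v w : L) (a m A B N : deg r) (Y : O) (n k j : nat).
Local Notation theta := (canonical_shift s p).

Lemma shift_map_s m Y v : le_deg m (kshape v) ->
  shift_map s m Y * s v = s (hd m v) * Y * s (tl m v).
Proof.
move=> mv; have hin : hd m v \in wds L m by rewrite (wdsP Lrow Lfin) shape_hd.
rewrite /shift_map mulr_suml (big_rem _ hin)/= big_seq big1 ?addr0 => [|w].
  by rewrite -mulrA (star_s_mul Lrow Lfin sF sgen) shape_hd// eqxx.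
rewrite mem_rem_uniq ?fset_uniq// inE (wdsP Lrow Lfin) => /andP[wh /eqP wm].
by rewrite -mulrA (star_s_mul Lrow Lfin sF sgen) ?wm// eq_sym (negbTE wh) mulr0.
Qed.

Lemma level_s N (g : L -> R[i]) v : le_deg N (kshape v) ->
  level s N g * s v = g (hd N v) *: s v.
Proof.
move=> Nv; have hin : hd N v \in wds L N by rewrite (wdsP Lrow Lfin) shape_hd.
rewrite /level mulr_suml (big_rem _ hin)/= big_seq big1 ?addr0 => [|w].
  rewrite -scalerAle /chi -mulrA (star_s_mul Lrow Lfin sF sgen) shape_hd// eqxx.
  by rewrite -(s_mul sF) ?hd_tl// trm_hd.
rewrite mem_rem_uniq ?fset_uniq// inE (wdsP Lrow Lfin) => /andP[wh /eqP wm].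
rewrite -scalerAle /chi -mulrA (star_s_mul Lrow Lfin sF sgen) ?wm//.
by rewrite eq_sym (negbTE wh) mulr0 scaler0.
Qed.

Lemma theta_level_s N (g : L -> R[i]) j v : le_deg (p *+ j + N) (kshape v) ->
  iter j theta (level s N g) * s v = g (sub (p *+ j) N v) *: s v.
Proof.
move=> jv; have pv := le_deg_trans (le_deg_addr _ _) jv.
have Nt : le_deg N (kshape (tl (p *+ j) v)) by rewrite -(le_deg_add2l (p *+ j)) shape_tl.
case: j => [|j] in jv pv Nt *.
  rewrite mulr0n add0r in jv *; rewrite level_s// /sub.
  have e : trm (org v) = org v by exact: trm_org.
  by have := tl_kmul e; rewrite shape_org kmul1l => ->.
rewrite (theta_iter Lrow Lfin sF p) shift_map_s// -mulrA level_s// -scalerAre.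
by rewrite -(s_mul sF) ?hd_tl// trm_hd.
Qed.

Lemma orbit_level_s N (c : L -> R) n v : le_deg (p *+ n + N) (kshape v) ->
  orbit_sum theta (level s N (fun w => (c w)%:C)) n * s v = (itsum p N c n v)%:C *: s v.
Proof.
move=> nv; rewrite /orbit_sum mulr_suml rmorph_sum scaler_suml; apply: eq_bigr => j _.
apply: theta_level_s; apply: le_deg_trans nv; apply: le_degD.
by rewrite mulrn_le_deg// -ltnS.
Qed.

Lemma orbit_sum_dist Y Y' n e : star Y = Y -> star Y' = Y' -> nrm (Y - Y') <= e ->
  nrm (orbit_sum theta Y n - orbit_sum theta Y' n) <= n.+1%:R * e.
Proof.
move=> sY sY' h; rewrite /orbit_sum -sumrB (le_trans (nrm_sum _ _ _))//.
rewrite -[n.+1 in leRHS]card_ord mulr_natl -sumr_const ler_sum// => j _.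
have tP := theta_iter_pos Lrow Lfin sF sgen p j; have [tl _ _] := tP.
by rewrite -(linf_B tl) (le_trans (pos_unital_nrm_sa tP _))// starB sY sY'.
Qed.

Lemma orbit_sum_sa Y n : star Y = Y -> star (orbit_sum theta Y n) = orbit_sum theta Y n.
Proof.
move=> sY; rewrite /orbit_sum star_sum; apply: eq_bigr => j _.
by rewrite (pos_unital_sa (theta_iter_pos Lrow Lfin sF sgen p j)).
Qed.

Variable tau : L -> O -> R[i].
Hypothesis tauP : forall c, objects L c ->
  [/\ pos_functional (tau c), tau c (s c) = 1, forall b, nc (tau c b) <= nrm b &
    forall u v, kshape u != kshape v -> tau c (s u * star (s v)) = 0].

Let tlin c (co : objects L c) : linear (tau c : O -> R[i]^o).
Proof. by have [/pos_functional_lin h _ _ _] := tauP co. Qed.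

Lemma compress_nrm v Y : nrm (star (s v) * Y * s v) <= nrm Y.
Proof.
rewrite (le_trans (nrmM _ _))// s1 mulr1 (le_trans (nrmM _ _))//.
by rewrite nrm_star s1 mul1r.
Qed.

(* Compressions of diagonal elements are diagonal matrices, so their
   exponentials need no trace inequality. *)
Lemma diag_offdiag ft u v : diag_alg s ft -> u != v -> 
  tau (trm u) (star (s u) * ft * s v) = 0.
Proof.
move=> hft uv; have co := trm_obj u; have [tp _ tn t0] := tauP co; have tl := tlin co.
apply/eqP; rewrite -nc_eq0 eq_le nc_ge0 andbT; apply/ler_addgt0Pr => e e0; rewrite add0r.
have [m hm] := dspn_dense Lrow Lfin sF sgen hft e0.
pose M := dsum m (dsum (kshape u) (kshape v)).
have [g hg] := hm M (le_maxl _ _).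
have uM : le_deg (kshape u) M by apply: le_deg_trans (le_maxr _ _); exact: le_maxl.
have vM : le_deg (kshape v) M by apply: le_deg_trans (le_maxr _ _); exact: le_maxr.
have z : tau (trm u) (star (s u) * level s M g * s v) = 0.
  rewrite /level mulr_sumr mulr_suml (linf_sum tl) big_seq big1// => w.
  rewrite (wdsP Lrow Lfin) => /eqP wM.
  rewrite -scalerAre -scalerAle (linf_Z tl) /chi -!mulrA mulrA.
  rewrite (star_s_mul Lrow Lfin sF sgen) ?wM// (s_mul_star Lrow Lfin sF sgen) ?wM//.
  case: eqP => hu; last by rewrite mul0r (linf_0 tl) scaler0.
  case: eqP => hv; last by rewrite mulr0 (linf_0 tl) scaler0.
  rewrite t0 ?scaler0//; apply/eqP => E.
  have : kshape u = kshape v.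
    have := shape_tl (m := kshape u) (w := w); have := shape_tl (m := kshape v) (w := w).
    rewrite wM => /(_ vM) + /(_ uM); rewrite E => <- /esym.
    by rewrite addrC [X in _ = X]addrC => /deg_addI.
  by move=> E'; case/eqP: uv; rewrite -hu -hv E'.
rewrite -[tau _ _]subr0 -z -(linf_B tl) -mulrBl -mulrBr (le_trans (tn _))//.
rewrite (le_trans (nrmM _ _))// s1 mulr1 (le_trans (nrmM _ _))//.
by rewrite nrm_star s1 mul1r ltW.
Qed.

Lemma theta_offdiag ft j u v : diag_alg s ft -> u != v -> trm u = trm v ->
  le_deg (p *+ j) (kshape u) -> le_deg (p *+ j) (kshape v) ->
  tau (trm u) (star (s u) * iter j theta ft * s v) = 0.
Proof.
move=> hft uv tuv ju jv; case: j => [|j] in ju jv *; first exact: diag_offdiag.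
rewrite (theta_iter Lrow Lfin sF p) (star_s_shift Lrow Lfin sF sgen)//.
case: eqP => [hh|_]; last exact: linf_0 (tlin (trm_obj u)).
rewrite -(trm_tl ju); apply: diag_offdiag => //; apply: contra uv => /eqP E.
by rewrite -(hd_tl ju) -(hd_tl jv) hh E.
Qed.

(** The compressed orbit sum is diagonal by [theta_offdiag]; replacing [ft] by the level element
    moves each entry by at most (n + 1) e. *)
Lemma compress_orbit_exp (K : nat) (U : 'I_K -> L) (ft : O) (c : L -> R) N n e
    (tr : {scalar mxC (cplx R) K}) :
  (forall x, tr x = \sum_i (x i i : R[i])) ->
  diag_alg s ft -> star ft = ft -> nrm (ft - level s N (fun w => (c w)%:C)) <= e ->
  injective U -> (forall i, le_deg (p *+ n + N) (kshape (U i))) ->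
  complex.Re (tr (cstar_exp (compress s tau U (orbit_sum theta ft n)))) <=
    expR (n.+1%:R * e) * \sum_i expR (itsum p N c n (U i)).
Proof.
move=> trE hft fsa fe Ui NU; set H := orbit_sum theta ft n.
pose la i := complex.Re (tau (trm (U i)) (star (s (U i)) * H * s (U i))).
have Hsa : star H = H by exact: orbit_sum_sa.
rewrite (@mx_diagP _ _ (compress s tau U H) la) => [|i|i j ij].
- rewrite (mx_diag_exp _ trE) /= mulr_sumr ler_sum// => i _.
  rewrite -expRD ler_expR -lerBlDr; have [tp t1 tn _] := tauP (trm_obj (U i)).
  set H' := orbit_sum theta (level s N (fun w => (c w)%:C)) n.
  have lsa : star (level s N (fun w => (c w)%:C)) = level s N (fun w => (c w)%:C).
    by rewrite star_level; apply: eq_bigr => w _; rewrite conjc_real.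
  have Hd : nrm (H - H') <= n.+1%:R * e by exact: orbit_sum_dist.
  apply: le_trans Hd; apply: le_trans (compress_nrm (U i) _); apply: le_trans (tn _).
  rewrite mulrBr mulrBl (linf_B (tlin (trm_obj (U i)))).
  rewrite -(mulrA _ H') orbit_level_s// -scalerAre (star_s sF).
  rewrite (linf_Z (tlin (trm_obj (U i)))) t1 /la.
  have hz : star (star (s (U i)) * H * s (U i)) = star (s (U i)) * H * s (U i).
    by rewrite star_sandwich Hsa.
  rewrite (pos_functional_sa tp hz) [_ *: 1](_ : _ = (itsum p N c n (U i))%:C).
    by rewrite -rmorphB nc_real /= ler_norm.
  exact: mulr1.
- rewrite mxE eqxx /la; have [tp _ _ _] := tauP (trm_obj (U i)).
  by apply: (pos_functional_sa tp); rewrite star_sandwich Hsa.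
- rewrite mxE; case: eqP => // tij; have tl := tlin (trm_obj (U i)).
  rewrite /H /orbit_sum mulr_sumr mulr_suml (linf_sum tl) big1// => k _.
  have h i' : le_deg (p *+ k) (kshape (U i')).
    apply: le_deg_trans (NU i'); apply: (@le_deg_trans _ _ (p *+ n)); last exact: le_deg_addr.
    by rewrite mulrn_le_deg// -ltnS.
  by apply: theta_offdiag => //; apply: contra ij => /eqP/Ui ->.
Qed.

(** A word of shape a has at most as many extensions by shape m as there are words of shape m. *)
Lemma words_sum_le (G : L -> R) a m : (forall u, 0 <= G u) ->
  \sum_(w <- wds L (a + m)) G (hd a w) <= (size (wds L m))%:R * \sum_(u <- wds L a) G u.
Proof.
move=> G0.
have -> : \sum_(w <- wds L (a + m)) G (hd a w) =
    \sum_(x <- [seq (hd a w, tl a w) | w <- wds L (a + m)]) G x.1 by rewrite big_map.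
rewrite -(perm_big _ (fac_perm Lrow Lfin a m)) big_filter.
apply: (@le_trans _ _ (\sum_(x <- [seq (u, v) | u <- wds L a, v <- wds L m]) G x.1)).
  by rewrite big_mkcond; apply: ler_sum => x _; case: ifP.
rewrite big_allpairs_dep /= mulr_sumr; apply: ler_sum => u _.
by rewrite big_const_seq count_predT iter_addr_0 mulr_natl.
Qed.

(** W bounds the number of ways to extend a word of shape p n + N to the shapes of the box; as the
    box has a fixed side, W does not depend on n. *)
Lemma ncZ_upper (ft : O) (Omega : set O) (eps : R) (c : L -> R) N e :
  finite_set Omega -> 0 < eps ->
  diag_alg s ft -> star ft = ft -> nrm (ft - level s N (fun w => (c w)%:C)) <= e ->
  exists2 W : R, 0 <= W & forall n,
    (ncZ theta ft Omega eps n <= (W * expR (n.+1%:R * e) * Zsum p N c n)%:E)%E.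
Proof.
move=> Of e0 hft fsa fe.
have [k k0 hk] := cpa_exists Lrow Lfin sF sgen s1 tauP p Of e0.
exists (\sum_(m <- box r k) (size (wds L (dconst r k + m)))%:R).
  by apply: sumr_ge0 => m _.
move=> n; set a := p *+ n + N.
have [tr [trC trE]] := mxC_trace R (size (words_list L (translated_box (a + dconst r k) k))).
apply: le_trans (ereal_inf_lbound _) _.
  exists (mxC (cplx R) _), (cpa_up s (a + dconst r k) k), (cpa_down s tau (a + dconst r k) k), tr.
  by split; [apply: hk; exact: le_deg_addr| |reflexivity].
rewrite lee_fin; apply: le_trans (compress_orbit_exp trE hft fsa fe _ _) _.
- exact/word_enum_inj/translated_box_uniq.
- move=> i; apply: le_deg_trans (translated_box_ge (word_enum_shape Lrow Lfin i)).
  exact: le_deg_addr.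
rewrite -mulrA mulrCA ler_wpM2l ?expR_ge0//.
rewrite (word_enum_sum _ (fun w => expR (itsum p N c n w))) big_map mulr_suml.
apply: ler_sum => m _; rewrite -addrA.
apply: le_trans (words_sum_le _ _ (fun u => expR_ge0 (itsum p N c n u))).
rewrite big_seq [leRHS]big_seq; apply: ler_sum => w; rewrite (wdsP Lrow Lfin) => /eqP wm.
have aw : le_deg a (kshape w) by rewrite wm le_deg_addr.
have := itsum_kmul (p := p) (N := N) c (n := n) (trm_hd aw).
by rewrite shape_hd// hd_tl// => ->//; exact: le_deg_refl.
Qed.

End TraceUpperBound.

(** * Lower bound for the noncommutative partition function *)

Section Blocks.
Variables (r : nat) (L : kGraph r).
Implicit Types (u v w : L) (a b m : deg r).

Lemma hd_kmul_le b u v : trm u = org v -> le_deg b (kshape u) ->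
  hd b (kmul u v) = hd b u.
Proof.
move=> uv bu; have [h1 h2 h3] := facP bu.
have tv : trm (tl b u) = org v by rewrite trm_tl.
rewrite {1}h3 -kmulA// -{1}h1 hd_kmul// org_mul//.
Qed.

Lemma hd_sub a b m w : le_deg (a + (b + m)) (kshape w) ->
  hd b (sub a (b + m) w) = sub a b w.
Proof.
move=> h; have ha := le_deg_trans (le_deg_addr _ _) h.
have ht : le_deg (b + m) (kshape (tl a w)) by rewrite -(le_deg_add2l a) shape_tl.
have [h1 h2 h3] := facP ht.
by rewrite /sub {2}h3 hd_kmul_le// h1 le_deg_addr.
Qed.

Lemma hd_add a b w : le_deg (a + b) (kshape w) ->
  hd (a + b) w = kmul (hd a w) (sub a b w).
Proof.
move=> h; have ha := le_deg_trans (le_deg_addr _ _) h.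
have [h1 h2 h3] := facP ha.
have hb : le_deg b (kshape (tl a w)) by rewrite -(le_deg_add2l a) shape_tl.
have [g1 g2 g3] := facP hb.
have E : trm (hd a w) = org (sub a b w) by rewrite h2 /sub org_hd.
rewrite {1}h3 g3 kmulA//.
have -> : a + b = kshape (kmul (hd a w) (hd b (tl a w))).
  by rewrite shape_mul// h1 g1.
by rewrite hd_kmul// trm_mul.
Qed.

Lemma hd_full w : hd (kshape w) w = w.
Proof. by have := hd_kmul (esym (org_trm w)); rewrite kmul1r. Qed.

(** Consecutive blocks start p l apart and overlap by N. Their heads of shape p l are concatenated
    to prefixes of w, and the last block is used whole; the prefix of shape 0 is the origin of the
    first block. *)
Lemma blocks_inj p N (l m : nat) w w' : kshape w = p *+ (m.+1 * l) + N ->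
  kshape w' = p *+ (m.+1 * l) + N ->
  (forall k, (k < m.+1)%N -> sub (p *+ (k * l)) (p *+ l + N) w = sub (p *+ (k * l)) (p *+ l + N) w') ->
  w = w'.
Proof.
move=> sw sw' h.
have bnd k : (k < m.+1)%N -> le_deg (p *+ (k * l) + (p *+ l + N)) (p *+ (m.+1 * l) + N).
  move=> km; rewrite addrA -mulrnDr -mulSnr; apply: le_degD.
  by apply: mulrn_le_deg; rewrite leq_mul2r km orbT.
have H k : (k <= m)%N -> hd (p *+ (k * l)) w = hd (p *+ (k * l)) w'.
  elim: k => [_|k ih km].
    have := h 0%N isT; rewrite mul0n mulr0n => h0.
    have b0 := bnd 0%N isT; rewrite mul0n mulr0n in b0.
    have e z : kshape z = p *+ (m.+1 * l) + N -> hd 0 z = org (sub 0 (p *+ l + N) z).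
      move=> sz; rewrite -sz in b0.
      have z0 : le_deg 0 (kshape z) by exact: le0_deg.
      rewrite /sub org_hd; last by rewrite -(le_deg_add2l 0) shape_tl.
      by rewrite -trm_hd// trm_id// shape_hd.
    by rewrite !e// h0.
  have kl : (k < m.+1)%N by rewrite ltnS ltnW.
  have bk := bnd k kl.
  have bk' : le_deg (p *+ (k * l) + p *+ l) (p *+ (m.+1 * l) + N).
    by apply: le_deg_trans bk; rewrite addrA le_deg_addr.
  rewrite mulSnr mulrnDr !hd_add ?sw ?sw'// ih; last exact: ltnW.
  by rewrite -(@hd_sub _ _ N) ?sw// -(@hd_sub _ _ N w') ?sw'// h.
have bm := bnd m (ltnSn m).
have E : kshape w = p *+ (m * l) + (p *+ l + N) by rewrite sw mulSnr mulrnDr addrA.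
have E' : kshape w' = p *+ (m * l) + (p *+ l + N) by rewrite sw' mulSnr mulrnDr addrA.
rewrite -(hd_full w) -(hd_full w') E E' !hd_add ?E ?E' ?le_deg_refl//.
by rewrite H// h.
Qed.

End Blocks.

Lemma psd_effect (R : realType) (A : cStarAlgType R) (x : A) :
  psd x -> psd (1 - x) -> psd (x - x * x).
Proof.
move=> p1 p2; have -> : x - x * x = x * (1 - x) by rewrite mulrBr mulr1.
by apply: psdM => //; rewrite mulrBr mulrBl mulr1 mul1r.
Qed.

Section TraceLowerBound.
Variables (R : realType) (r : nat) (L : kGraph r).
Hypotheses (Lrow : row_finite L) (Lfin : finite_set (objects L)) (Lsrc : no_sources L).
Variables (O : cStarAlgType R) (s : L -> O).
Hypotheses (sF : graph_family s) (sgen : cstar_gen (range s) = setT).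
Hypothesis s1 : forall u, nrm (s u) = 1.
Variable p : deg r.
Variable tau : L -> O -> R[i].
Hypothesis tauP : forall c, objects L c ->
  [/\ pos_functional (tau c), tau c (s c) = 1, forall b, nc (tau c b) <= nrm b &
    forall u v, kshape u != kshape v -> tau c (s u * star (s v)) = 0].
Implicit Types (u v w : L) (a m A B N : deg r) (Y : O) (n k j : nat).
Local Notation theta := (canonical_shift s p).

(** Without sources every word has an extension by shape m. *)
Lemma words_sum_ge (G : L -> R) a m : (forall u, 0 <= G u) ->
  \sum_(u <- wds L a) G u <= \sum_(w <- wds L (a + m)) G (hd a w).
Proof.
move=> G0.
have -> : \sum_(w <- wds L (a + m)) G (hd a w) =
    \sum_(x <- [seq (hd a w, tl a w) | w <- wds L (a + m)]) G x.1 by rewrite big_map.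
rewrite -(perm_big _ (fac_perm Lrow Lfin a m)) big_filter [leRHS]big_mkcond.
rewrite big_allpairs_dep /=; apply: ler_sum => u _.
have [v [vm vu]] := Lsrc m (trm_obj u).
have vin : v \in wds L m by rewrite (wdsP Lrow Lfin) vm.
rewrite (big_rem _ vin)/= vu eqxx lerDl; apply: sumr_ge0 => v' _.
by case: ifP.
Qed.

Definition state_at w (b : O) : R[i] := tau (trm w) (star (s w) * b * s w).

Lemma state_at_pos w : pos_functional (state_at w).
Proof.
have [[tl tp] _ _ _] := tauP (trm_obj w); split.
  move=> z a b; rewrite /state_at mulrDr mulrDl -scalerAre -scalerAle.
  exact: tl.
move=> y; rewrite /state_at.
have -> : star (s w) * (star y * y) * s w = star (y * s w) * (y * s w).
  by rewrite starM !mulrA.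
exact: tp.
Qed.

Lemma state_at_nrm w b : nc (state_at w b) <= nrm b.
Proof.
have [_ _ tn _] := tauP (trm_obj w).
exact: le_trans (tn _) (compress_nrm s1 _ _).
Qed.

Lemma state_at_eigen w Y (la : R[i]) : Y * s w = la *: s w -> state_at w Y = la.
Proof.
move=> h; have [/pos_functional_lin tl t1 _ _] := tauP (trm_obj w).
rewrite /state_at -mulrA h -scalerAre (star_s sF) (linf_Z tl) t1.
exact: mulr1.
Qed.

Lemma Re_le_nc (z : R[i]) : complex.Re z <= nc z.
Proof.
case: z => a b; rewrite /nc /= (le_trans (ler_norm _))//.
by rewrite -sqrtr_sqr ler_sqrt ?lerDl ?sqr_ge0 ?addr_ge0 ?sqr_ge0.
Qed.

(* A word [w] gives the functional [a |-> tau (s_w^* phi(a) s_w)] on the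
   finite-dimensional algebra, and [psi (Phi^(k l) (chi v))] decodes from it the
   [k]-th block of [w]. *)
Lemma ncZ_lower (ft : O) (c : L -> R) N e (l : nat) (eps : R) :
  star ft = ft -> nrm (ft - level s N (fun w => (c w)%:C)) <= e ->
  (0 < l)%N -> 0 < eps -> eps <= 1 ->
  exists2 Omega : set O, finite_set Omega & forall n,
    ((Zsum p N c n * expR (- (n.+1%:R * (e + eps) +
        (n %/ l).+1%:R * loss (size (wds L (p *+ l + N))) eps)))%:E <=
     ncZ theta ft Omega eps n)%E.
Proof.
move=> fsa fe l0 e0 e1; set q := p *+ l + N.
exists (ft |` (chi s @` [set` wds L q])) => [|n].
  by rewrite finite_setU; split; [exact: finite_set1|apply: finite_image; exact: finite_fset].
apply: le_ereal_inf_tmp => _ [C [phi [psi [tr [[Cfd phiU psiU hcpa] trC ->]]]]].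
(* m blocks of length l reach time n, and the last one begins at (m - 1) l <= n, so all measured
   elements lie in the orbit. *)
rewrite lee_fin; set m := (n %/ l).+1.
have nm : (n <= m * l)%N by rewrite ltnW// ltn_ceil.
pose T : finType := wds L (p *+ (m * l) + N).
pose I : finType := wds L q.
have Tsh (w : T) : kshape (val w) = p *+ (m * l) + N.
  by apply/eqP; rewrite -(wdsP Lrow Lfin) (valP w).
have blk k (w : T) : (k < m)%N -> le_deg (p *+ (k * l) + q) (kshape (val w)).
  move=> km; rewrite Tsh /q addrA -mulrnDr -mulSnr; apply: le_degD.
  by apply: mulrn_le_deg; rewrite leq_mul2r km orbT.
have blkn k : (k < m)%N -> (k * l <= n)%N.
  by rewrite ltnS => km; rewrite (leq_trans (leq_mul km (leqnn l)))// leq_divM.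
have subI k (w : T) : (k < m)%N -> sub (p *+ (k * l)) q (val w) \in wds L q.
  move=> km; rewrite (wdsP Lrow Lfin) /sub shape_hd//.
  have h := blk k w km; have h' := le_deg_trans (le_deg_addr _ _) h.
  by rewrite -(le_deg_add2l (p *+ (k * l))) shape_tl.
have [I0|[i0 _]] := set_0Vmem [set: I]%SET.
  have T0 (w : T) : False.
    by have := finset.in_setT [` subI 0%N w isT]%fset; rewrite I0 inE.
  have -> : Zsum p N c n = 0.
    rewrite /Zsum big_seq big1// => u; rewrite (wdsP Lrow Lfin) => /eqP un.
    have [v [vm vu]] := Lsrc (p *+ (m * l - n)) (trm_obj u).
    exfalso; have win : kmul u v \in wds L (p *+ (m * l) + N).
      by rewrite (wdsP Lrow Lfin) shape_mul// un vm addrAC -mulrnDr subnKC.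
    exact: (T0 [` win]%fset).
  (* Without blocks Z(n) = 0, and only nonnegativity of the trace is left: [trace_exp_lower] for
     empty families. *)
  rewrite mul0r; have H := trace_exp_lower Cfd trC (I := void) (T := void)
    (om := fun=> fun=> 0) (b := fun=> fun=> 0) (lab := fun=> id) (eps := 1) (m := 0)
    (S := fun=> 0) (kap := 0) (h := psi (orbit_sum theta ft n)).
  have : \sum_(w : void) expR (0 : R) = 0 by rewrite big1// => -[].
  move=> E; move: H; rewrite E mul0r; apply=> //; try by case.
  exact: (pos_unital_sa (ucp_pos_unital psiU) (orbit_sum_sa Lrow Lfin sF sgen p _ fsa)).
pose om (w : T) x := (expR (itsum p N c n (val w)))%:C * state_at (val w) (phi x).
have phiP := ucp_pos_unital phiU; have psiP := ucp_pos_unital psiU.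
have [phil phi1 _] := phiP; have [psil psi1 _] := psiP.
have stl (w : T) := pos_functional_lin (state_at_pos (val w)).
have omP (w : T) : pos_functional (om w).
  split=> [z x y|y]; rewrite /om.
    by rewrite phil (linf_D (stl w)) (linf_Z (stl w)) mulrDr /GRing.scale /= mulrCA.
  rewrite mulr_ge0//; first by rewrite lecR expR_ge0.
  apply: (pos_functional_psd (state_at_pos _)).
  by have [_ _ pp] := phiP; exact: pp.
have st1 (w : T) : state_at (val w) 1 = 1.
  by apply: state_at_eigen; rewrite mul1r scale1r.
have omRe (w : T) x : complex.Re (om w x) =
    expR (itsum p N c n (val w)) * complex.Re (state_at (val w) (phi x)).
  by rewrite /om; case: (state_at _ _) => a b /=; rewrite mul0r subr0.
have om1 (w : T) : complex.Re (om w 1) = expR (itsum p N c n (val w)).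
  by rewrite omRe phi1 st1 mulr1.
pose b k (i : I) := psi (iter (k * l)%N theta (chi s (val i))).
have chiP v : psd (chi s v) /\ psd (1 - chi s v).
  split; first exact: s_psd.
  have cc : chi s v * chi s v = chi s v by rewrite /chi mulrA (s_partial sF).
  have := psd_starM (1 - chi s v); rewrite starB star1 star_chi.
  by rewrite mulrBl mul1r mulrBr mulr1 cc subrr subr0.
pose lab k (w : T) : I := insubd i0 (sub (p *+ (k * l)) q (val w)).
have labE k (w : T) : (k < m)%N -> val (lab k w) = sub (p *+ (k * l)) q (val w).
  by move=> km; rewrite val_insubd subI.
have chi_st k (w : T) : (k < m)%N ->
    state_at (val w) (iter (k * l)%N theta (chi s (val (lab k w)))) = 1.
  move=> km; have bk := blk k w km.
  pose g v : R[i] := (v == val (lab k w))%:R.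
  have -> : chi s (val (lab k w)) = level s q g.
    have vin := valP (lab k w).
    rewrite /level (big_rem _ vin)/= /g eqxx scale1r big_seq big1 ?addr0// => v.
    by rewrite mem_rem_uniq ?fset_uniq// inE => /andP[/negbTE -> _]; rewrite scale0r.
  apply: state_at_eigen; rewrite (theta_level_s Lrow Lfin sF sgen)//.
  by rewrite /g labE// eqxx.
have dec k : (k < m)%N -> decoder om b lab eps k.
  move=> km; have tP := theta_iter_pos Lrow Lfin sF sgen p (k * l).
  have [tl t1 _] := tP.
  have bp i : psd (b k i).
    by apply: (pos_unital_psd psiP); apply: (pos_unital_psd tP); case: (chiP (val i)).
  split=> [|i||w]; first exact: bp.
  - apply: psd_effect => //; rewrite /b -psi1 -(linf_B psil).
    apply: (pos_unital_psd psiP); rewrite -t1 -(linf_B tl).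
    by apply: (pos_unital_psd tP); case: (chiP (val i)).
  - rewrite /b -(linf_sum psil) -(linf_sum tl).
    rewrite -(big_seq_fsetE _ (wds L q) predT (chi s)) (s_unit Lrow Lfin sF sgen).
    by rewrite t1 psi1.
  - rewrite om1 omRe mulrC ler_wpM2r ?expR_ge0//.
    rewrite (linf_B phil) phi1 (linf_B (stl w)) st1 -(chi_st k w km) -(linf_B (stl w)).
    apply: le_trans (Re_le_nc _) _; apply: le_trans (state_at_nrm _ _) _.
    have hO : orbit_set theta (ft |` (chi s @` [set` wds L q])) n
        (iter (k * l)%N theta (chi s (val (lab k w)))).
      exists (k * l)%N; first exact: blkn.
      exists (chi s (val (lab k w))) => //; right; exists (val (lab k w)) => //=.
    by rewrite nrm_distC; apply: ltW; have := hcpa _ hO; rewrite nrmE ltcR.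
have labinj (w w' : T) : (forall k, (k < m)%N -> lab k w = lab k w') -> w = w'.
  move=> h; apply/val_inj/(@blocks_inj _ _ p N l (n %/ l)); rewrite ?Tsh// => k km.
  by rewrite -!labE// h.
have hsa : star (psi (orbit_sum theta ft n)) = psi (orbit_sum theta ft n).
  exact: (pos_unital_sa psiP (orbit_sum_sa Lrow Lfin sF sgen p _ fsa)).
have hkap (w : T) : expR (itsum p N c n (val w)) * (itsum p N c n (val w) - n.+1%:R * (e + eps)) <=
    complex.Re (om w (psi (orbit_sum theta ft n))).
  rewrite omRe ler_wpM2l ?expR_ge0//.
  set H' := orbit_sum theta (level s N (fun w => (c w)%:C)) n.
  have nw : le_deg (p *+ n + N) (kshape (val w)).
    by rewrite Tsh; apply: le_degD; exact: mulrn_le_deg.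
  have E : state_at (val w) H' = (itsum p N c n (val w))%:C.
    by apply: state_at_eigen; rewrite (orbit_level_s Lrow Lfin sF sgen).
  set X := phi _.
  rewrite -[itsum _ _ _ _ _]/(complex.Re (itsum p N c n (val w))%:C) -E lerBlDl -lerBlDr.
  have -> : complex.Re (state_at (val w) H') - complex.Re (state_at (val w) X) =
      complex.Re (state_at (val w) (H' - X)).
    by rewrite (linf_B (stl w)); case: (state_at _ H') => ? ?; case: (state_at _ X).
  apply: le_trans (Re_le_nc _) _; apply: le_trans (state_at_nrm _ _) _.
  have lsa : star (level s N (fun w => (c w)%:C)) = level s N (fun w => (c w)%:C).
    by rewrite star_level; apply: eq_bigr => v _; rewrite conjc_real.
  have d1 := orbit_sum_dist Lrow Lfin sF sgen p n fsa lsa fe.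
  rewrite nrm_distC; apply: le_trans (nrm_dist_add (orbit_sum theta ft n) _ _) _.
  rewrite mulrDr addrC lerD//.
  rewrite /X /orbit_sum (linf_sum psil) (linf_sum phil) -sumrB (le_trans (nrm_sum _ _ _))//.
  rewrite -[n.+1 in leRHS]card_ord mulr_natl -sumr_const ler_sum// => j _.
  apply: ltW; rewrite -ltcR -nrmE; apply: hcpa; exists j; first by rewrite /= -ltnS.
  by exists ft => //; left.
apply: le_trans (trace_exp_lower Cfd trC omP e0 e1 dec labinj om1 hsa hkap).
rewrite -cardfE ler_wpM2r ?expR_ge0//.
rewrite -(big_seq_fsetE _ (wds L (p *+ (m * l) + N)) predT (fun w => expR (itsum p N c n w))) /=.
(* The words of T extend those of shape p n + N and have the same sum along the times 0, ..., n. *)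
apply: le_trans (words_sum_ge _ (p *+ (m * l - n)) (fun u => expR_ge0 (itsum p N c n u))) _.
have -> : p *+ n + N + p *+ (m * l - n) = p *+ (m * l) + N.
  by rewrite addrAC -mulrnDr subnKC.
rewrite big_seq [leRHS]big_seq; apply: ler_sum => w; rewrite (wdsP Lrow Lfin) => /eqP wm.
have aw : le_deg (p *+ n + N) (kshape w).
  by rewrite wm; apply: le_degD; exact: mulrn_le_deg.
have := itsum_kmul (p := p) (N := N) c (n := n) (trm_hd aw).
by rewrite shape_hd// hd_tl// => ->//; exact: le_deg_refl.
Qed.

End TraceLowerBound.

Lemma sum_cover_le (R : realType) (X Y : choiceType) (W : {fset X}) (F : {fset Y})
    (g : Y -> X) (G : X -> R) :
  (forall w, 0 <= G w) -> (forall w, w \in W -> exists2 y, y \in F & g y = w) ->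
  \sum_(w <- W) G w <= \sum_(y <- F) G (g y).
Proof.
move=> G0 h.
apply: (@le_trans _ _ (\sum_(w <- W) \sum_(y <- F) if g y == w then G w else 0)).
  rewrite big_seq [leRHS]big_seq; apply: ler_sum => w /h[y yF gy].
  rewrite (big_rem _ yF)/= gy eqxx lerDl; apply: sumr_ge0 => z _.
  by case: ifP.
rewrite exchange_big /=; apply: ler_sum => y _.
have [gW|gW] := boolP (g y \in W).
  rewrite (big_rem _ gW)/= eqxx gerDl big_seq big1// => w.
  by rewrite mem_rem_uniq ?fset_uniq// inE eq_sym => /andP[/negbTE -> _].
rewrite big_seq big1// => w wW; case: eqP => // E.
by move: gW; rewrite E wW.
Qed.

(** * Comparison with the topological pressure *)

Section PathSums.
Variables (R : realType) (r : nat) (L : kGraph r).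
Hypotheses (Lrow : row_finite L) (Lfin : finite_set (objects L)) (Lsrc : no_sources L).
Hypothesis cyl : forall u : L, exists x, sg x 0 (kshape u) = u.
Variables (p N : deg r) (c : L -> R).
Implicit Types (u v w : L) (x y : infpath L) (n : nat).
Local Notation T := (path_shift p).
Local Notation Z := (Zsum p N c).
Local Notation S := (itsum p N c).

Let bnd : R := \sum_(w <- wds L N) `|c w|.

Let bndP w : kshape w = N -> `|c w| <= bnd.
Proof.
move=> wN; have win : w \in wds L N by rewrite (wdsP Lrow Lfin) wN.
by rewrite /bnd (big_rem _ win)/= lerDl; apply: sumr_ge0.
Qed.

Lemma itsumS n w : kshape w = p *+ n.+1 + N ->
  `|S n.+1 w - S n (hd (p *+ n + N) w)| <= bnd.
Proof.
move=> wn; have aw : le_deg (p *+ n + N) (kshape w).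
  by rewrite wn; apply: le_degD; exact: mulrn_le_deg.
have := itsum_kmul (p := p) (N := N) c (n := n) (trm_hd aw).
rewrite shape_hd// hd_tl// => <-; last exact: le_deg_refl.
rewrite /itsum big_ord_recr /= addrAC subrr add0r; apply: bndP.
rewrite /sub shape_hd// -(le_deg_add2l (p *+ n.+1)) shape_tl ?wn ?le_deg_refl//.
exact: le_deg_addr.
Qed.

(** With [ZsumS_ge], this absorbs the difference of one between the two conventions for the number
    of terms. *)
Lemma ZsumS_le n : Z n.+1 <= (size (wds L p))%:R * expR bnd * Z n.
Proof.
have E : p *+ n.+1 + N = p *+ n + N + p by rewrite mulrSr addrAC.
rewrite mulrAC [leRHS]mulrC.
apply: le_trans (ler_wpM2l (expR_ge0 bnd) (words_sum_le Lrow Lfin _ _ (fun u => expR_ge0 (S n u)))).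
rewrite mulr_sumr /Zsum -E big_seq [leRHS]big_seq; apply: ler_sum => w.
rewrite (wdsP Lrow Lfin) => /eqP /itsumS h.
by rewrite -expRD ler_expR -lerBlDr (le_trans (ler_norm _)).
Qed.

Lemma ZsumS_ge n : Z n <= expR bnd * Z n.+1.
Proof.
have E : p *+ n.+1 + N = p *+ n + N + p by rewrite mulrSr addrAC.
apply: le_trans (words_sum_ge Lrow Lfin Lsrc _ p (fun u => expR_ge0 (S n u))) _.
rewrite mulr_sumr /Zsum -E big_seq [leRHS]big_seq; apply: ler_sum => w.
rewrite (wdsP Lrow Lfin) => /eqP /itsumS h.
by rewrite -expRD ler_expR -lerBlDr (le_trans (ler_norm _))// distrC.
Qed.

Variables (f : infpath L -> R) (e : R).
Hypothesis fc : forall x, `|f x - c (sg x 0 N)| <= e.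

Lemma birkhoff_itsum n x :
  `|birkhoff_sum f T n.+1 x - S n (sg x 0 (p *+ n + N))| <= n.+1%:R * e.
Proof.
rewrite /birkhoff_sum /itsum -sumrB (le_trans (ler_norm_sum _ _ _))//.
rewrite -[n.+1 in leRHS]card_ord mulr_natl -sumr_const ler_sum// => j _.
have h : le_deg (p *+ j + N) (p *+ n + N).
  by apply: le_degD; apply: mulrn_le_deg; rewrite -ltnS.
rewrite sub_sg// [_ + N]addrC -{1}[p *+ j]add0r -sg_iter_shift//.
exact: le0_deg.
Qed.

Variable d : infpath L -> infpath L -> R.
Hypothesis dP : compatible_metric d.

(** One point of each cylinder of shape p n + N gives a spanning set. *)
Lemma topQ_le_Zsum n (ep : R) : 0 < ep ->
  (forall x y, sg x 0 N = sg y 0 N -> d x y <= ep) ->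
  (topQ d f T n.+1 ep <= (expR (n.+1%:R * e) * Z n)%:E)%E.
Proof.
move=> ep0 hN; set a := p *+ n + N.
have [X hX] := choice cyl.
apply: le_trans (ereal_inf_lbound _) _.
  exists (X @` [set` wds L a]); last reflexivity.
  split=> [|x]; first by apply: finite_image; exact: finite_fset.
  have win : sg x 0 a \in wds L a by rewrite (wdsP Lrow Lfin) sg_shape0.
  exists (X (sg x 0 a)); first by exists (sg x 0 a).
  move=> i ni; apply: hN; rewrite !sg_iter_shift ?le0_deg//.
  apply: (@sg_agree _ _ _ _ a).
  - by have := hX (sg x 0 a); rewrite sg_shape0 => ->.
  - by rewrite add0r addrC le_deg_addr.
  - by rewrite addrC; apply: le_degD; apply: mulrn_le_deg; rewrite -ltnS.
have fF : finite_set (X @` [set` wds L a]) by apply: finite_image; exact: finite_fset.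
rewrite lee_fin fsbig_finite//=.
have cov x : x \in fset_set (X @` [set` wds L a]) -> exists2 w, w \in wds L a & X w = x.
  by rewrite in_fset_set// => /set_mem[w /= win <-]; exists w.
apply: le_trans (sum_cover_le (fun x => expR_ge0 (birkhoff_sum f T n.+1 x)) cov) _.
rewrite mulr_sumr big_seq [leRHS]big_seq; apply: ler_sum => w.
rewrite (wdsP Lrow Lfin) => /eqP wa.
rewrite -expRD ler_expR -lerBlDr (le_trans (ler_norm _))//.
have := birkhoff_itsum n (X w).
by rewrite -/a -wa hX.
Qed.

(** A point of F that stays within ep of x shares with it the segments of shape N at the times 0,
    ..., n. As N = p + N0, these leave no gap and determine the prefix of shape p n + N by
    [blocks_inj] with l = 1; so the prefixes of F are all words of this shape. *)
Lemma Zsum_le_topQ n (ep : R) N0 : N = p + N0 ->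
  (forall x y, d x y <= ep -> sg x 0 N = sg y 0 N) ->
  ((Z n * expR (- (n.+1%:R * e)))%:E <= topQ d f T n.+1 ep)%E.
Proof.
move=> NE hN; set a := p *+ n + N.
apply: le_ereal_inf_tmp => _ [F [Ffin Fspan] <-].
rewrite lee_fin fsbig_finite//=.
rewrite -[in expR (- _)]mulrN.
rewrite -ler_pdivlMr ?expR_gt0// -expRN mulrN opprK mulr_suml.
have cov w : w \in wds L a -> exists2 y, y \in fset_set F & sg y 0 a = w.
  rewrite (wdsP Lrow Lfin) => /eqP wa.
  have [x hx] := cyl w; have [y Fy hy] := Fspan x.
  exists y; first by rewrite in_fset_set//; exact: mem_set.
  rewrite -hx wa; apply/esym.
  have aE : a = p *+ (n.+1 * 1) + N0 by rewrite muln1 mulrSr -addrA -NE.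
  apply: (@blocks_inj _ _ p N0 1 n); rewrite ?sg_shape0// => k kn.
  have h : le_deg (p *+ k + N) a by apply: le_degD; apply: mulrn_le_deg; rewrite -ltnS.
  rewrite muln1 mulr1n -NE !sub_sg//.
  have := hN _ _ (hy k kn); rewrite !sg_iter_shift ?le0_deg// add0r.
  by rewrite addrC.
apply: le_trans (sum_cover_le (fun w => expR_ge0 (S n w)) cov) _.
apply: ler_sum => x _.
rewrite -expRD ler_expR -lerBlDl (le_trans (ler_norm _))// distrC.
exact: birkhoff_itsum.
Qed.

End PathSums.

(** * Exponential growth rates *)

Section GrowthRates.
Variable R : realType.
Local Open Scope ereal_scope.

Definition rate (x : nat -> \bar R) : \bar R :=
  limn_esup (fun n => (n%:R^-1)%:E * lne (x n)).

Lemma lne_le (x y : \bar R) : x <= y -> lne x <= lne y.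
Proof.
move=> xy; have [x0|x0] := leP x 0; first by rewrite le0_lneNy// leNye.
by rewrite lee_lne// in_itv /= leey andbT ltW// (lt_le_trans x0).
Qed.

Lemma lne_exp_le (x y : \bar R) (g : R) : 0 <= y -> x <= (expR g)%:E * y ->
  lne x <= g%:E + lne y.
Proof.
move=> y0 xy; have [x0|x0] := leP x 0; first by rewrite le0_lneNy// leNye.
have {}y0 : 0 < y.
  rewrite lt_neqAle y0 andbT; apply/eqP => yE.
  by move: xy; rewrite -yE mule0 leNgt x0.
have e0 : 0 < (expR g)%:E by rewrite lte_fin expR_gt0.
have i0 (z : \bar R) : 0 < z -> z \in `]0, +oo].
  by move=> z0; rewrite in_itv /= z0 leey.
apply: le_trans (lne_le xy) _; rewrite lneM; [|exact: i0|exact: i0].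
by rewrite lne_EFin ?expR_gt0// expRK.
Qed.

Lemma rate_le (x y : nat -> \bar R) (g : R) (n0 : nat) : (forall n, 0 <= y n) ->
  (forall n, (n0 <= n)%N -> x n <= (expR (g * n%:R))%:E * y n) ->
  rate x <= g%:E + rate y.
Proof.
move=> y0 xy; rewrite -leeBlDl//; apply: le_ereal_inf_tmp => _ [A [M _ MA] <-].
rewrite leeBlDl//.
pose B := [set n : nat | (maxn (maxn n0 1) M <= n)%N].
apply: le_trans (ereal_inf_lbound _) _.
  by exists B; [exists (maxn (maxn n0 1) M)|reflexivity].
apply: ge_ereal_sup => _ [n Bn <-]; move: Bn; rewrite /B /= !geq_max => /andP[/andP[nn0 n1] nM].
have nr : (n%:R != 0 :> R)%R by rewrite pnatr_eq0 -lt0n.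
apply: (@le_trans _ _ (g%:E + (n%:R^-1)%:E * lne (y n))); last first.
  by rewrite leeD2l// ereal_sup_ubound//; exists n => //; exact: MA.
have -> : g%:E = (n%:R^-1)%:E * (g * n%:R)%:E :> \bar R.
  by rewrite -EFinM mulrCA mulVf// mulr1.
rewrite -muleDr ?fin_num_adde_defr//.
by rewrite lee_wpmul2l ?lee_fin ?invr_ge0// lne_exp_le// xy.
Qed.

Lemma le_rate (x y : nat -> \bar R) : (forall n, x n <= y n) -> rate x <= rate y.
Proof.
move=> xy; apply: le_ereal_inf_tmp => _ [A hA <-].
apply: le_trans (ereal_inf_lbound _) _; first by exists A.
apply: ge_ereal_sup => _ [n An <-].
apply: (@le_trans _ _ ((n%:R^-1)%:E * lne (y n))).
  by rewrite lee_wpmul2l ?lee_fin ?invr_ge0// lne_le.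
by rewrite ereal_sup_ubound//; exists n.
Qed.

Lemma const_le_exp (C e : R) : (0 < e)%R -> exists n0, forall n, (n0 <= n)%N ->
  (C <= expR (e * n%:R))%R.
Proof.
move=> e0; exists (Num.bound (C / e)) => n hn.
apply: le_trans (expR_ge1Dx _); rewrite ler_wpDl//.
rewrite mulrC -ler_pdivrMr//; apply: (@le_trans _ _ (Num.bound (C / e))%:R%R); last by rewrite ler_nat.
have [c0|c0] := leP 0%R (C / e)%R; first exact/ltW/archi_boundP.
by rewrite (le_trans (ltW c0)).
Qed.

End GrowthRates.

Section TopPressure.
Variables (R : realType) (X : choiceType) (d : X -> X -> R) (f : X -> R) (T : X -> X).
Local Open Scope ereal_scope.

Lemma topQ_ge0 (n : nat) (e : R) : 0 <= topQ d f T n e.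
Proof.
apply: le_ereal_inf_tmp => _ [F [Ff _] <-]; rewrite lee_fin fsbig_finite//=.
by apply: sumr_ge0 => x _; exact: expR_ge0.
Qed.

Lemma topQ_mono (n : nat) (e e' : R) : (e <= e')%R -> topQ d f T n e' <= topQ d f T n e.
Proof.
move=> ee; apply: ereal_inf_le_tmp => _ [F [Ff Fs] <-]; exists F => //; split=> // x.
by have [y Fy h] := Fs x; exists y => // i ni; rewrite (le_trans (h i ni)).
Qed.

(** Fewer sets span for a smaller eps, so the rate increases as eps decreases to 0, and the limit is
    a supremum. *)
Lemma top_pressureE :
  top_pressure d f T = ereal_sup [set rate (fun n => topQ d f T n e) | e in [set e | (0 < e)%R]].
Proof.
apply: cvg_lim => //.
have -> : [set e : R | (0 < e)%R] = [set` Interval (BRight 0%R) (BInfty R false)].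
  by apply/seteqP; split=> e /=; rewrite in_itv /= andbT.
apply: nonincreasing_at_right_cvge => // e e' _ _ ee.
by apply: le_rate => n; exact: topQ_mono.
Qed.

End TopPressure.

(** * Choice of the error and of the block length *)

Section LossBound.
Variable R : realType.

Lemma ln_2K_ge0 (K : nat) : 0 <= ln (2 * K%:R : R).
Proof.
case: K => [|K]; first by rewrite mulr0 ln0.
by apply: ln_ge0; rewrite -natrM ler1n muln_gt0.
Qed.

Lemma loss_ge0 (K : nat) (eps : R) : 0 < eps -> eps <= 1 -> 0 <= loss K eps.
Proof.
move=> e0 e1; have := ln_2K_ge0 K; have := ln_le0 e1 => h1 h2.
by rewrite /loss addr_ge0// addr_ge0 ?oppr_ge0// !mulr_ge0// ltW.
Qed.

Let loss_arith (x a b c lk ne el : R) : x * lk <= x * (a + (b + c)) -> x * b <= el ->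
  ne + x * (a + c) + 1 <= el -> ne + x * lk + 1 <= 2 * el.
Proof. by rewrite !mulrDr; lra. Qed.

(** The part of the loss that grows with l is 6 eps l ln P, at most e l by the choice of eps; the
    rest A does not depend on l and is at most e l once l >= A / e. *)
Lemma loss_small (P Q e : R) : 1 <= P -> 1 <= Q -> 0 < e ->
  exists (eps : R) (l : nat), [/\ 0 < eps, eps <= 1, eps <= e, (0 < l)%N &
    forall K : nat, K%:R <= P ^+ l * Q -> loss K eps <= 2 * e * l%:R].
Proof.
move=> P1 Q1 e0; have lP : 0 <= ln P by exact: ln_ge0.
have q0 : 0 < 6 * ln P + 1 by rewrite ltr_wpDl ?mulr_ge0.
pose eps := Num.min 1 (Num.min e (e / (6 * ln P + 1))).
have eps0 : 0 < eps by rewrite !lt_min ltr01 e0 divr_gt0.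
have eps1 : eps <= 1 by rewrite ge_min lexx.
have epse : eps <= e by rewrite !ge_min lexx orbT.
have epsP : 6 * eps * ln P <= e.
  have : eps <= e / (6 * ln P + 1) by rewrite !ge_min lexx !orbT.
  rewrite ler_pdivlMr// => h; apply: le_trans h.
  by rewrite mulrDr mulr1 mulrA [6 * _]mulrC lerDl ltW.
pose A := - ln eps + 6 * eps * (ln 2 + ln Q) + 1.
exists eps, (Num.bound (A / e)).+1; set l := (Num.bound _).+1; split=> // K hK.
have Al : A <= e * l%:R.
  rewrite mulrC -ler_pdivrMr//; apply: (@le_trans _ _ (Num.bound (A / e))%:R); last by rewrite ler_nat.
  have [c0|c0] := leP 0 (A / e); first exact/ltW/archi_boundP.
  by rewrite (le_trans (ltW c0)).
have P0 : 0 < P by exact: lt_le_trans P1.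
have Q0 : 0 < Q by exact: lt_le_trans Q1.
have lK : ln (2 * K%:R) <= ln 2 + (ln P *+ l + ln Q).
  case: K hK => [_|K hK].
    by rewrite mulr0 ln0// addr_ge0 ?ln_ge0 ?ler1n// addr_ge0 ?mulrn_wge0 ?ln_ge0.
  have Pl0 : 0 < P ^+ l by exact: exprn_gt0.
  have PQ : 0 < P ^+ l * Q by exact: mulr_gt0.
  have -> : ln 2 + (ln P *+ l + ln Q) = ln (2 * (P ^+ l * Q)).
    by rewrite -lnXn// [RHS]lnM ?posrE// [in RHS]lnM ?posrE.
  have K0 : 0 < 2 * K.+1%:R :> R by rewrite mulr_gt0// ltr0n.
  have PQ0 : 0 < 2 * (P ^+ l * Q) by exact: mulr_gt0.
  by rewrite ler_ln ?posrE//; exact: ler_wpM2l.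
have e6 : 0 <= 6 * eps by rewrite mulr_ge0// ltW.
have h1 := ler_wpM2l e6 lK.
have h2 : 6 * eps * (ln P *+ l) <= e * l%:R by rewrite -[ln P *+ l]mulr_natr mulrA ler_wpM2r.
by rewrite /loss -(mulrA 2 e); exact: loss_arith h1 h2 Al.
Qed.

End LossBound.

(** * The two inequalities *)

Section Assembly.
Variables (R : realType) (r : nat) (L : kGraph r).
Hypotheses (Lrow : row_finite L) (Lfin : finite_set (objects L)).
Hypotheses (Lsrc : no_sources L) (Laper : aperiodic L).
Variables (O : cStarAlgType R) (s : L -> O).
Hypotheses (sF : graph_family s) (sgen : cstar_gen (range s) = setT).
Variable kappa : O -> infpath L -> R[i]^o.
Hypothesis kappaP : diagonal_iso s kappa.
Variable d : infpath L -> infpath L -> R.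
Hypothesis dP : compatible_metric d.
Variables (ft : O) (f : infpath L -> R) (p : deg r).
Hypotheses (ftC : diag_alg s ft) (ftsa : star ft = ft).
Hypothesis ftf : forall x, kappa ft x = (f x)%:C.
Local Notation theta := (canonical_shift s p).
Local Notation T := (path_shift p).

Let s1 (u : L) : nrm (s u) = 1 := nrm_s Laper sF kappaP u.

Let cyl (u : L) : exists x, sg x 0 (kshape u) = u := cylinder_nonempty Laper sF kappaP u.

Lemma object_states : exists tau : L -> O -> R[i], forall c, objects L c ->
  [/\ pos_functional (tau c), tau c (s c) = 1, forall b, nc (tau c b) <= nrm b &
    forall u v : L, kshape u != kshape v -> tau c (s u * star (s v)) = 0].
Proof.
suff H c : exists t : O -> R[i], objects L c -> [/\ pos_functional t, t (s c) = 1,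
    forall b, nc (t b) <= nrm b &
    forall u v : L, kshape u != kshape v -> t (s u * star (s v)) = 0].
  by have [tau h] := choice H; exists tau.
have [co|nco] := pselect (objects L c); last by exists (fun=> 0).
have [x [xc xap]] := Laper co.
have [tau [h1 h2 h3 h4]] := aperiodic_state Lrow Lfin sF sgen s1 xap.
exists tau => _; split=> //.
suff <- : sg x 0 0 = c by [].
by rewrite -xc /origin -(sgE x (le_deg_refl 0)) org_id// sg_shape0.
Qed.

(** The successors keep both factors at least 1, as [loss_small] demands. *)
Lemma size_words_le N (l : nat) :
  (size (wds L (p *+ l + N)))%:R <= ((size (wds L p)).+1%:R) ^+ l * (size (wds L N)).+1%:R :> R.
Proof.
elim: l => [|l ih]; first by rewrite mulr0n add0r expr0 mul1r ler_nat.
have E : p *+ l.+1 + N = p *+ l + N + p by rewrite mulrSr addrAC.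
have one (a : deg r) : (size (wds L a))%:R = \sum_(w <- wds L a) 1 :> R.
  by rewrite big_const_seq count_predT iter_addr_0.
rewrite E one.
apply: le_trans (words_sum_le Lrow Lfin (G := fun=> 1) _ _ (fun=> ler01)) _.
rewrite -one exprS -mulrA ler_pM ?ler_nat//.
Qed.

Lemma ncP_le_top (Omega : set O) (eps : R) : finite_set Omega -> 0 < eps ->
  (ncP theta ft Omega eps <= top_pressure d f T)%E.
Proof.
move=> Of eps0; apply/lee_addgt0Pr => de de0.
have [tau tauP] := object_states.
(* One e each pays for approximating [ft], for approximating f, and for the constants W and M. *)
have [e [e0 deE]] : exists e : R, 0 < e /\ de = 3 * e.
  by exists (de / 3); rewrite divr_gt0//; split=> //; rewrite mulrC divfK.
have [m hm] := diagonal_approx Lrow Lfin Laper sF sgen kappaP ftC ftf e0.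
(* N >= p, as [Zsum_le_topQ] demands. *)
have [c [ftc fc]] := hm (p + m) ltac:(by rewrite addrC le_deg_addr).
set N := p + m in ftc fc.
have [W W0 hW] := ncZ_upper Lrow Lfin sF sgen s1 p tauP Of eps0 ftC ftsa (ltW ftc).
have [ep ep0 hep] := small_cylinder Lrow Lfin dP N.
have [M [M0 U2]] : exists M : R, 0 <= M /\ forall n, Zsum p N c n.+1 <= M * Zsum p N c n.
  eexists; split; last by move=> n; exact: ZsumS_le.
  by rewrite mulr_ge0 ?expR_ge0.
have [n0 hn0] := const_le_exp (W * M * expR e) e0.
apply: (@le_trans _ _ ((3 * e)%:E + rate (fun n => topQ d f T n ep))%E); last first.
  rewrite -deE addeC leeD2r// top_pressureE; apply: ereal_sup_ubound.
  by exists ep.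
apply: (@rate_le _ _ _ _ (maxn 1 n0)) => [n|n]; first exact: topQ_ge0.
rewrite geq_max => /andP[n1 nn0]; case: n n1 nn0 => // n _ nn0.
apply: le_trans (hW n.+1) _.
have U3 := Zsum_le_topQ Lrow Lfin cyl (fun x => ltW (fc x)) n erefl hep.
have Z0 (k : nat) : 0 <= Zsum p N c k by apply: sumr_ge0 => w _; exact: expR_ge0.
apply: (@le_trans _ _ ((expR (3 * e * n.+1%:R))%:E *
    (Zsum p N c n * expR (- (n.+1%:R * e)))%:E)%E); last first.
  by rewrite lee_wpmul2l// lee_fin expR_ge0.
rewrite -EFinM lee_fin.
apply: (@le_trans _ _ (W * expR (n.+2%:R * e) * (M * Zsum p N c n))).
  rewrite ler_wpM2l//; first by rewrite mulr_ge0 ?expR_ge0.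
rewrite [leRHS]mulrCA [leLHS](_ : _ = Zsum p N c n * (W * M * expR (n.+2%:R * e))); last by ring.
rewrite ler_wpM2l// -expRD.
have -> : n.+2%:R * e = e + n.+1%:R * e by rewrite -natr1 mulrDl mul1r addrC.
rewrite expRD mulrA; apply: le_trans (ler_wpM2r (expR_ge0 _) (hn0 _ nn0)) _.
by rewrite -expRD ler_expR; lra.
Qed.

Lemma top_le_nc (ep : R) : 0 < ep ->
  (rate (fun n => topQ d f T n ep) <= nc_pressure theta ft)%E.
Proof.
move=> ep0; apply/lee_addgt0Pr => de de0.
have [tau tauP] := object_states.
(* Of the six e, one pays for approximating f, two for e + eps, two for the loss and one for the
   constants. *)
have [e [e0 deE]] : exists e : R, 0 < e /\ de = 6 * e.
  by exists (de / 6); rewrite divr_gt0//; split=> //; rewrite mulrC divfK.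
have [k hk] := cylinder_small Lrow Lfin dP ep0.
have [m hm] := diagonal_approx Lrow Lfin Laper sF sgen kappaP ftC ftf e0.
have [c [ftc fc]] := hm (m + dconst r k) (le_deg_addr _ _).
set N := m + dconst r k in ftc fc.
have small x y : sg x 0 N = sg y 0 N -> d x y <= ep.
  move=> xy; apply: hk; apply: (sg_agree xy); first exact: le0_deg.
  by rewrite /N addrC le_deg_addr.
have [eps [l [eps0 eps1 epse l0 hl]]] :=
  @loss_small R (size (wds L p)).+1%:R (size (wds L N)).+1%:R _ (ler1n _ _) (ler1n _ _) e0.
have [Om Omf hO] := ncZ_lower Lrow Lfin Lsrc sF sgen s1 p tauP ftsa (ltW ftc) l0 eps0 eps1.
set ls := loss _ _ in hO.
have ls2 : ls <= 2 * e * l%:R by apply: hl; exact: size_words_le.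
have ls0 : 0 <= ls by exact: loss_ge0.
pose B := \sum_(w <- wds L N) `|c w|.
have [n0 hn0] := const_le_exp (expR (B + 2 * e + ls)) e0.
apply: (@le_trans _ _ ((6 * e)%:E + rate (ncZ theta ft Om eps))%E); last first.
  rewrite -deE addeC leeD2r//; apply: ereal_sup_ubound.
  by exists eps, Om.
have Z0 (j : nat) : 0 <= Zsum p N c j by apply: sumr_ge0 => w _; exact: expR_ge0.
apply: (@rate_le _ _ _ _ (maxn 1 n0)) => [n|n].
  by apply: le_trans (hO n); rewrite lee_fin mulr_ge0 ?expR_ge0.
rewrite geq_max => /andP[n1 nn0]; case: n n1 nn0 => // n _ nn0.
apply: le_trans (topQ_le_Zsum Lrow Lfin cyl p (fun x => ltW (fc x)) n ep0 small) _.
set E := n.+2%:R * (e + eps) + (n.+1 %/ l).+1%:R * ls.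
apply: (@le_trans _ _ ((expR (6 * e * n.+1%:R))%:E *
    (Zsum p N c n.+1 * expR (- E))%:E)%E); last first.
  by rewrite lee_wpmul2l ?hO// lee_fin expR_ge0.
rewrite -EFinM lee_fin.
apply: (@le_trans _ _ (expR (n.+1%:R * e) * (expR B * Zsum p N c n.+1))).
  by rewrite ler_wpM2l ?expR_ge0//; exact: ZsumS_ge.
rewrite [leRHS]mulrCA [leLHS](_ : _ = Zsum p N c n.+1 * (expR (n.+1%:R * e) * expR B)); last by ring.
rewrite ler_wpM2l// -!expRD ler_expR.
have h1 : B + 2 * e + ls <= e * n.+1%:R by have := hn0 _ nn0; rewrite ler_expR.
have h2 : (n.+1 %/ l).+1%:R * ls <= 2 * e * n.+1%:R + ls.
  rewrite -natr1 mulrDl mul1r lerD2r; apply: le_trans (ler_wpM2l _ ls2) _ => //.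
  rewrite mulrCA -natrM ler_wpM2l ?ler_nat ?leq_divM//.
  by rewrite mulr_ge0// ltW.
have h3 : n.+2%:R * (e + eps) <= 2 * e * n.+1%:R + 2 * e.
  rewrite -natr1 [leRHS](_ : _ = (n.+1%:R + 1) * (e + e)); last by ring.
  by rewrite ler_wpM2l ?lerD2l// addr_ge0.
by rewrite /E; lra.
Qed.

End Assembly.

Theorem theorem2p4 (R : realType) (r : nat) (L : kGraph r)
    (Lrow : row_finite L) (Lfin : finite_set (objects L))
    (Lsrc : no_sources L) (Laper : aperiodic L)
    (O : cStarAlgType R) (s : L -> O) (Os : graph_algebra s)
    (kappa : O -> infpath L -> R[i]^o) (kappaP : diagonal_iso s kappa)
    (d : infpath L -> infpath L -> R) (dP : compatible_metric d)
    (ft : O) (ftC : diag_alg s ft) (ftsa : star ft = ft)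
    (f : infpath L -> R) (fcont : continuous f)
    (ftf : forall x, kappa ft x = (f x)%:C)
    (p : deg r) :
  nc_pressure (canonical_shift s p) ft = top_pressure d f (path_shift p).
Proof.
have [sF sgen _] := Os.
apply/eqP; rewrite eq_le; apply/andP; split.
  apply: ge_ereal_sup => _ [eps [Om [e0 Omf ->]]].
  exact: (ncP_le_top Lrow Lfin Laper sF sgen kappaP dP).
rewrite top_pressureE; apply: ge_ereal_sup => _ [ep /= ep0 <-].
exact: (top_le_nc Lrow Lfin Lsrc Laper sF sgen kappaP dP).
Qed.
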